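(* Let $f\colon\mathbb N\to\mathbb U$ be a pretentious multiplicative function. Then every Furstenberg system of $f$ for Cesàro or logarithmic averages has rational discrete spectrum. As a consequence, every such system has zero entropy and does not have irrational spectrum (its spectrum contains no irrational number).
   Context: $\mathbb N=\{1,2,\ldots\}$, $\mathbb P$ is the set of primes, $\mathbb U$ is the closed complex unit disc, $e(t)=e^{2\pi i t}$, $[N]=\{1,\ldots,N\}$. A function $f\colon\mathbb N\to\mathbb U$ is multiplicative if $f(mn)=f(m)f(n)$ whenever $(m,n)=1$. For multiplicative $f,g\colon\mathbb N\to\mathbb U$ let $\mathbb D^2(f,g)=\sum_{p\in\mathbb P}\frac1p\big(1-\mathrm{Re}(f(p)\overline{g(p)})\big)$ and write $f\sim g$ if $\mathbb D(f,g)<+\infty$. $f$ is pretentious if $f\sim n^{it}\cdot\chi$ for some $t\in\mathbb R$ and some primitive Dirichlet character $\chi$ (the constant $\chi=1$, with conductor $1$, is regarded as primitive). For a finite non-empty $A\subset\mathbb N$, $\mathbb E_{n\in A}a(n)=\frac1{|A|}\sum_{n\in A}a(n)$ (Cesàro average) and $\mathbb E^{\log}_{n\in A}a(n)=\big(\sum_{n\in A}\frac1n\big)^{-1}\sum_{n\in A}\frac{a(n)}n$ (logarithmic average); these also act on measures. Let $X=\mathbb U^{\mathbb Z}$ with the product topology and let $T\colon X\to X$ be the shift $(Tx)(k)=x(k+1)$. A sequence $a\colon\mathbb N\to\mathbb U$ is extended to $\mathbb Z$ arbitrarily (the extension does not matter) and viewed as a point of $X$. If $(N_k)$ is a strictly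 increasing sequence of positive integers and the weak-star limit $\mu=\lim_{k\to\infty}\mathbb E_{n\in[N_k]}\delta_{T^na}$ exists, then $(X,\mu,T)$ is called the Furstenberg system of $a$ along $(N_k)$ for Cesàro averages. With $\mathbb E^{\log}$ in place of $\mathbb E$ one gets the Furstenberg system of $a$ along $(N_k)$ for logarithmic averages. A Furstenberg system of $a$ is one obtained along some $(N_k)$. The spectrum of a system $(X,\mu,T)$ is the set of $\alpha\in[0,1)$ for which there is a non-zero $g\in L^2(\mu)$ with $g\circ T=e(\alpha)\,g$; such $g$ is an eigenfunction and $e(\alpha)$ an eigenvalue, rational if $\alpha\in\mathbb Q$. The system has rational discrete spectrum if $L^2(\mu)$ is spanned (in the closed linear sense) by eigenfunctions with rational eigenvalues. *)

(* Defs.v *)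
From HB Require Import structures.
From mathcomp Require Import all_boot all_order all_algebra.
From mathcomp Require Import complex.
From mathcomp Require Import all_classical all_reals all_analysis.
From mathcomp Require Import measurable_realfun.

Set Implicit Arguments.
Unset Strict Implicit.
Unset Printing Implicit Defensive.

Import Order.TTheory GRing.Theory Num.Theory.
Import numFieldNormedType.Exports.

Local Open Scope classical_set_scope.
Local Open Scope complex_scope.
Local Open Scope ring_scope.

(* [R[i]] itself carries no topology in the library; its regular module
   [R[i]^o] carries the topology of the modulus. *)
Definition unit_disc (R : realType) : set (R[i]^o) :=
  [set z | `|z : R[i]| <= 1].

Definition disc (R : realType) : Type := set_type (@unit_disc R).

HB.instance Definition _ (R : realType) :=
  Topological.copy (disc R) (set_type (@unit_disc R)).

Definition disc0 (R : realType) : disc R.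
Proof. by exists 0; apply/mem_set; rewrite /unit_disc /= normr0 ler01. Defined.

HB.instance Definition _ (R : realType) :=
  isPointed.Build (disc R) (disc0 R).

Definition disc_val (R : realType) (z : disc R) : R[i] := val z.
Coercion disc_val : disc >-> complex.

Section ComplexExponentials.
Context {R : realType}.

Definition cis (t : R) : R[i] := cos t +i* sin t.

(* e(t) = exp(2 pi i t) *)
Definition expi2pi (t : R) : R[i] := cis (2 * pi * t).

(* n^{it} = exp(i t log n), for n > 0 *)
Definition nat_powi (t : R) (n : nat) : R[i] := cis (t * ln n%:R).

End ComplexExponentials.

(* Functions on N = {1, 2, ...} are functions on [nat] whose value at 0 plays
   no role. *)
Section PretentiousFunctions.
Context {R : realType}.

Definition multiplicative_fun (f : nat -> R[i]) : Prop :=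
  forall m n, (0 < m)%N -> (0 < n)%N -> coprime m n ->
    f (m * n)%N = f m * f n.

Definition pret_dist2 (f g : nat -> R[i]) : \bar R :=
  (\sum_(0 <= p <oo | prime p)
     (p%:R^-1 * (1 - complex.Re (f p * conjc (g p))))%:E)%E.

Definition pret_dist (f g : nat -> R[i]) : \bar R := sqrte (pret_dist2 f g).

Definition pret_sim (f g : nat -> R[i]) : Prop := (pret_dist f g < +oo)%E.

Definition dirichlet_character (q : nat) (chi : nat -> R[i]) : Prop :=
  [/\ (0 < q)%N,
      forall m n, chi (m * n)%N = chi m * chi n,
      forall n, chi (n + q)%N = chi n
    & forall n, (chi n != 0) = coprime n q].

(* Primitive: not induced by a character of smaller modulus. The only character
   of modulus 1 is the constant 1, and it is primitive. *)
Definition primitive_character (q : nat) (chi : nat -> R[i]) : Prop :=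
  dirichlet_character q chi /\
  forall d psi, (d %| q)%N -> (d < q)%N -> dirichlet_character d psi ->
    ~ (forall n, coprime n q -> chi n = psi n).

Definition pretentious (f : nat -> R[i]) : Prop :=
  exists (t : R) (q : nat) (chi : nat -> R[i]),
    primitive_character q chi /\
    pret_sim f (fun n => nat_powi t n * chi n).

End PretentiousFunctions.

Section SpectrumAndEntropy.
Context {R : realType} {d : measure_display} {T : measurableType d}.
Variables (mu : probability T R) (S : T -> T).

Definition L2norm (g : T -> R[i]) : \bar R :=
  ('N[mu]_2%:E[EFin \o (fun x => ComplexField.Normc.normc (g x))])%E.

Definition in_L2 (g : T -> R[i]) : Prop :=
  [/\ measurable_fun setT (fun x => complex.Re (g x)),
      measurable_fun setT (fun x => complex.Im (g x))
    & (L2norm g < +oo)%E].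

Definition eigenfunction (alpha : R) (g : T -> R[i]) : Prop :=
  [/\ in_L2 g,
      ~ {ae mu, forall x, g x = 0}
    & {ae mu, forall x, g (S x) = expi2pi alpha * g x}].

Definition spectrum : set R :=
  [set alpha | 0 <= alpha < 1 /\ exists g, eigenfunction alpha g].

Definition rational_discrete_spectrum : Prop :=
  forall h, in_L2 h -> forall eps : R, 0 < eps ->
    exists (n : nat) (c : 'I_n -> R[i]) (g : 'I_n -> T -> R[i]),
      (forall i, exists alpha,
         [/\ 0 <= alpha < 1, rational alpha & eigenfunction alpha (g i)]) /\
      (L2norm (fun x => (h x - \sum_(i < n) c i * g i x)%R) < eps%:E)%E.

Definition measurable_partition (I : finType) (A : I -> set T) : Prop :=
  [/\ forall i, measurable (A i), trivIset setT A & \bigcup_i A i = setT].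

Definition partition_entropy (I : finType) (A : I -> set T) : R :=
  - \sum_(i : I) fine (mu (A i)) * ln (fine (mu (A i))).

(* The common refinement of A, S^{-1} A, ..., S^{-(n-1)} A. *)
Definition dynamical_join (I : finType) (A : I -> set T) (n : nat)
    (w : {ffun 'I_n -> I}) : set T :=
  [set x | forall j : 'I_n, A (w j) (iter j S x)].

Definition entropy_rate (I : finType) (A : I -> set T) : \bar R :=
  limn (fun n => (partition_entropy (dynamical_join A (n := n)) / n%:R)%:E).

(* Kolmogorov-Sinai entropy *)
Definition ks_entropy : \bar R :=
  ereal_sup [set h | exists (k : nat) (A : 'I_k -> set T),
    measurable_partition A /\ h = entropy_rate A].

End SpectrumAndEntropy.

Variant averaging := Cesaro | Logarithmic.

Section FurstenbergSystems.
Context {R : realType}.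

(* U^Z with the product topology, and the same space with its Borel
   sigma-algebra. *)
Definition seqspace : topologicalType := {ptws int -> disc R}.
Definition borel_seqspace : measurableType (@open seqspace).-sigma :=
  g_sigma_algebraType (@open {ptws int -> disc R}).

Definition seq_shift (x : borel_seqspace) : borel_seqspace := fun k => x (k + 1).

Lemma harmonic_inv_ge0 (N : nat) : 0 <= (\sum_(n < N) n.+1%:R^-1)^-1 :> R.
Proof. by rewrite invr_ge0 sumr_ge0. Qed.

(* E_{n in [N]} nu_n; the summation index of [msum] starts at 0. *)
Definition avg_measure (m : averaging)
    (nu : nat -> {measure set borel_seqspace -> \bar R}) (N : nat) :
    {measure set borel_seqspace -> \bar R} :=
  match m with
  | Cesaro => mscale (N%:R^-1)%:nng (msum (fun n => nu n.+1) N)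
  | Logarithmic =>
      mscale (NngNum (harmonic_inv_ge0 N))
        (msum (fun n => mscale (n.+1%:R^-1)%:nng (nu n.+1)) N)
  end.

Definition weak_star_cvg
    (nu : nat -> {measure set borel_seqspace -> \bar R})
    (mu : {measure set borel_seqspace -> \bar R}) : Prop :=
  forall F : seqspace -> R, continuous F ->
    (\int[nu k]_x F x)%R @[k --> \oo] --> (\int[mu]_x F x)%R.

Definition furstenberg_system (m : averaging) (f : nat -> disc R)
    (mu : probability borel_seqspace R) : Prop :=
  exists (a : borel_seqspace) (N : nat -> nat),
    [/\ forall n : nat, (0 < n)%N -> a n%:Z = f n,
        forall k, (0 < N k)%N,
        {homo N : i j / (i < j)%N}
      & weak_star_cvg
          (fun k => avg_measure m (fun n => \d_(iter n seq_shift a)) (N k)) mu].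

End FurstenbergSystems.

(* Main.v *)
Require Import Defs.
From mathcomp Require Import all_boot all_order all_algebra.
From mathcomp Require Import complex.
From mathcomp Require Import all_classical all_reals all_analysis.
From mathcomp Require Import measurable_realfun.
From mathcomp Require Import cyclic.
From mathcomp Require Import zify ring lra.
Import Order.TTheory GRing.Theory Num.Theory.
Import numFieldNormedType.Exports HBSimple.
Local Open Scope classical_set_scope.
Local Open Scope ring_scope.

Set Implicit Arguments.
Unset Strict Implicit.
Unset Printing Implicit Defensive.

(** A pretentious function is almost periodic in mean with integer periods, and
this single property passes to every Furstenberg system and forces its spectrum
to be rational and its entropy to vanish.

Arithmetic ([pretentious_almost_periodic]). Let [f] be at finite distance from
[g n = n^(it) chi n], with [chi] of modulus [q]. For every [eps] there is a [Q]
such that, for every [k], the mean of [|f (n + Q k) - f n|] is at most [eps] in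
the limit. Split [n] into the part made of primes up to [K] and the rest, its
rough part. Up to few exceptional [n],
[f n = f (smooth part) * g (rough part) * H n], where [H n] is the product of
[f p * conj (g p)] over the primes [p > K] dividing [n]
([multiplicative_decomposition]). If [Q] is [q] times a high power of the
primorial of [K], a shift by [Q k] keeps the smooth part of [n] and the residue
of its rough part modulo [q] ([shift_parts]), and [n^(it)] varies slowly; so the
first two factors hardly change. The third is concentrated: since the tail of
[pret_dist2 f g] beyond [K] is small, [H] is close in mean on [[1, M]] to a
constant that may depend on [M] ([concentration], from [turan_kubilius] and
[sum_inv_large_primes]), and both [n] and [n + Q k] lie in the same interval.

Transfer. The [L1]-distance of a coordinate of the sequence space to its [Q k]-th
translate is the integral of a continuous function, hence a limit of averages of
the quantities above; a bound for Cesaro sums carries over to logarithmic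
averages by summation by parts ([weak_limit_le]). So the coordinates are
rationally almost periodic ([rap]): for every [eps] there is one [Q] such that
all translates by multiples of [Q] are [eps]-close. This property survives
Lipschitz operations and bounded pointwise limits, and the measurable sets whose
indicators have it form a sigma-algebra; as the half-spaces defined by the
coordinates generate the Borel sets, every measurable set has it ([rap_borel]).

Consequences, for any measure-preserving map all of whose measurable sets are
rationally almost periodic. Averaging along a chain of better and better periods
approximates a bounded function by one invariant under a power of the map
([invariant_approx]); the latter is a finite sum of eigenfunctions with roots of
unity as eigenvalues, which yields [rap_rational_discrete_spectrum]. An
eigenfunction with irrational eigenvalue [z] would return close to itself along
the powers of [z ^+ Q], one of which is far from 1; this is
[rap_no_irrational_spectrum]. A long orbit segment is coded by its first period
and the rare places where it fails to repeat that period, so entropy rates are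
arbitrarily small ([rap_ks_entropy_eq0]). *)

(** * The modulus on [R[i]] and the complex exponential *)

(** The modulus as a real number; the norm of [R[i]] takes its values in [R[i]]. *)
Definition nc {R : realType} (z : R[i]) : R := ComplexField.Normc.normc z.

Section Modulus.
Context {R : realType}.
Implicit Types (z w : R[i]) (x y : R).

Lemma nc_sqr z : nc z ^+ 2 = complex.Re z ^+ 2 + complex.Im z ^+ 2.
Proof. by case: z => a b; rewrite /nc /= sqr_sqrtr // addr_ge0 ?sqr_ge0. Qed.

Lemma nc_ge0 z : 0 <= nc z.
Proof. by case: z => a b; exact: sqrtr_ge0. Qed.

Lemma ncD z w : nc (z + w) <= nc z + nc w.
Proof. exact: (@le_normcD R z w). Qed.

Lemma ncN z : nc (- z) = nc z.
Proof. exact: (@normcN R z). Qed.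

Lemma ncB z w : nc (z - w) <= nc z + nc w.
Proof. by rewrite -(ncN w); exact: ncD. Qed.

Lemma nc_distC z w : nc (z - w) = nc (w - z).
Proof. by rewrite -ncN opprB. Qed.

Lemma nc_tri w z u : nc (z - u) <= nc (z - w) + nc (w - u).
Proof. by have := ncD (z - w) (w - u); rewrite addrA subrK. Qed.

Lemma ncM z w : nc (z * w) = nc z * nc w.
Proof. exact: ComplexField.Normc.normcM. Qed.

Lemma nc0 : nc (0 : R[i]) = 0.
Proof. exact: ComplexField.Normc.normc0. Qed.

Lemma nc1 : nc (1 : R[i]) = 1.
Proof. exact: ComplexField.Normc.normc1. Qed.

Lemma nc_conj z : nc (conjc z) = nc z.
Proof. by case: z => a b; rewrite /nc /= sqrrN. Qed.

Lemma nc_ler_sqr z x : 0 <= x -> nc z ^+ 2 <= x ^+ 2 -> nc z <= x.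
Proof. by move=> x0; rewrite ler_sqr // nnegrE ?nc_ge0. Qed.

Lemma nc_ge_Re z : `|complex.Re z| <= nc z.
Proof.
rewrite -ler_sqr ?nnegrE ?nc_ge0 // nc_sqr real_normK ?num_real //.
by rewrite lerDl sqr_ge0.
Qed.

Lemma nc_ge_Im z : `|complex.Im z| <= nc z.
Proof.
rewrite -ler_sqr ?nnegrE ?nc_ge0 // nc_sqr real_normK ?num_real //.
by rewrite lerDr sqr_ge0.
Qed.

Lemma nc_le_ReIm z : nc z <= `|complex.Re z| + `|complex.Im z|.
Proof.
apply: nc_ler_sqr; first by rewrite addr_ge0.
by rewrite nc_sqr sqrrD !real_normK ?num_real // addrAC lerDl mulrn_wge0 // mulr_ge0.
Qed.

Lemma nc_sum (I : Type) (r : seq I) (P : pred I) (F : I -> R[i]) :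
  nc (\sum_(i <- r | P i) F i) <= \sum_(i <- r | P i) nc (F i).
Proof.
elim/big_rec2: _ => [|i x z _ ih]; first by rewrite nc0.
by rewrite (le_trans (ncD _ _)) // lerD2l.
Qed.

Lemma nc_eq0 z : nc z = 0 -> z = 0.
Proof. exact: ComplexField.Normc.eq0_normc. Qed.

Lemma ReB z w : complex.Re (z - w) = complex.Re z - complex.Re w.
Proof. by case: z w => a b []. Qed.

Lemma ImB z w : complex.Im (z - w) = complex.Im z - complex.Im w.
Proof. by case: z w => a b []. Qed.

Lemma ReD z w : complex.Re (z + w) = complex.Re z + complex.Re w.
Proof. by case: z w => a b []. Qed.

Lemma ImD z w : complex.Im (z + w) = complex.Im z + complex.Im w.
Proof. by case: z w => a b []. Qed.

Lemma Re_sum (I : Type) (r : seq I) (P : pred I) (F : I -> R[i]) :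
  complex.Re (\sum_(i <- r | P i) F i) = \sum_(i <- r | P i) complex.Re (F i).
Proof. by elim/big_rec2: _ => // i x z _ <-; rewrite ReD. Qed.

Lemma Im_sum (I : Type) (r : seq I) (P : pred I) (F : I -> R[i]) :
  complex.Im (\sum_(i <- r | P i) F i) = \sum_(i <- r | P i) complex.Im (F i).
Proof. by elim/big_rec2: _ => // i x z _ <-; rewrite ImD. Qed.

Lemma nc_real x : nc (x%:C)%C = `|x|.
Proof. by rewrite /nc /= expr0n /= addr0 sqrtr_sqr. Qed.

Lemma nc_sub1_sqr z : nc z <= 1 -> nc (z - 1) ^+ 2 <= 2 * (1 - complex.Re z).
Proof.
move=> z1; have : nc z ^+ 2 <= 1 by rewrite expr_le1 ?nc_ge0.
by rewrite !nc_sqr ReB ImB /= => h; nra.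
Qed.

Lemma nc_Re_le1 z : nc z <= 1 -> complex.Re z <= 1.
Proof. by move=> z1; rewrite (le_trans (ler_norm _)) // (le_trans (nc_ge_Re z)). Qed.

Lemma disc_nc_le1 (z : disc R) : nc (disc_val z) <= 1.
Proof.
rewrite /disc_val; have := set_valP z; rewrite /unit_disc /= normc_def.
by rewrite -[1 in X in X -> _]/(1%:C)%C lecR => h; case: (sval z) h.
Qed.

Lemma ncJ z : nc z = 1 -> z * conjc z = 1.
Proof.
move=> z1; have := nc_sqr z; rewrite z1 expr1n; case: z z1 => a b /= _ h.
by apply/eqP; rewrite eq_complex /= mulrN opprK -!expr2 -h eqxx /= mulrC; apply/eqP; ring.
Qed.

End Modulus.

Section ComplexExponential.
Context {R : realType}.
Implicit Types (x y : R) (z w : R[i]).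

Lemma abs_sin_le y : `|sin y| <= `|y|.
Proof.
wlog y0 : y / 0 <= y.
  move=> h; have [/h//|/ltW y0] := leP 0 y.
  by rewrite -normrN -sinN -[leRHS]normrN; apply: h; rewrite oppr_ge0.
have [c _] := @MVT_segment R sin cos 0 y y0 (fun x _ => is_derive_sin x)
  (continuous_subspaceT (@continuous_sin R)).
rewrite sin0 !subr0 => ->; rewrite normrM ler_piMl // ler_norml.
by rewrite cos_geN1 cos_le1.
Qed.

Lemma cos_ge1Bsqr y : 1 - y ^+ 2 / 2 <= cos y.
Proof.
have -> : cos y = 1 - 2 * sin (y / 2) ^+ 2.
  rewrite {1}(_ : y = y / 2 + y / 2); last by field.
  by rewrite cosD; have := cos2Dsin2 (y / 2) => h; rewrite -!expr2; lra.
have := abs_sin_le (y / 2); rewrite -ler_sqr ?nnegrE // !real_normK ?num_real //.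
by rewrite exprMn => h; lra.
Qed.

Lemma dist_sin x y : `|sin x - sin y| <= `|x - y|.
Proof.
wlog xy : x y / y <= x.
  move=> h; have [/h//|/ltW yx] := leP y x.
  by rewrite distrC [leRHS]distrC; exact: h.
have [c _ ->] := @MVT_segment R sin cos y x xy (fun x _ => is_derive_sin x)
  (continuous_subspaceT (@continuous_sin R)).
by rewrite normrM ler_piMl // ler_norml cos_geN1 cos_le1.
Qed.

Lemma dist_cos x y : `|cos x - cos y| <= `|x - y|.
Proof.
by rewrite -!sinDpihalf (le_trans (dist_sin _ _)) // opprD addrACA subrr addr0.
Qed.

Lemma sin_sub_id y : `|sin y - y| <= y ^+ 2.
Proof.
wlog y0 : y / 0 <= y.
  move=> h; have [/h//|/ltW y0] := leP 0 y.
  have := h (- y); rewrite sinN sqrrN -opprD normrN; apply.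
  by rewrite oppr_ge0.
have [c] := @MVT_segment R sin cos 0 y y0 (fun x _ => is_derive_sin x)
  (continuous_subspaceT (@continuous_sin R)).
rewrite in_itv /= => /andP[c0 cy]; rewrite sin0 !subr0 => ->.
rewrite -{2}(mul1r y) -mulrBl normrM (ger0_norm y0) expr2 ler_wpM2r //.
rewrite -(cos0) (le_trans (dist_cos _ _)) // subr0 ger0_norm //.
Qed.

Lemma dist_expR x y : x <= 0 -> y <= 0 -> `|expR x - expR y| <= `|x - y|.
Proof.
move=> x0 y0; wlog xy : x y x0 y0 / y <= x.
  move=> h; have [yx|/ltW yx] := leP y x; first exact: h.
  by rewrite distrC [leRHS]distrC; exact: h.
rewrite !ger0_norm ?subr_ge0 ?ler_expR //.
have := expR_ge1Dx (y - x); rewrite expRD expRN => h.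
have e1 : expR x <= 1 by rewrite expR_le1.
have e0 := expR_gt0 x.
have : (1 + (y - x)) * expR x <= expR y.
  by rewrite -ler_pdivlMr // mulrC.
by nra.
Qed.

Lemma expR_sub_affine x : x <= 0 -> `|expR x - 1 - x| <= x ^+ 2.
Proof.
move=> x0; have h1 := expR_ge1Dx x.
rewrite ger0_norm; last by lra.
have h2 := expR_ge1Dx (- x).
have e0 := expR_gt0 x.
have : (1 - x) * expR x <= 1.
  by rewrite -ler_pdivlMr // div1r -expRN.
move=> h3; nra.
Qed.

Definition cexp z : R[i] := (expR (complex.Re z))%:C%C * cis (complex.Im z).

Lemma ReM_cexp z : complex.Re (cexp z) = expR (complex.Re z) * cos (complex.Im z).
Proof. by rewrite /cexp /cis /= mul0r subr0. Qed.

Lemma ImM_cexp z : complex.Im (cexp z) = expR (complex.Re z) * sin (complex.Im z).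
Proof. by rewrite /cexp /cis /= mul0r addr0. Qed.

Lemma cisD x y : cis (x + y) = cis x * cis y :> R[i].
Proof.
rewrite /cis cosD sinD; apply/eqP; rewrite eq_complex /= eqxx /=.
by apply/eqP; ring.
Qed.

Lemma nc_cis x : nc (cis x : R[i]) = 1.
Proof. by rewrite /nc /cis /= cos2Dsin2 sqrtr1. Qed.

Lemma dist_cis x y : nc (cis x - cis y : R[i]) <= 2 * `|x - y|.
Proof.
rewrite (le_trans (nc_le_ReIm _)) // ReB ImB /= mulr2n mulrDl mul1r.
by rewrite lerD // ?dist_cos ?dist_sin.
Qed.

Lemma cexpD z w : cexp (z + w) = cexp z * cexp w.
Proof. by rewrite /cexp ReD ImD expRD cisD rmorphM; ring. Qed.

Lemma cexp0 : cexp 0 = 1.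
Proof.
by rewrite /cexp /cis /= expR0 cos0 sin0 mul1r.
Qed.

Lemma nc_cexp z : nc (cexp z) = expR (complex.Re z).
Proof. by rewrite ncM nc_cis mulr1 nc_real ger0_norm ?expR_ge0. Qed.

Lemma nc_cexp_le1 z : complex.Re z <= 0 -> nc (cexp z) <= 1.
Proof. by rewrite nc_cexp expR_le1. Qed.

Lemma dist_cexp z w : complex.Re z <= 0 -> complex.Re w <= 0 ->
  nc (cexp z - cexp w) <= 4 * nc (z - w).
Proof.
move=> z0 w0.
set x := expR (complex.Re z); set y := expR (complex.Re w).
set s := cis (complex.Im z); set t := cis (complex.Im w).
have -> : cexp z - cexp w = (x - y)%:C%C * s + y%:C%C * (s - t).
  by rewrite /cexp -/x -/y -/s -/t rmorphB /=; ring.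
rewrite (le_trans (ncD _ _)) // !ncM nc_cis mulr1 !nc_real.
have h1 := dist_expR z0 w0.
have h2 := dist_cis (complex.Im z) (complex.Im w).
have h3 := nc_ge_Re (z - w); have h4 := nc_ge_Im (z - w).
rewrite ReB in h3; rewrite ImB in h4.
have y1 : `|y| <= 1 by rewrite ger0_norm ?expR_ge0 // expR_le1.
have : `|y| * nc (s - t) <= nc (s - t) by rewrite ler_piMl // nc_ge0.
rewrite -/x -/y in h1; rewrite -/s -/t in h2.
by have := nc_ge0 (z - w); lra.
Qed.

Lemma cexp_sub_affine w : complex.Re w <= 0 ->
  nc (1 + w - cexp w) <= 3 * nc w ^+ 2.
Proof.
move=> w0; rewrite (le_trans (nc_le_ReIm _)) // ReB ImB ReM_cexp ImM_cexp ReD ImD nc_sqr.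
move: w0; case: w => x y /= x0; rewrite add0r.
have h1 := expR_sub_affine x0; have h2 := cos_ge1Bsqr y; have h2' := cos_le1 y.
have h3 := sin_sub_id y; have h4 := abs_sin_le y.
have e1 : expR x <= 1 by rewrite expR_le1.
have e0 := expR_gt0 x.
have h5 : `|expR x - 1| <= `|x|.
  by have := dist_expR x0 (lexx 0); rewrite expR0 subr0.
have a1 : `|1 + x - expR x * cos y| <= x ^+ 2 + y ^+ 2 / 2.
  have -> : 1 + x - expR x * cos y = - (expR x - 1 - x) + expR x * (1 - cos y) by ring.
  rewrite (le_trans (ler_normD _ _)) // normrN lerD // normrM ger0_norm ?expR_ge0 //.
  rewrite ger0_norm ?subr_ge0 //.
  have : 0 <= 1 - cos y by lra.
  nra.
have a2 : `|y - expR x * sin y| <= y ^+ 2 + `|x| * `|y|.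
  have -> : y - expR x * sin y = - (sin y - y) + (1 - expR x) * sin y by ring.
  rewrite (le_trans (ler_normD _ _)) // normrN lerD // normrM distrC.
  exact: ler_pM.
have : `|x| * `|y| <= (x ^+ 2 + y ^+ 2) / 2.
  rewrite -(real_normK (num_real x)) -(real_normK (num_real y)).
  by have := sqr_ge0 (`|x| - `|y|); rewrite sqrrB; lra.
have := sqr_ge0 x; have := sqr_ge0 y; lra.
Qed.

(** A product of numbers of the closed disc near 1 is close to the exponential
of the sum of the [z i - 1], with an error that is quadratic in each factor:
this replaces taking logarithms, which need not exist for [z i = 0]. *)
Lemma prod_near_cexp (I : Type) (r : seq I) (P : pred I) (z : I -> R[i]) :
  (forall i, P i -> nc (z i) <= 1) ->
  nc (\prod_(i <- r | P i) z i - cexp (\sum_(i <- r | P i) (z i - 1)))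
    <= 3 * \sum_(i <- r | P i) nc (z i - 1) ^+ 2.
Proof.
move=> z1; pose S := \sum_(i <- r | P i) (z i - 1).
suff : [/\ nc (\prod_(i <- r | P i) z i) <= 1,
  complex.Re (\sum_(i <- r | P i) (z i - 1)) <= 0 &
  nc (\prod_(i <- r | P i) z i - cexp (\sum_(i <- r | P i) (z i - 1)))
    <= 3 * \sum_(i <- r | P i) nc (z i - 1) ^+ 2] by case.
elim: r {S} => [|i r [ih1 ih2 ih3]].
  rewrite !big_nil nc1; split => //.
  by rewrite cexp0 subrr nc0 mulr0.
rewrite !big_cons; case: ifPn => // Pi.
have zi := z1 _ Pi.
have Rzi : complex.Re (z i - 1) <= 0 by rewrite ReB subr_le0 nc_Re_le1.
split; [by rewrite ncM mulr_ile1 ?nc_ge0|by rewrite ReD; lra|].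
set p := \prod_(j <- r | P j) z j in ih1 ih3 *.
set S := \sum_(j <- r | P j) (z j - 1) in ih2 ih3 *.
rewrite cexpD.
have -> : z i * p - cexp (z i - 1) * cexp S =
    (1 + (z i - 1) - cexp (z i - 1)) * p + cexp (z i - 1) * (p - cexp S) by ring.
rewrite (le_trans (ncD _ _)) // (ncM _ p) (ncM (cexp (z i - 1)) (p - cexp S)).
rewrite mulrDr lerD //.
  by rewrite (le_trans _ (cexp_sub_affine Rzi)) // ler_piMr // nc_ge0.
by rewrite (le_trans _ ih3) // ler_piMl ?nc_ge0 // nc_cexp_le1.
Qed.

End ComplexExponential.

(** * The Turan-Kubilius inequality and concentration of multiplicative functions *)

Section Counting.
Context {R : realType}.
Implicit Types (M p q : nat).

Lemma count_multiples p M : (0 < p)%N ->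
  \sum_(1 <= n < M.+1) (p %| n)%:R = (M %/ p)%:R :> R.
Proof.
move=> p0; elim: M => [|M ih]; first by rewrite big_geq // div0n.
by rewrite big_nat_recr //= ih divnS // natrD addrC.
Qed.

Lemma divn_le_divr p M : (0 < p)%N -> (M %/ p)%:R <= M%:R / p%:R :> R.
Proof.
by move=> p0; rewrite ler_pdivlMr ?ltr0n // -natrM ler_nat leq_trunc_div.
Qed.

Lemma divr_le_divnS p M : (0 < p)%N -> M%:R / p%:R <= (M %/ p)%:R + 1 :> R.
Proof.
move=> p0; rewrite ler_pdivrMr ?ltr0n // natr1 -natrM ler_nat.
by rewrite ltnW // ltn_ceil.
Qed.

Lemma natr_dvdnM p q n : prime p -> prime q -> p != q ->
  (p %| n)%:R * (q %| n)%:R = (p * q %| n)%:R :> R.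
Proof.
move=> pp pq npq; rewrite Gauss_dvd; last first.
  by rewrite prime_coprime // dvdn_prime2.
by case: (p %| n)%N; case: (q %| n)%N; rewrite ?mulr0 ?mul0r ?mulr1.
Qed.

(** The events [p %| n] and [q %| n] are almost uncorrelated on [[1, M]]: the
covariance sum is at most 1 in modulus, whatever the size of M. *)
Lemma divisibility_covariance M p q : prime p -> prime q ->
  `|\sum_(1 <= n < M.+1) ((p %| n)%:R - p%:R^-1) * ((q %| n)%:R - q%:R^-1)|
    <= 1 + (p == q)%:R * (M%:R / p%:R) :> R.
Proof.
move=> pp pq; have p0 := prime_gt0 pp; have q0 := prime_gt0 pq.
have p2 : 2 <= p%:R :> R by rewrite ler_nat prime_gt1.
have q2 : 2 <= q%:R :> R by rewrite ler_nat prime_gt1.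
set x := p%:R^-1; set y := q%:R^-1.
have x0 : 0 < x by rewrite invr_gt0 ltr0n.
have y0 : 0 < y by rewrite invr_gt0 ltr0n.
have x2 : x <= 2^-1 by rewrite lef_pV2 // posrE ?ltr0n.
have y2 : y <= 2^-1 by rewrite lef_pV2 // posrE ?ltr0n.
have -> : \sum_(1 <= n < M.+1) ((p %| n)%:R - x) * ((q %| n)%:R - y) =
   \sum_(1 <= n < M.+1) ((p %| n)%:R * (q %| n)%:R) - (M %/ p)%:R * y
    - (M %/ q)%:R * x + M%:R * (x * y).
  rewrite -!(count_multiples M) // !mulr_suml -!sumrB.
  rewrite (_ : M%:R * (x * y) = \sum_(1 <= n < M.+1) (x * y)); last first.
    by rewrite sumr_const_nat subSS subn0 mulr_natl.
  by rewrite -big_split /=; apply: eq_bigr => n _; ring.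
have a1 := divn_le_divr M p0; have a2 := divr_le_divnS M p0.
have b1 := divn_le_divr M q0; have b2 := divr_le_divnS M q0.
rewrite -/x in a1 a2; rewrite -/y in b1 b2.
have M0 : 0 <= M%:R :> R by [].
have [epq|npq] := eqVneq p q.
  have xy : y = x by rewrite /y /x epq.
  rewrite mul1r -epq xy; rewrite -epq in b1 b2.
  under eq_bigr do rewrite -natrM mulnb andbb.
  rewrite count_multiples //; rewrite -/x.
  have C0 : 0 <= (M %/ p)%:R :> R by [].
  rewrite ler_norml; apply/andP; split; last by nra.
  have : 0 <= M%:R * (x * x) by rewrite mulr_ge0 // mulr_ge0 // ltW.
  have : 0 <= (M %/ p)%:R * (1 - 2 * x) by rewrite mulr_ge0 //; lra.
  have : 0 <= M%:R * x by rewrite mulr_ge0 // ltW.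
  by lra.
rewrite mul0r addr0.
under eq_bigr do rewrite natr_dvdnM //.
rewrite count_multiples ?muln_gt0 ?p0 //.
have c1 : (M %/ (p * q))%:R <= M%:R * (x * y).
  have := @divn_le_divr (p * q) M; rewrite muln_gt0 p0 q0 => /(_ isT).
  by rewrite natrM invfM.
have c2 : M%:R * (x * y) <= (M %/ (p * q))%:R + 1.
  have := @divr_le_divnS (p * q) M; rewrite muln_gt0 p0 q0 => /(_ isT).
  by rewrite natrM invfM.
have d1 : (M %/ p)%:R * y <= M%:R * (x * y) by rewrite mulrA ler_wpM2r // ltW.
have d2 : M%:R * (x * y) <= (M %/ p)%:R * y + y.
  by rewrite -[X in _ + X]mul1r -mulrDl mulrA ler_wpM2r // ltW.
have e1 : (M %/ q)%:R * x <= M%:R * (x * y).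
  by rewrite (mulrC x) mulrA ler_wpM2r // ltW.
have e2 : M%:R * (x * y) <= (M %/ q)%:R * x + x.
  by rewrite -[X in _ + X]mul1r -mulrDl (mulrC x) mulrA ler_wpM2r // ltW.
by rewrite ler_norml; apply/andP; split; lra.
Qed.

(** Turan-Kubilius: the mean is subtracted prime by prime and the square
expanded. Only primes up to the square root of M occur, so that even the trivial
bound [q <= s] for each of them controls the off-diagonal terms, and no
information on the distribution of primes enters. *)
Lemma turan_kubilius M s (P : pred nat) (a : nat -> R) :
  (s * s <= M)%N -> (forall p, P p -> prime p) ->
  \sum_(1 <= n < M.+1)
     (\sum_(p < s.+1 | P p) a p * ((p %| n)%:R - p%:R^-1)) ^+ 2
    <= 2 * M%:R * \sum_(p < s.+1 | P p) a p ^+ 2 / p%:R.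
Proof.
move=> sM Pp; set B : R := \sum_(p < s.+1 | P p) _.
have -> : \sum_(1 <= n < M.+1)
     (\sum_(p < s.+1 | P p) a p * ((p %| n)%:R - p%:R^-1)) ^+ 2 =
  \sum_(p < s.+1 | P p) \sum_(q < s.+1 | P q) a p * a q *
    \sum_(1 <= n < M.+1) ((p %| n)%:R - p%:R^-1) * ((q %| n)%:R - q%:R^-1).
  under eq_bigr => n _.
    rewrite expr2 mulr_suml; under eq_bigr => p _ do rewrite mulr_sumr; over.
  rewrite exchange_big /=; apply: eq_bigr => p _.
  rewrite exchange_big /=; apply: eq_bigr => q _.
  by rewrite mulr_sumr; apply: eq_bigr => n _; ring.
have pos (p : 'I_s.+1) : P p -> 0 < (p%:R : R).
  by move=> /Pp/prime_gt0; rewrite ltr0n.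
have step (p q : 'I_s.+1) : P p -> P q ->
  a p * a q *
    \sum_(1 <= n < M.+1) ((p %| n)%:R - p%:R^-1) * ((q %| n)%:R - q%:R^-1) <=
  (a p ^+ 2 / p%:R * q%:R + a q ^+ 2 / q%:R * p%:R) / 2
   + (p == q)%:R * (M%:R * (a p ^+ 2 / p%:R)).
  move=> pp pq.
  rewrite (le_trans (ler_norm _)) // normrM.
  rewrite (le_trans (ler_wpM2l _ (divisibility_covariance M (Pp _ pp) (Pp _ pq)))) //.
  rewrite mulrDr mulr1 lerD //.
    rewrite normrM.
    have p0 := pos _ pp; have q0 := pos _ pq.
    have := sqr_ge0 (`|a p| / p%:R - `|a q| / q%:R).
    rewrite sqrrB !expr_div_n !real_normK ?num_real // => h.
    have : 0 <= p%:R * q%:R * (a p ^+ 2 / p%:R ^+ 2 - `|a p| / p%:R * (`|a q| / q%:R) *+ 2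
         + a q ^+ 2 / q%:R ^+ 2).
      by rewrite mulr_ge0 // mulr_ge0 // ltW.
    rewrite (_ : p%:R * q%:R * _ = a p ^+ 2 / p%:R * q%:R + a q ^+ 2 / q%:R * p%:R
       - `|a p| * `|a q| * 2); first by lra.
    by field; rewrite !lt0r_neq0.
  rewrite -[val p == val q]/(p == q).
  have [<-|] := eqVneq p q; last by rewrite !mul0r mulr0.
  by rewrite -expr2 ger0_norm ?sqr_ge0 // !mul1r mulrCA mulrA.
rewrite (le_trans (ler_sum _ (fun (p : 'I_s.+1) pp => ler_sum _ (fun (q : 'I_s.+1) pq => step p q pp pq)))) //.
under eq_bigr => p pp.
  rewrite big_split /= -mulr_suml big_split /= -mulr_sumr -mulr_suml -/B.
  rewrite (_ : \sum_(i < s.+1 | P i) (p == i)%:R * _ = M%:R * (a p ^+ 2 / p%:R)); last first.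
    rewrite (bigD1 p) //= eqxx mul1r big1 ?addr0 // => i /andP[_].
    by rewrite eq_sym => /negPf ->; rewrite mul0r.
  over.
rewrite big_split /= -mulr_sumr -/B -mulr_suml big_split /= -mulr_suml -mulr_sumr -/B.
set S := \sum_(p < s.+1 | P p) p%:R.
have S0 : S <= M%:R.
  apply: (@le_trans _ _ (s * s)%:R); last by rewrite ler_nat.
  rewrite /S big_mkcond big_ord_recl /=.
  rewrite (_ : (if _ then _ else _) = 0) ?add0r; last by case: ifP.
  rewrite natrM mulr_natl -[X in _ *+ X](card_ord s) -sumr_const.
  apply: ler_sum => i _; case: ifP => // _; rewrite ler_nat.
  by rewrite /bump leq0n add1n; exact: ltn_ord.
have B0 : 0 <= B by apply: sumr_ge0 => p pp; rewrite divr_ge0 // sqr_ge0.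
have := ler_wpM2l B0 S0; lra.
Qed.

(** An integer up to [M < (s+1)^2] has at most one prime factor above s, so the
reciprocals of these primes have bounded sum; this stands in for Mertens'
theorem. *)
Lemma sum_inv_large_primes M s (P : pred nat) :
  (M < s.+1 * s.+1)%N -> (0 < M)%N -> (forall p, P p -> prime p) ->
  \sum_(p < M.+1 | P p && (s < p)%N) p%:R^-1 <= 2 :> R.
Proof.
move=> Ms M0 Pp; have M0' : 0 < M%:R :> R by rewrite ltr0n.
rewrite -(ler_pM2l M0') mulr_sumr.
apply: (@le_trans _ _ (\sum_(p < M.+1 | P p && (s < p)%N) ((M %/ p)%:R + 1))).
  by apply: ler_sum => p /andP[/Pp pp _]; rewrite divr_le_divnS // prime_gt0.
rewrite big_split /= mulr2n mulrDr mulr1 lerD //; last first.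
  rewrite big_mkcond big_ord_recl /=.
  rewrite (_ : (if _ then _ else _) = 0) ?add0r; last by rewrite ltn0 andbF.
  rewrite -[leRHS]mulr1 mulr_natl -[X in _ *+ X](card_ord M) -sumr_const.
  by apply: ler_sum => i _; case: ifP.
under eq_bigr => p /andP[/Pp pp _] do rewrite -count_multiples ?prime_gt0 //.
rewrite exchange_big /= -[leRHS]mulr1 mulr_natl.
rewrite -[X in _ *+ X](subn0 M) -subSS -sumr_const_nat.
rewrite big_nat_cond [leRHS]big_nat_cond; apply: ler_sum => n; rewrite andbT => /andP[n0 nM].
have [/existsP[p /andP[/andP[Pp' sp] pn]]|none] :=
    boolP [exists p : 'I_M.+1, P p && (s < p)%N && (p %| n)%N]; last first.
  rewrite big1 // => p pP; move: none; rewrite negb_exists => /forallP/(_ p).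
  by rewrite pP /= => /negPf ->.
rewrite (bigD1 p) ?Pp' //= big1 ?addr0 => [|q /andP[/andP[Pq sq] qp]].
  by rewrite lern1 leq_b1.
apply/eqP; rewrite pnatr_eq0 eqb0; apply/negP => qn.
have : (p * q %| n)%N.
  rewrite Gauss_dvd ?pn ?qn // prime_coprime ?Pp //.
  by rewrite dvdn_prime2 ?Pp // eq_sym.
move=> /(dvdn_leq n0); rewrite leqNgt => /negP; apply.
by rewrite (leq_ltn_trans _ (leq_trans Ms (leq_mul sp sq))).
Qed.

End Counting.

Section Concentration.
Context {R : realType}.

Lemma sqrt_between M : exists s, (s * s <= M)%N /\ (M < s.+1 * s.+1)%N.
Proof.
elim: M => [|M [s [s1 s2]]]; first by exists 0%N.
have [h|h] := ltnP M.+1 (s.+1 * s.+1)%N; first by exists s; split => //; exact: leqW.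
have -> : M.+1 = (s.+1 * s.+1)%N by apply/eqP; rewrite eqn_leq h s2.
by exists s.+1; split => //; rewrite ltn_mul.
Qed.

Lemma ler_norm_sqr (x t : R) : 0 < t -> `|x| <= (x ^+ 2 / t + t) / 2.
Proof.
move=> t0; rewrite ler_pdivlMr // -(ler_pM2r t0) mulrDl -[_ / t * t]mulrA.
rewrite mulVf ?gt_eqF // mulr1 -(real_normK (num_real x)).
by have := sqr_ge0 (`|x| - t); rewrite sqrrB; lra.
Qed.

(** The values on [[1, M]] of [n |-> \prod_(p | n) h p] cluster around a single
constant when the [h p] are close to 1 in weighted mean square: the product is
close to the exponential of the additive function [\sum_(p | n) (h p - 1)], and
this additive function is close to its mean by the Turan-Kubilius inequality.
The constant depends on M, and cannot be taken to be 1: the imaginary parts of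
[h p - 1] may have a divergent weighted sum. *)
Lemma concentration M (P : pred nat) (h : nat -> R[i]) (t : R) :
  (0 < M)%N -> (forall p, P p -> prime p) -> (forall p, P p -> nc (h p) <= 1) ->
  0 < t -> t <= 1 ->
  \sum_(p < M.+1 | P p) nc (h p - 1) ^+ 2 / p%:R <= t ^+ 2 ->
  exists c : R[i], \sum_(1 <= n < M.+1)
    nc (\prod_(p < M.+1 | P p && (p %| n)%N) h p - c) <= 17 * t * M%:R.
Proof.
move=> M0 Pp h1 t0 t1 hB; have [s [sM Ms]] := sqrt_between M.
have sM' : (s <= M)%N by rewrite (leq_trans _ sM) //; case: (s) => // k; rewrite leq_pmulr.
have hp p : P p -> complex.Re (h p - 1) <= 0.
  by move=> pp; rewrite ReB subr_le0 nc_Re_le1 // h1.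
pose B : R := \sum_(p < M.+1 | P p) nc (h p - 1) ^+ 2 / p%:R.
pose A1 n := \sum_(p < s.+1 | P p) (h p - 1) * (p %| n)%:R%:C%C.
pose A2 n := \sum_(p < M.+1 | P p && (s < p)%N) (h p - 1) * (p %| n)%:R%:C%C.
pose m := \sum_(p < s.+1 | P p) (h p - 1) * (p%:R^-1)%:C%C.
have ReMr (z : R[i]) (x : R) : complex.Re (z * x%:C%C) = complex.Re z * x.
  by case: z => a b /=; rewrite mulr0 subr0.
have ImMr (z : R[i]) (x : R) : complex.Im (z * x%:C%C) = complex.Im z * x.
  by case: z => a b /=; rewrite mulr0 add0r.
have Rem : complex.Re m <= 0.
  rewrite Re_sum; apply: sumr_le0 => p pp; rewrite ReMr.
  by rewrite mulr_le0_ge0 ?hp // invr_ge0.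
have splitA n : \sum_(p < M.+1 | P p && (p %| n)%N) (h p - 1) = A1 n + A2 n.
  rewrite /A1 /A2 (big_mkcond (fun p : 'I_M.+1 => P p && (p %| n)%N)) /=.
  have -> : \sum_(p < s.+1 | P p) (h p - 1) * (p %| n)%:R%:C%C =
    \sum_(p < M.+1 | P p && (p < s.+1)%N) (h p - 1) * (p %| n)%:R%:C%C.
    by rewrite (big_ord_widen_cond M.+1 P (fun p => (h p - 1) * (p %| n)%:R%:C%C)).
  rewrite (big_mkcond (fun p : 'I_M.+1 => P p && (p < s.+1)%N)) /=.
  rewrite (big_mkcond (fun p : 'I_M.+1 => P p && (s < p)%N)) /= -big_split /=.
  apply: eq_bigr => p _; rewrite ltnS leqNgt.
  case: (P p) => /=; last by rewrite addr0.
  by case: (s < p)%N => /=; case: (p %| n)%N; rewrite ?mulr1 ?mulr0 ?addr0 ?add0r.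
have ReA n : complex.Re (A1 n + A2 n) <= 0.
  rewrite -splitA Re_sum; apply: sumr_le0 => p /andP[pp _]; exact: hp.
exists (cexp m).
have step n : nc (\prod_(p < M.+1 | P p && (p %| n)%N) h p - cexp m) <=
   3 * \sum_(p < M.+1 | P p) nc (h p - 1) ^+ 2 * (p %| n)%:R
   + 4 * (nc (A1 n - m) + \sum_(p < M.+1 | P p && (s < p)%N) nc (h p - 1) * (p %| n)%:R).
  rewrite (le_trans (nc_tri (cexp (A1 n + A2 n)) _ _)) // lerD //.
    rewrite -splitA (le_trans (prod_near_cexp _ _)) // => [p /andP[pp _]|]; first exact: h1.
    rewrite ler_wpM2l // big_mkcondr /=; apply: ler_sum => p _.
    by case: ifP => _; rewrite ?mulr1 ?mulr0.
  rewrite (le_trans (dist_cexp _ _)) // ler_wpM2l // addrAC.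
  rewrite (le_trans (ncD _ _)) // lerD2l /A2 (le_trans (nc_sum _ _ _)) //.
  by apply: ler_sum => p _; rewrite ncM nc_real normr_nat.
rewrite (le_trans (ler_sum_nat (fun n _ => step n))) // {step}.
rewrite big_split /= -!mulr_sumr big_split /=.
have B1 : \sum_(1 <= n < M.+1) \sum_(p < M.+1 | P p) nc (h p - 1) ^+ 2 * (p %| n)%:R
    <= M%:R * B.
  rewrite exchange_big /= mulr_sumr; apply: ler_sum => p pp.
  rewrite -mulr_sumr count_multiples ?prime_gt0 ?Pp // mulrCA ler_wpM2l ?sqr_ge0 //.
  by rewrite divn_le_divr // prime_gt0 ?Pp.
have B2 : \sum_(1 <= n < M.+1) \sum_(p < M.+1 | P p && (s < p)%N)
      nc (h p - 1) * (p %| n)%:R <= M%:R * ((B / t + t * 2) / 2).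
  rewrite exchange_big /=.
  apply: (@le_trans _ _ (M%:R * \sum_(p < M.+1 | P p && (s < p)%N)
      (nc (h p - 1) ^+ 2 / p%:R / t + t * p%:R^-1) / 2)).
    rewrite mulr_sumr; apply: ler_sum => p /andP[pp _].
    rewrite -mulr_sumr count_multiples ?prime_gt0 ?Pp //.
    have p0 := prime_gt0 (Pp _ pp).
    rewrite (le_trans (ler_wpM2l (nc_ge0 _) (divn_le_divr M p0))) //.
    rewrite mulrCA ler_wpM2l //.
    have := ler_norm_sqr (nc (h p - 1)) t0; rewrite ger0_norm ?nc_ge0 // => hh.
    rewrite (le_trans (ler_wpM2r _ hh)) ?invr_ge0 // le_eqVlt; apply/orP; left; apply/eqP.
    by ring.
  rewrite ler_wpM2l // -mulr_suml ler_wpM2r // big_split /= lerD //.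
    rewrite -mulr_suml ler_wpM2r ?invr_ge0 ?(ltW t0) // /B.
    rewrite [leRHS](bigID (fun p : 'I_M.+1 => (s < p)%N)) /= lerDl.
    by apply: sumr_ge0 => p _; rewrite divr_ge0 // sqr_ge0.
  by rewrite -mulr_sumr ler_wpM2l ?(ltW t0) // sum_inv_large_primes.
pose Bs (a : nat -> R) := \sum_(p < s.+1 | P p) a p ^+ 2 / p%:R.
have tk (a : nat -> R) : \sum_(1 <= n < M.+1)
    `|\sum_(p < s.+1 | P p) a p * ((p %| n)%:R - p%:R^-1)| <=
    M%:R * ((2 * Bs a / t + t) / 2).
  apply: (@le_trans _ _ (\sum_(1 <= n < M.+1)
    ((\sum_(p < s.+1 | P p) a p * ((p %| n)%:R - p%:R^-1)) ^+ 2 / t + t) / 2)).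
    by apply: ler_sum => n _; exact: ler_norm_sqr.
  rewrite -mulr_suml big_split /= -mulr_suml sumr_const_nat subSS subn0.
  rewrite mulrA ler_wpM2r // mulrDr -[t *+ M]mulr_natl lerD2r.
  rewrite !mulrA ler_wpM2r ?invr_ge0 ?(ltW t0) //.
  by rewrite (le_trans (turan_kubilius a sM Pp)) // [2 * _]mulrC /Bs.
have B3 : \sum_(1 <= n < M.+1) nc (A1 n - m) <= M%:R * (B / t + t).
  apply: (@le_trans _ _ (\sum_(1 <= n < M.+1)
    (`|\sum_(p < s.+1 | P p) complex.Re (h p - 1) * ((p %| n)%:R - p%:R^-1)|
    + `|\sum_(p < s.+1 | P p) complex.Im (h p - 1) * ((p %| n)%:R - p%:R^-1)|))).
    apply: ler_sum => n _; rewrite (le_trans (nc_le_ReIm _)) // /A1 /m -sumrB.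
    rewrite (eq_bigr (fun p : 'I_s.+1 => (h p - 1) * ((p %| n)%:R - p%:R^-1)%:C%C)).
      by rewrite Re_sum Im_sum (eq_bigr _ (fun p _ => ReMr _ _))
        (eq_bigr _ (fun p _ => ImMr _ _)).
    by move=> p _; rewrite rmorphB mulrBr.
  rewrite big_split /=; apply: (le_trans (lerD (tk (fun p => complex.Re (h p - 1)))
    (tk (fun p => complex.Im (h p - 1))))).
  rewrite -mulrDr ler_wpM2l //.
  suff : Bs (fun p => complex.Re (h p - 1)) / t + Bs (fun p => complex.Im (h p - 1)) / t
      <= B / t by lra.
  rewrite -mulrDl ler_wpM2r ?invr_ge0 ?(ltW t0) // -big_split /=.
  rewrite (eq_bigr (fun p : 'I_s.+1 => nc (h p - 1) ^+ 2 / p%:R)) => [|p _].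
    rewrite (big_ord_widen_cond M.+1 P (fun p => nc (h p - 1) ^+ 2 / p%:R)) //.
    rewrite /B [leRHS](bigID (fun p : 'I_M.+1 => (p < s.+1)%N)) /= lerDl.
    by apply: sumr_ge0 => p _; rewrite divr_ge0 // sqr_ge0.
  by rewrite -mulrDl nc_sqr.
have hBt : B / t <= t by rewrite ler_pdivrMr // -expr2.
have M0' : 0 <= M%:R :> R by [].
have BtM := ler_wpM2l M0' hBt.
have tt : t ^+ 2 <= t by rewrite expr2 ler_piMl // ltW.
have BM : M%:R * B <= M%:R * t by rewrite ler_wpM2l // (le_trans hB).
rewrite mulrDr in B3; rewrite mulrA mulrDr [t * 2]mulrC in B2.
rewrite -mulrA [t * M%:R]mulrC.
rewrite [M%:R * (2 * t)]mulrCA in B2.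
move: B1 B2 B3 BtM BM; clearbody B.
move: (M%:R * B : R) (M%:R * (B / t) : R) (M%:R * t : R) => x1 x2 x3 *.
lra.
Qed.

End Concentration.
(** * Smooth and rough parts under a shift by a highly divisible number *)

Section RoughPart.
Local Open Scope nat_scope.

Definition rough (K : nat) : nat_pred := [pred p : nat | prime p && (K < p)%N].

Definition primorial_power (K L : nat) : nat := \prod_(p < K.+1 | prime p) p ^ L.

Lemma primorial_power_gt0 K L : (0 < primorial_power K L)%N.
Proof. by apply: prodn_cond_gt0 => p pp; rewrite expn_gt0 prime_gt0. Qed.

Lemma dvdn_primorial_power K L p : prime p -> (p <= K)%N ->
  (p ^ L %| primorial_power K L)%N.
Proof.
move=> pp pK; have pK' : (p < K.+1)%N by [].
by rewrite /primorial_power (bigD1 (Ordinal pK')) //= dvdn_mulr.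
Qed.

Lemma logn_shift p L n D : prime p -> (0 < n)%N -> (p ^ L %| D)%N ->
  ~~ (p ^ L %| n)%N -> logn p (n + D) = logn p n.
Proof.
move=> pp n0 pD pn.
have lL : (logn p n < L)%N by rewrite ltnNge -pfactor_dvdn.
have nD0 : (0 < n + D)%N by rewrite addn_gt0 n0.
have h j : (j <= L)%N -> (j <= logn p (n + D))%N = (j <= logn p n)%N.
  move=> jL; rewrite -!pfactor_dvdn // dvdn_addl //.
  by rewrite (dvdn_trans _ pD) // dvdn_exp2l.
apply/eqP; rewrite eqn_leq; apply/andP; split.
  by rewrite -ltnS ltnNge h // -ltnNge.
by rewrite h // ltnW.
Qed.

Lemma smooth_part_dvd K L n : (0 < n)%N ->
  (forall p, prime p -> (p <= K)%N -> ~~ (p ^ L %| n)%N) ->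
  (n`_(rough K)^' %| primorial_power K L)%N.
Proof.
move=> n0 nL; apply/dvdn_partP; first by rewrite part_gt0.
move=> p; rewrite mem_primes => /and3P[pp _ pn].
have pK : (p <= K)%N.
  have := part_pnat (rough K)^' n; rewrite /pnat => /andP[_ /allP/(_ p)].
  by rewrite mem_primes pp part_gt0 pn => /(_ isT); rewrite !inE pp /= -leqNgt.
rewrite p_part (dvdn_trans _ (dvdn_primorial_power L pp pK)) // dvdn_exp2l //.
rewrite (leq_trans (dvdn_leq_log p n0 (dvdn_part _ n))) // ltnW // ltnNge.
by rewrite -pfactor_dvdn // nL.
Qed.

(** Shifting [n] by a multiple of [q * primorial_power K L] changes neither its
K-smooth part nor the residue modulo q of its K-rough part, unless [n] is
divisible by the L-th power of some prime up to K. *)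
Lemma shift_parts K L q k n : (0 < n)%N ->
  (forall p, prime p -> (p <= K)%N -> ~~ (p ^ L %| n)%N) ->
  let m := (n + q * primorial_power K L * k)%N in
  m`_(rough K)^' = n`_(rough K)^' /\
  exists j, m`_(rough K) = (n`_(rough K) + q * j)%N.
Proof.
move=> n0 nL m; have m0 : (0 < m)%N by rewrite addn_gt0 n0.
have eqs : m`_(rough K)^' = n`_(rough K)^'.
  apply: eq_partn_from_log => // p.
  rewrite !inE negb_and -leqNgt => pK /=.
  have [pp|npp] := boolP (prime p); last first.
    by rewrite (lognE p m) (lognE p n) (negPf npp).
  rewrite pp /= in pK.
  apply: (logn_shift (L := L)) => //; last exact: nL.
  by rewrite mulnAC dvdn_mull // dvdn_primorial_power.
split=> //; have /dvdnP[w hw] := smooth_part_dvd n0 nL.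
exists (w * k)%N; apply/eqP.
rewrite -(eqn_pmul2l (part_gt0 (rough K)^' n)) -{1}eqs mulnC partnC // /m hw.
rewrite -{1}(partnC (rough K) n0) mulnDr mulnC; apply/eqP; congr addn.
by rewrite -!mulnA; nia.
Qed.

End RoughPart.

Section MultiplicativeFunctions.
Context {R : realType}.
Implicit Types (f g : nat -> R[i]).

Lemma multiplicative_prod f (I : seq nat) (P : pred nat) (e : nat -> nat) :
  multiplicative_fun f -> f 1%N = 1 -> uniq I -> (forall p, P p -> prime p) ->
  f (\prod_(p <- I | P p) p ^ e p)%N = \prod_(p <- I | P p) f (p ^ e p)%N.
Proof.
move=> fm f1 + Pp; elim: I => [|p I ih] /=; first by rewrite !big_nil.
move=> /andP[pI uI]; rewrite !big_cons; case: ifPn => pp; last exact: ih.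
rewrite fm ?ih //; first by rewrite expn_gt0 prime_gt0 ?Pp.
  by apply: prodn_cond_gt0 => i /Pp ip; rewrite expn_gt0 prime_gt0.
rewrite big_seq_cond; apply: (big_ind (fun m => coprime (p ^ e p) m)).
- exact: coprimen1.
- by move=> x y; rewrite coprimeMr => -> ->.
- move=> i /andP[iI /Pp ip]; apply/coprimeXl/coprimeXr.
  rewrite prime_coprime ?Pp // dvdn_prime2 //; last exact: Pp.
  by apply: contraNneq pI => ->.
Qed.

Lemma multiplicative_rough f K n M : multiplicative_fun f -> f 1%N = 1 ->
  (0 < n)%N -> (n <= M)%N ->
  (forall p, prime p -> (K < p)%N -> ~~ (p ^ 2 %| n)%N) ->
  f (n`_(rough K))%N = \prod_(p < M.+1 | ((p : nat) \in rough K) && (p %| n)%N) f p.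
Proof.
move=> fm f1 n0 nM n2; rewrite (widen_partn _ nM).
rewrite multiplicative_prod ?iota_uniq //; last by move=> p /andP[].
rewrite big_mkord [RHS]big_mkcondr; apply: eq_bigr => p.
rewrite inE => /andP[pp Kp].
have := n2 p pp Kp; rewrite pfactor_dvdn // -ltnNge ltnS.
case: ifPn => pn l1.
  have : (0 < logn p n)%N by rewrite logn_gt0 mem_primes pp n0.
  by move: l1; case: logn => [//|[|//]] _ _; rewrite expn1.
by rewrite (_ : logn p n = 0%N) ?expn0 ?f1 // lognE (negPf pn) !andbF.
Qed.

(** On integers without square factors from the primes above K, the function [f]
is [f] of the smooth part, times [g] of the rough part, times a product over
prime divisors that measures the distance from [f] to [g]. *)
Lemma multiplicative_decomposition f g K n M :
  multiplicative_fun f -> f 1%N = 1 -> multiplicative_fun g -> g 1%N = 1 ->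
  (forall p, prime p -> (K < p)%N -> nc (g p) = 1) ->
  (0 < n)%N -> (n <= M)%N ->
  (forall p, prime p -> (K < p)%N -> ~~ (p ^ 2 %| n)%N) ->
  f n = f (n`_(rough K)^')%N * g (n`_(rough K))%N *
    \prod_(p < M.+1 | ((p : nat) \in rough K) && (p %| n)%N) (f p * conjc (g p)).
Proof.
move=> fm f1 gm g1 g_unit n0 nM n2.
rewrite -{1}(partnC (rough K) n0) mulnC fm ?part_gt0 //; last first.
  by rewrite coprime_sym coprime_partC.
rewrite (multiplicative_rough fm f1 n0 nM n2) (multiplicative_rough gm g1 n0 nM n2).
rewrite -mulrA -big_split /=; congr (_ * _); apply: eq_bigr => p /andP[/andP[pp Kp] _].
by rewrite mulrCA ncJ ?mulr1 // g_unit.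
Qed.

End MultiplicativeFunctions.

Section TwistedCharacters.
Context {R : realType}.
Implicit Types (q : nat) (chi : nat -> R[i]) (t : R).

Lemma character1 q chi : dirichlet_character q chi -> chi 1%N = 1.
Proof.
move=> [q0 chiM _ chi0]; have := chiM 1%N 1%N; rewrite muln1 => h.
have c1 : chi 1%N != 0 by rewrite chi0 coprime1n.
by apply: (mulfI c1); rewrite -h mulr1.
Qed.

Lemma characterX q chi m n : dirichlet_character q chi ->
  chi (n ^ m)%N = chi n ^+ m.
Proof.
move=> hchi; elim: m => [|m ih]; first by rewrite expn0 expr0 (character1 hchi).
by case: hchi => _ chiM _ _; rewrite expnS exprS chiM ih.
Qed.

Lemma character_periodic q chi n k : dirichlet_character q chi ->
  chi (n + q * k)%N = chi n.
Proof.
move=> [_ _ chiD _]; elim: k => [|k ih]; first by rewrite muln0 addn0.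
by rewrite mulnS addnCA addnC chiD.
Qed.

Lemma nc_character q chi n : dirichlet_character q chi -> coprime n q ->
  nc (chi n) = 1.
Proof.
move=> hchi nq; have [q0 _ _ _] := hchi.
have ncX m : nc (chi n ^+ m) = nc (chi n) ^+ m.
  by elim: m => [|m ih]; rewrite ?expr0 ?nc1 // !exprS ncM ih.
have E (a b : nat) : (a = b %[mod q])%N -> chi a = chi b.
  move=> ab; rewrite (divn_eq a q) (divn_eq b q) ab.
  by rewrite ![(_ * q + _)%N]addnC ![(_ * q)%N]mulnC !character_periodic.
have := E _ _ (Euler_exp_totient nq).
rewrite (characterX _ _ hchi) (character1 hchi) => /(congr1 (@nc R)).
rewrite ncX nc1 => /eqP; rewrite pexpr_eq1 ?nc_ge0 ?totient_gt0 //.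
by move=> /eqP.
Qed.

Lemma nc_character_le1 q chi n : dirichlet_character q chi -> nc (chi n) <= 1.
Proof.
move=> hchi; have [nq|nq] := boolP (coprime n q).
  by rewrite (nc_character hchi).
have [_ _ _ chi0] := hchi; have : chi n == 0 by rewrite -[_ == _]negbK chi0.
by move=> /eqP ->; rewrite nc0.
Qed.

Lemma nat_powiM t m n : (0 < m)%N -> (0 < n)%N ->
  nat_powi t (m * n) = nat_powi t m * nat_powi t n.
Proof. by move=> m0 n0; rewrite /nat_powi natrM lnM ?posrE ?ltr0n // mulrDr cisD. Qed.

Lemma twisted_character_multiplicative q chi t : dirichlet_character q chi ->
  multiplicative_fun (fun n => nat_powi t n * chi n).
Proof. by case=> _ chiM _ _ m n m0 n0 _; rewrite nat_powiM // chiM mulrACA. Qed.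

Lemma twisted_character1 q chi t : dirichlet_character q chi ->
  nat_powi t 1 * chi 1%N = 1.
Proof. by move=> /character1 ->; rewrite /nat_powi ln1 mulr0 /cis cos0 sin0 mulr1. Qed.

Lemma ln_shift_le (n d : nat) : (0 < n)%N ->
  ln (n + d)%:R - ln n%:R <= d%:R / n%:R :> R.
Proof.
move=> n0; have n0' : 0 < n%:R :> R by rewrite ltr0n.
have d0 : 0 <= d%:R / n%:R :> R by rewrite divr_ge0.
rewrite -ln_div ?posrE ?ltr0n ?addn_gt0 ?n0 // natrD mulrDl divff ?gt_eqF //.
by rewrite le_ln1Dx // (lt_le_trans _ d0).
Qed.

End TwistedCharacters.

(** * Almost periodicity in mean of pretentious functions *)

Section AlmostPeriodicity.
Context {R : realType}.
Implicit Types (f g h : nat -> R[i]).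

Lemma pret_sim_tail f g : (forall n, nc (f n) <= 1) -> (forall n, nc (g n) <= 1) ->
  pret_sim f g -> forall eta : R, 0 < eta -> exists K0, forall K M, (K0 <= K)%N ->
  \sum_(p < M.+1 | (p : nat) \in rough K)
     p%:R^-1 * (1 - complex.Re (f p * conjc (g p))) <= eta.
Proof.
move=> f1 g1; rewrite /pret_sim /pret_dist => fg eta eta0.
pose u p : R := p%:R^-1 * (1 - complex.Re (f p * conjc (g p))).
have u0 p : 0 <= u p.
  rewrite mulr_ge0 // subr_ge0 nc_Re_le1 // ncM nc_conj mulr_ile1 ?nc_ge0 //.
have dfin : (pret_dist2 f g < +oo)%E.
  by rewrite ltey; apply: contraTneq fg => ->.
pose s N : R := \sum_(0 <= p < N | prime p) u p.
have sE N : (\sum_(0 <= p < N | prime p) (u p)%:E)%E = (s N)%:E by rewrite sumEFin.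
have d0 : (0 <= pret_dist2 f g)%E by apply: nneseries_ge0 => p _ _; rewrite lee_fin; exact: u0.
have dE : pret_dist2 f g \is a fin_num by rewrite ge0_fin_numE.
have cvs : s N @[N --> \oo] --> fine (pret_dist2 f g).
  apply: (@fine_cvg _ _ _ _ (fun N => (s N)%:E)).
  rewrite fineK // -(funext sE); apply: is_cvg_nneseries_cond => p _.
  by rewrite lee_fin.
have /cvgrPdist_lt/(_ _ eta0)[K0 _ HK0] := cvs.
exists K0 => K M K0K; have [MK|KM] := leqP M K.
  rewrite big1 ?ltW // => p /andP[_ /= Kp].
  by have := leq_trans (ltn_ord p) (leq_ltn_trans MK Kp); rewrite ltnn.
have -> : \sum_(p < M.+1 | (p : nat) \in rough K) u p = s M.+1 - s K.+1.
  apply/esym/eqP; rewrite subr_eq; apply/eqP; rewrite /s (@big_cat_nat _ _ _ K.+1) //=; last exact: leqW.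
  rewrite addrC; congr (_ + _).
  rewrite (big_nat_widenl K.+1 0%N) //= big_mkord.
  by apply: eq_bigl => p; rewrite !inE.
have sM : s M.+1 <= fine (pret_dist2 f g).
  by rewrite -lee_fin fineK // -sE; apply: nneseries_lim_ge => p _; rewrite lee_fin.
by have := HK0 K.+1 (leqW K0K); rewrite /= ltr_norml => /andP[_]; lra.
Qed.

Lemma sum_inv_sqr_le K M : (0 < K)%N ->
  \sum_(K.+1 <= p < M.+1) (p%:R ^+ 2)^-1 <= K%:R^-1 :> R.
Proof.
move=> K0; have [KM|MK] := leqP K M; last by rewrite big_geq // ltnW.
suff : \sum_(K.+1 <= p < M.+1) (p%:R ^+ 2)^-1 <= K%:R^-1 - M%:R^-1 :> R.
  by move=> h; rewrite (le_trans h) // gerBl.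
elim: M KM => [|M ih]; first by rewrite leqn0 => /eqP ->; rewrite big_geq // subrr.
rewrite leq_eqVlt => /predU1P[<-|]; first by rewrite big_geq // subrr.
rewrite ltnS => KM; rewrite big_nat_recr //=.
have M0 : (0 < M)%N by apply: leq_trans KM.
suff : (M.+1%:R ^+ 2)^-1 <= M%:R^-1 - M.+1%:R^-1 :> R.
  by move=> h; rewrite (le_trans (lerD (ih KM) h)) // addrA subrK.
rewrite -subr_ge0 (_ : _ - _ = (M%:R * M.+1%:R ^+ 2)^-1).
  by rewrite invr_ge0 mulr_ge0 // exprn_ge0.
have M0' : M%:R != 0 :> R by rewrite pnatr_eq0 -lt0n.
by rewrite -natr1; field; rewrite M0' natr1 pnatr_eq0.
Qed.

(** Counting the obstructing divisors, rather than the integers that have one,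
keeps the mean additive over primes. *)
Definition exceptional (K L M n : nat) : R :=
  \sum_(p < M.+1 | (p : nat) \in rough K) (p ^ 2 %| n)%:R
  + \sum_(p < K.+1 | prime p) (p ^ L %| n)%:R.

Lemma exceptional_ge0 K L M n : 0 <= exceptional K L M n.
Proof. by rewrite addr_ge0 // sumr_ge0. Qed.

Lemma exceptional_dichotomy K L M n : (0 < n)%N -> (n <= M)%N ->
  1 <= exceptional K L M n \/
  (forall p, prime p -> (K < p)%N -> ~~ (p ^ 2 %| n)%N) /\
  (forall p, prime p -> (p <= K)%N -> ~~ (p ^ L %| n)%N).
Proof.
move=> n0 nM; have [h|h] := leP 1 (exceptional K L M n); [by left|right; split].
- move=> p pp Kp; apply/negP => pn; move: h; apply/negP; rewrite -leNgt.
  have pM : (p < M.+1)%N.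
    rewrite ltnS (leq_trans _ nM) // (leq_trans _ (dvdn_leq n0 pn)) //.
    by rewrite -mulnn leq_pmulr // prime_gt0.
  rewrite /exceptional (bigD1 (Ordinal pM)) /=; last by rewrite !inE pp Kp.
  by rewrite pn -!addrA lerDl addr_ge0 // sumr_ge0.
- move=> p pp; rewrite -ltnS => pK; apply/negP => pn; move: h; apply/negP; rewrite -leNgt.
  rewrite /exceptional [X in _ + X](bigD1 (Ordinal pK)) //=.
  by rewrite pn addrCA lerDl addr_ge0 // sumr_ge0.
Qed.

Lemma sum_exceptional_le K L M : (0 < K)%N ->
  \sum_(1 <= n < M.+1) exceptional K L M n
    <= M%:R * (K%:R^-1 + K%:R / 2 ^+ L).
Proof.
move=> K0; rewrite /exceptional big_split /= mulrDr lerD //.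
  rewrite exchange_big /= (le_trans _ (ler_wpM2l _ (sum_inv_sqr_le M K0))) //.
  rewrite mulr_sumr.
  rewrite (eq_bigr (fun p : 'I_M.+1 => (M %/ p ^ 2)%:R)); last first.
    by move=> p /andP[/= pp _]; rewrite count_multiples // expn_gt0 prime_gt0.
  apply: (@le_trans _ _ (\sum_(0 <= p < M.+1 | (K < p)%N) M%:R * (p%:R ^+ 2)^-1)).
    rewrite big_mkord [leRHS]big_mkcond [leLHS]big_mkcond /=; apply: ler_sum => p _.
    case: ifPn => [/andP[/= pp Kp]|_].
      by rewrite Kp (le_trans (divn_le_divr _ _)) ?expn_gt0 ?prime_gt0 // natrX.
    by case: ifP => // _; rewrite mulr_ge0 // invr_ge0 exprn_ge0.
  rewrite le_eqVlt; apply/orP; left; apply/eqP.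
  rewrite [RHS](big_nat_widenl _ 0%N) //=.
rewrite exchange_big /=.
apply: (@le_trans _ _ (\sum_(p < K.+1 | (0 < p)%N) M%:R / 2 ^+ L)).
  rewrite [leRHS]big_mkcond [leLHS]big_mkcond /=; apply: ler_sum => p _.
  case: ifPn => pp; last by case: ifP => // _; rewrite divr_ge0 // exprn_ge0.
  rewrite prime_gt0 // count_multiples ?expn_gt0 ?prime_gt0 //.
  rewrite (le_trans (divn_le_divr _ _)) ?expn_gt0 ?prime_gt0 // ler_wpM2l //.
  rewrite natrX lef_pV2 ?posrE ?exprn_gt0 ?ltr0n ?prime_gt0 //.
  by rewrite lerXn2r ?nnegrE // ler_nat prime_gt1.
rewrite big_mkcond big_ord_recl /= add0r.
by rewrite sumr_const card_ord -[_ *+ K]mulr_natl mulrCA.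
Qed.

End AlmostPeriodicity.

Section MainEstimate.
Context {R : realType}.

(** The value of the twist [n^(it) chi n] at the rough part changes little under
a shift that preserves the smooth part and the residue of the rough part. *)
Lemma twisted_character_shift (t : R) q (chi : nat -> R[i]) K n m j :
  dirichlet_character q chi -> (0 < n)%N -> (0 < m)%N -> (n <= m)%N ->
  (m`_(rough K)^' = n`_(rough K)^')%N ->
  (m`_(rough K) = n`_(rough K) + q * j)%N ->
  nc (nat_powi t (m`_(rough K))%N * chi (m`_(rough K))%N
      - nat_powi t (n`_(rough K))%N * chi (n`_(rough K))%N)
    <= 2 * `|t| * (m - n)%:R / n%:R.
Proof.
move=> hchi n0 m0 nm sm rm.
rewrite {2}rm (character_periodic _ _ hchi) -mulrBl ncM.
rewrite (le_trans (ler_wpM2l (nc_ge0 _) (nc_character_le1 _ hchi))) // mulr1.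
rewrite (le_trans (dist_cis _ _)) // -mulrBr normrM mulrA -[leRHS]mulrA.
rewrite ler_wpM2l // ?mulr_ge0 //.
have lnE k : (0 < k)%N -> ln (k`_(rough K))%N%:R = ln k%:R - ln (k`_(rough K)^')%N%:R :> R.
  move=> k0; rewrite -{2}(partnC (rough K) k0) natrM lnM ?posrE ?ltr0n ?part_gt0 //.
  by rewrite addrK.
rewrite !lnE // sm (_ : _ - _ - (_ - _) = ln m%:R - ln n%:R); last by ring.
have := @ln_shift_le R n (m - n) n0; rewrite subnKC // => h.
rewrite ger0_norm // subr_ge0 ler_ln ?posrE ?ltr0n // ler_nat //.
Qed.

Lemma sum_initial_indicator (a N : nat) :
  \sum_(1 <= n < N.+1) (n < a)%:R <= a%:R :> R.
Proof.
rewrite -natr_sum ler_nat (leq_trans _ (geq_minr N a)) //.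
elim: N => [|N ih]; first by rewrite big_geq.
rewrite big_nat_recr //=; move: ih; move: (\sum_(_ <= _ < _) _)%N => S.
by rewrite !leq_min => /andP[SN Sa]; case: (ltnP N.+1 a) => /= h; apply/andP; split; lia.
Qed.

(** The period [Q] depends on [eps] only: [K] makes the tail of the distance and the
density of large square divisors small, then [L] makes high powers of primes up
to [K] rare. The constant [C] absorbs the dependence on [k], through the initial
segment on which [n^(it)] still varies and through the passage from [[1, N]] to
[[1, N + Q k]]. *)
Theorem pretentious_almost_periodic (f : nat -> R[i]) :
  multiplicative_fun f -> (forall n, nc (f n) <= 1) -> pretentious f ->
  forall eps : R, 0 < eps -> exists2 Q, (0 < Q)%N &
  forall k, exists C : R, forall N,
    \sum_(1 <= n < N.+1) nc (f (n + Q * k)%N - f n) <= eps * N%:R + C.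
Proof.
move=> fm fle1 [t [q [chi [[hchi _] fg]]]] eps eps0.
(* If [f 1] is not 1 it is 0, and then [f] vanishes on positive integers. *)
have [f1|nf1] := eqVneq (f 1%N) 1; last first.
  exists 1%N => // k; exists 0 => N.
  have f10 : f 1%N = 0.
    have := fm 1%N 1%N isT isT (coprime1n _); rewrite muln1 => h.
    apply/eqP; apply: contraNT nf1 => f0; apply/eqP/(mulfI f0).
    by rewrite -h mulr1.
  have f0 n : (0 < n)%N -> f n = 0.
    by move=> n0; have := fm n 1%N n0 isT (coprimen1 _); rewrite muln1 f10 mulr0.
  rewrite addr0 big_nat_cond big1 ?mulr_ge0 ?(ltW eps0) // => n.
  by rewrite andbT => /andP[n0 _]; rewrite !f0 ?addn_gt0 ?n0 // subrr nc0.
pose g n := nat_powi t n * chi n.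
have gm : multiplicative_fun g by exact: twisted_character_multiplicative hchi.
have g1 : g 1%N = 1 by exact: twisted_character1 hchi.
have gle1 n : nc (g n) <= 1.
  by rewrite ncM nc_cis mul1r (nc_character_le1 _ hchi).
have q0 : (0 < q)%N by case: hchi.
(* The concentration error [17 * s] is to be at most [eps / 8]. *)
pose s := Num.min 1 (eps / 200).
have s0 : 0 < s by rewrite lt_min ltr01 divr_gt0.
have s1 : s <= 1 by rewrite ge_min lexx.
have seps : s <= eps / 200 by rewrite ge_min lexx orbT.
have [K0 HK0] := pret_sim_tail fle1 gle1 fg (divr_gt0 (exprn_gt0 2 s0) (ltr0Sn _ 1)).
(* Primes above [q] do not divide the modulus, so [g] is unimodular there. *)
pose K := maxn (maxn K0 q) (Num.bound (32 / eps)).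
have K0K : (K0 <= K)%N by rewrite !leq_max leqnn.
have qK : (q <= K)%N by rewrite !leq_max leqnn orbT.
have Kpos : (0 < K)%N by apply: leq_trans qK.
have KR0 : 0 < K%:R :> R by rewrite ltr0n.
have epsK : K%:R^-1 <= eps / 32.
  rewrite -[leRHS]invrK lef_pV2 ?posrE ?invr_gt0 ?divr_gt0 // invf_div.
  rewrite (le_trans (ltW (archi_boundP _))) ?divr_ge0 ?(ltW eps0) // ler_nat.
  by rewrite leq_max leqnn orbT.
pose L := Num.bound (32 * K%:R / eps).
have epsL : K%:R / 2 ^+ L <= eps / 32.
  rewrite ler_pdivrMr ?exprn_gt0 // mulrAC ler_pdivlMr // [leRHS]mulrC -ler_pdivrMr //.
  rewrite [K%:R * _]mulrC (le_trans (ltW (archi_boundP _))) ?divr_ge0 ?mulr_ge0 ?(ltW eps0) //.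
  by rewrite -/L -natrX ler_nat ltnW // ltn_expl.
have g_unit p : prime p -> (K < p)%N -> nc (g p) = 1.
  move=> pp Kp; rewrite ncM nc_cis mul1r (nc_character hchi) //.
  rewrite prime_coprime //; apply/negP => /(dvdn_leq q0).
  by rewrite leqNgt (leq_ltn_trans qK Kp).
pose Q := (q * primorial_power K L)%N.
exists Q => [|k]; first by rewrite muln_gt0 q0 primorial_power_gt0.
pose d := (Q * k)%N.
(* From [n1] on, [n^(it)] moves by at most [eps / 4] under the shift by [d]. *)
pose n1 := Num.bound (8 * `|t| * d%:R / eps).
have n1P n : (n1 <= n)%N -> (0 < n)%N -> 2 * `|t| * d%:R / n%:R <= eps / 4.
  move=> n1n n0; rewrite ler_pdivrMr ?ltr0n // [leRHS]mulrAC ler_pdivlMr // [leRHS]mulrC.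
  rewrite -ler_pdivrMr // (_ : _ / eps = 8 * `|t| * d%:R / eps); last by ring.
  rewrite (le_trans (ltW (archi_boundP _))) ?divr_ge0 ?mulr_ge0 ?(ltW eps0) //.
  by rewrite ler_nat.
exists (eps * d%:R + 2 * n1%:R) => N; pose M := (N + d)%N.
have [->|Npos] := posnP N.
  by rewrite big_geq // mulr0 add0r addr_ge0 // mulr_ge0 // ltW.
have Mpos : (0 < M)%N by rewrite addn_gt0 Npos.
pose h p := f p * conjc (g p).
have hle1 p : nc (h p) <= 1 by rewrite ncM nc_conj mulr_ile1 ?nc_ge0.
have hB : \sum_(p < M.+1 | (p : nat) \in rough K) nc (h p - 1) ^+ 2 / p%:R <= s ^+ 2.
  rewrite -[leRHS](@divfK _ 2) ?pnatr_eq0 // mulrC.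
  apply: (le_trans _ (ler_wpM2l _ (HK0 K M K0K))) => //.
  rewrite mulr_sumr; apply: ler_sum => p _.
  rewrite [leRHS]mulrCA [leRHS]mulrC ler_wpM2r ?invr_ge0 //; exact: nc_sub1_sqr.
have [c Hc] := concentration Mpos (fun p (pp : p \in rough K) => proj1 (andP pp))
   (fun p _ => hle1 p) s0 s1 hB.
pose H n := \prod_(p < M.+1 | ((p : nat) \in rough K) && (p %| n)%N) h p.
have Hc' : \sum_(1 <= n < M.+1) nc (H n - c) <= 17 * s * M%:R by [].
pose x n : R := exceptional K L M n.
have fdiff2 n m : nc (f n - f m) <= 2.
  by rewrite (le_trans (ncB _ _)) // (le_trans (lerD (fle1 _) (fle1 _))).
(* Where the decomposition fails, the trivial bound 2 is charged to [x] or to the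
   initial segment. *)
have step n : (1 <= n < N.+1)%N -> nc (f (n + d)%N - f n) <=
   2 * (x n + x (n + d)%N) + (nc (H n - c) + nc (H (n + d)%N - c)) +
   (eps / 4 + 2 * (n < n1)%:R).
  move=> /andP[n0 nN]; rewrite ltnS in nN.
  have nM : (n <= M)%N by rewrite (leq_trans nN) // leq_addr.
  have m0 : (0 < n + d)%N by rewrite addn_gt0 n0.
  have mM : (n + d <= M)%N by rewrite leq_add2r.
  have xn0 := exceptional_ge0 K L M n : 0 <= x n.
  have xm0 := exceptional_ge0 K L M (n + d) : 0 <= x (n + d)%N.
  have h1 := nc_ge0 (H n - c); have h2 := nc_ge0 (H (n + d)%N - c).
  have d2 := fdiff2 (n + d)%N n.
  have e4 : 0 <= eps / 4 by rewrite divr_ge0 // ltW.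
  have [nn1|n1n] := ltnP n n1; first by rewrite mulr1; lra.
  rewrite mulr0 addr0.
  have [xn|[sqn Ln]] := @exceptional_dichotomy R K L M n n0 nM; first by rewrite -/(x n) in xn; lra.
  have [xm|[sqm _]] := @exceptional_dichotomy R K L M (n + d) m0 mM; first by rewrite -/(x (n + d)%N) in xm; lra.
  have [smooth [j rou]] := shift_parts q k n0 Ln.
  rewrite -/Q -/d in smooth rou.
  have fn := multiplicative_decomposition fm f1 gm g1 g_unit n0 nM sqn.
  have fnd := multiplicative_decomposition fm f1 gm g1 g_unit m0 mM sqm.
  rewrite -/(H n) in fn; rewrite -/(H (n + d)%N) smooth in fnd.
  have hw := twisted_character_shift t hchi n0 m0 (leq_addr d n) smooth rou.
  rewrite addKn in hw.
  have w4 := le_trans hw (n1P n n1n n0).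
  rewrite -/(g ((n + d)`_(rough K))%N) -/(g (n`_(rough K))%N) in w4.
  set a := f (n`_(rough K)^')%N in fn fnd.
  set u := g ((n + d)`_(rough K))%N in fnd w4.
  set v := g (n`_(rough K))%N in fn w4.
  have nc3 : nc (H (n + d)%N) <= 1.
    rewrite /H; elim/big_rec: _ => [|p z _ z1]; first by rewrite nc1.
    by rewrite ncM mulr_ile1 ?nc_ge0.
  rewrite fn fnd (_ : _ - _ = a * (u - v) * H (n + d)%N + a * v * (H (n + d)%N - H n));
    last by ring.
  have a1 : nc a <= 1 by exact: fle1.
  have av : nc a * nc v <= 1 by rewrite mulr_ile1 ?nc_ge0 // gle1.
  clearbody a u v; rewrite (le_trans (ncD _ _)) // !ncM.
  have t1 : nc a * nc (u - v) * nc (H (n + d)%N) <= eps / 4.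
    rewrite (le_trans _ w4) // (le_trans (ler_piMr _ nc3)) ?mulr_ge0 ?nc_ge0 //.
    by rewrite ler_piMl // nc_ge0.
  have t2 : nc a * nc v * nc (H (n + d)%N - H n) <= nc (H n - c) + nc (H (n + d)%N - c).
    rewrite (le_trans (ler_piMl (nc_ge0 _) av)) // (le_trans (nc_tri c _ _)) //.
    by rewrite [nc (c - _)]nc_distC addrC.
  by apply: (le_trans (lerD t1 t2)); lra.
have X0 n : 0 <= x n by exact: exceptional_ge0.
have XM := @sum_exceptional_le R K L M Kpos.
rewrite -[exceptional _ _ _]/x in XM; clearbody x.
rewrite (le_trans (ler_sum_nat step)) // !big_split /=.
rewrite -!mulr_sumr !big_split /=.
have shift_sum (F : nat -> R) : (forall n, 0 <= F n) ->
    \sum_(1 <= n < N.+1) F (n + d)%N <= \sum_(1 <= n < M.+1) F n.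
  move=> F0; have -> : \sum_(1 <= n < N.+1) F (n + d)%N = \sum_(1 + d <= n < M.+1) F n.
    by rewrite big_addn /M subSn ?leq_addl // addnK.
  rewrite add1n.
  rewrite [leRHS](@big_cat_nat _ _ _ d.+1) //=; last by rewrite ltnS leq_addl.
  by rewrite lerDr sumr_ge0.
have init_sum (F : nat -> R) : (forall n, 0 <= F n) ->
    \sum_(1 <= n < N.+1) F n <= \sum_(1 <= n < M.+1) F n.
  move=> F0; rewrite [leRHS](@big_cat_nat _ _ _ N.+1) //=; last by rewrite ltnS leq_addr.
  by rewrite lerDl sumr_ge0.
have N0 n : 0 <= nc (H n - c) by exact: nc_ge0.
have i1 := init_sum _ X0; have i2 := shift_sum _ X0.
have i3 := init_sum _ N0; have i4 := shift_sum _ N0.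
have M0' : 0 <= M%:R :> R by [].
have XM' : \sum_(1 <= n < M.+1) x n <= M%:R * (eps / 16).
  by rewrite (le_trans XM) // ler_wpM2l //; lra.
have HM' : \sum_(1 <= n < M.+1) nc (H n - c) <= M%:R * (eps / 8).
  rewrite (le_trans Hc') // mulrC ler_wpM2l //; lra.
have n1s : \sum_(1 <= n < N.+1) (n < n1)%:R <= n1%:R :> R by exact: sum_initial_indicator.
rewrite sumr_const_nat subSS subn0 -[_ *+ N]mulr_natl.
have ME : M%:R = N%:R + d%:R :> R by rewrite natrD.
rewrite ME in XM' HM'.
have e1 : 0 <= eps * N%:R by rewrite mulr_ge0 // ltW.
have e2 : 0 <= eps * d%:R by rewrite mulr_ge0 // ltW.
apply: (le_trans (lerD (lerD (ler_wpM2l (ler0n _ 2) (lerD i1 i2)) (lerD i3 i4))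
  (lerD (lexx _) (ler_wpM2l (ler0n _ 2) n1s)))).
move: e1 e2 XM' HM'; move: (\sum_(1 <= n < M.+1) x n) => X.
move: (\sum_(1 <= n < M.+1) nc (H n - c)) => Y.
move: (N%:R : R) (d%:R : R) (n1%:R : R) => rN rd r1; clear.
lra.
Qed.

End MainEstimate.
(** * Rationally almost periodic functions of a measure-preserving map *)

Section L1Distance.
Context {R : realType} {d : measure_display} {T : measurableType d}.
Context (mu : probability T R).
Implicit Types (u v w : T -> R).

Definition dist1 u v : \bar R := (\int[mu]_x `|u x - v x|%:E)%E.

Arguments dist1 (u v)%_R.

Lemma measurable_dist u v : measurable_fun setT u -> measurable_fun setT v ->
  measurable_fun setT (fun x => `|u x - v x|%:E).
Proof.
move=> mu_ mv; apply/measurable_EFinP.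
by apply: measurableT_comp => //; exact: measurable_funB.
Qed.

Lemma dist1_ge0 u v : (0 <= dist1 u v)%E.
Proof. by apply: integral_ge0 => x _; rewrite lee_fin. Qed.

Lemma dist1C u v : dist1 u v = dist1 v u.
Proof. by apply: eq_integral => x _; rewrite distrC. Qed.

Lemma dist1xx u : dist1 u u = 0%E.
Proof.
by rewrite /dist1; under eq_integral do rewrite subrr normr0; rewrite integral0.
Qed.

Lemma dist1_tri v u w : measurable_fun setT u -> measurable_fun setT v ->
  measurable_fun setT w -> (dist1 u w <= dist1 u v + dist1 v w)%E.
Proof.
move=> mu_ mv mw; rewrite /dist1 -ge0_integralD //; [|exact: measurable_dist..].
apply: ge0_le_integral => //; first exact: measurable_dist.
  by apply: emeasurable_funD; exact: measurable_dist.
by move=> x _; rewrite -EFinD lee_fin (le_trans _ (ler_normD _ _)) // addrA subrK.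
Qed.

Lemma dist1_le u v u' v' (C : R) : 0 <= C ->
  measurable_fun setT u -> measurable_fun setT v ->
  measurable_fun setT u' -> measurable_fun setT v' ->
  (forall x, `|u x - v x| <= C * `|u' x - v' x|) ->
  (dist1 u v <= C%:E * dist1 u' v')%E.
Proof.
move=> C0 mu_ mv mu' mv' h; rewrite /dist1 -ge0_integralZl //;
  [|exact: measurable_dist].
apply: ge0_le_integral => //; first exact: measurable_dist.
  by apply: measurable_funeM; exact: measurable_dist.
by move=> x _; rewrite -EFinM lee_fin.
Qed.

End L1Distance.
Arguments dist1 {R d T} mu (u v)%_R.

Section MeasurePreserving.
Context {R : realType} {d : measure_display} {T : measurableType d}.
Context (mu : probability T R) (S : T -> T).

Definition measure_preserving : Prop :=
  measurable_fun setT S /\ forall A, measurable A -> mu (S @^-1` A) = mu A.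

Hypothesis mpS : measure_preserving.

Lemma measurable_iter n : measurable_fun setT (iter n S).
Proof.
case: mpS => mS _; elim: n => [|n ih]; first exact: measurable_id.
exact: (measurableT_comp mS ih).
Qed.

Lemma measurable_comp_iter d' (U : measurableType d') n (u : T -> U) :
  measurable_fun setT u -> measurable_fun setT (fun x => u (iter n S x)).
Proof. by move=> mu_; exact: (measurableT_comp mu_ (measurable_iter n)). Qed.

Lemma measure_preimage_iter n A : measurable A -> mu (iter n S @^-1` A) = mu A.
Proof.
move=> mA; elim: n => // n ih; case: mpS => mS inv.
rewrite -[RHS]ih -[RHS]inv; last first.
  by rewrite -[_ @^-1` _]setTI; exact: measurable_iter.
congr (mu _); apply/seteqP; split => x /=; rewrite -iterSr //.
Qed.

Lemma integral_iter n (F : T -> \bar R) : measurable_fun setT F ->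
  (forall x, (0 <= F x)%E) -> (\int[mu]_x F (iter n S x) = \int[mu]_x F x)%E.
Proof.
move=> mF F0.
have := ge0_integral_pushforward (measurable_iter n) mu measurableT mF (fun x _ => F0 x).
rewrite preimage_setT => <-; apply: eq_measure_integral => [|_ A mA _ /=]; first exact: measurable_iter.
by rewrite /pushforward measure_preimage_iter.
Qed.

Lemma dist1_iter n u v : measurable_fun setT u -> measurable_fun setT v ->
  dist1 mu (fun x => u (iter n S x)) (fun x => v (iter n S x)) = dist1 mu u v.
Proof.
move=> mu_ mv; rewrite /dist1.
by rewrite (integral_iter n (measurable_dist mu_ mv)) // => x; rewrite lee_fin.
Qed.

(** Rational almost periodicity. Closeness is required along all multiples of one
period: closeness along the period itself would only give a bound that grows
linearly with the multiple. *)
Definition rap (u : T -> R) : Prop :=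
  measurable_fun setT u /\ forall eps : R, 0 < eps -> exists2 Q, (0 < Q)%N &
    forall k, (dist1 mu (fun x => u (iter (Q * k) S x)) u <= eps%:E)%E.

Lemma rap_approx u : measurable_fun setT u ->
  (forall eps : R, 0 < eps -> exists2 v, rap v & (dist1 mu u v <= eps%:E)%E) ->
  rap u.
Proof.
move=> mu_ h; split=> // eps eps0.
have e3 : 0 < eps / 3 by rewrite divr_gt0.
have [v [mv rv] uv] := h _ e3; have [Q Q0 HQ] := rv _ e3.
exists Q => // k.
have mv' := measurable_comp_iter (Q * k) mv.
have mu' := measurable_comp_iter (Q * k) mu_.
apply: (le_trans (dist1_tri mu mu' mv' mu_)).
have h2 := dist1_tri mu mv' mv mu_.
rewrite dist1_iter // (_ : eps%:E = (eps / 3)%:E + ((eps / 3)%:E + (eps / 3)%:E))%E.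
  by rewrite leeD // (le_trans h2) // leeD // dist1C.
by rewrite -!EFinD; congr (_%:E); field.
Qed.

(** A common multiple of periods of [v] and [w] serves [u]. *)
Lemma rap_lipschitz2 (u v w : T -> R) (C : R) : 0 <= C -> measurable_fun setT u -> rap v -> rap w ->
  (forall x y, `|u x - u y| <= C * (`|v x - v y| + `|w x - w y|)) -> rap u.
Proof.
move=> C0 mu_ [mv rv] [mw rw] h; split=> // eps eps0.
pose e := eps / (2 * (C + 1)).
have C1 : 0 < C + 1 by rewrite ltr_wpDl.
have e0 : 0 < e by rewrite divr_gt0 // mulr_gt0.
have [Q Q0 HQ] := rv _ e0; have [Q' Q'0 HQ'] := rw _ e0.
exists (Q * Q')%N => [|k]; first by rewrite muln_gt0 Q0.
have h1 := HQ (Q' * k)%N; have h2 := HQ' (Q * k)%N.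
rewrite mulnA in h1; rewrite mulnA [(Q' * Q)%N]mulnC in h2.
set m := (Q * Q' * k)%N in h1 h2 *.
have mv' := measurable_comp_iter m mv; have mw' := measurable_comp_iter m mw.
have mu' := measurable_comp_iter m mu_.
apply: (@le_trans _ _ (C%:E * (dist1 mu (fun x => v (iter m S x)) v +
   dist1 mu (fun x => w (iter m S x)) w))%E).
  rewrite /dist1 -ge0_integralD //; [|exact: measurable_dist..].
  rewrite -ge0_integralZl //; last 2 first.
    by apply: emeasurable_funD; exact: measurable_dist.
    by move=> x _; rewrite -EFinD lee_fin addr_ge0.
  apply: ge0_le_integral => //; first exact: measurable_dist.
    by apply: measurable_funeM; apply: emeasurable_funD; exact: measurable_dist.
  by move=> x _; rewrite -EFinD -EFinM lee_fin.
apply: (@le_trans _ _ (C%:E * (e%:E + e%:E))%E).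
  by rewrite lee_wpmul2l // leeD.
rewrite -EFinD -EFinM lee_fin /e -mulrDl -mulr2n -mulr_natl mulrA.
rewrite ler_pdivrMr ?mulr_gt0 // mulrCA; nra.
Qed.

Lemma rap_cst (c : R) : rap (fun=> c).
Proof.
split; first exact: measurable_cst.
by move=> eps eps0; exists 1%N => // k; rewrite dist1xx lee_fin ltW.
Qed.

Lemma rapD u v : rap u -> rap v -> rap (fun x => u x + v x).
Proof.
move=> ru rv; have [mu_ _] := ru; have [mv _] := rv.
apply: (@rap_lipschitz2 _ u v 1) => //; first exact: measurable_funD.
by move=> x y; rewrite mul1r opprD addrACA ler_normD.
Qed.

Lemma rapZ (c : R) u : rap u -> rap (fun x => c * u x).
Proof.
move=> ru; have [mu_ _] := ru.
apply: (@rap_lipschitz2 _ u u `|c|) => //; first exact: measurable_funM.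
by move=> x y; rewrite -mulrBr normrM ler_wpM2l // lerDl.
Qed.

Lemma rap_sum (I : Type) (r : seq I) (F : I -> T -> R) : (forall i, rap (F i)) ->
  rap (fun x => \sum_(i <- r) F i x).
Proof.
move=> rF; elim: r => [|i r ih].
  by rewrite (_ : (fun x => _) = fun=> 0); [exact: rap_cst|apply/funext => x; rewrite big_nil].
rewrite (_ : (fun x => _) = fun x => F i x + \sum_(j <- r) F j x); first exact: rapD.
by apply/funext => x; rewrite big_cons.
Qed.

Lemma rap_lim (u : T -> R) (v : nat -> T -> R) (M : R) :
  (forall n, rap (v n)) -> (forall n x, `|v n x| <= M) ->
  (forall x, v n x @[n --> \oo] --> u x) -> rap u.
Proof.
move=> rv vM vu.
have mv n : measurable_fun setT (v n) by have [] := rv n.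
have mu_ : measurable_fun setT u.
  by apply: (measurable_fun_cvg (h := v)) => // x _; exact: vu.
have uM x : `|u x| <= M.
  rewrite -(cvg_lim _ (cvg_norm (vu x))) //; apply: limr_le.
    by apply/cvg_ex; exists `|u x|; apply: cvg_norm; exact: vu.
  by near=> n; exact: vM.
apply: rap_approx => // eps eps0.
have : (\int[mu]_x `|u x - v n x|%:E)%E @[n --> \oo] --> (\int[mu]_x (cst 0 x))%E.
  apply: (@dominated_cvg _ _ _ mu setT measurableT (fun n x => `|u x - v n x|%:E) _
    (cst (M + M)%:E)) => //.
  - by move=> n; exact: measurable_dist.
  - move=> x _ /=; apply: cvg_EFin; first by near=> n.
    rewrite (_ : fine \o _ = fun n => `|u x - v n x|) //.
    rewrite -[X in _ --> X](normr0 R) -[X in `|X|](subrr (u x)).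
    by apply: cvg_norm; apply: cvgB; [exact: cvg_cst|exact: vu].
  - exact: finite_measure_integrable_cst.
  - move=> n x _ /=; rewrite normr_id lee_fin (le_trans (ler_normB _ _)) // lerD //.
rewrite integral0 => /(_ [set y | (y < eps%:E)%E]) h.
have [|N _ /(_ N (leqnn N)) /= hN] := h.
  by apply: open_nbhs_nbhs; split; [exact: open_ereal_lt_ereal|rewrite /= lte_fin].
by exists (v N) => //; exact: ltW.
Unshelve. all: by end_near. Qed.

Definition rap_set (A : set T) : Prop := measurable A /\ rap (\1_A).

Lemma rap_setC A : rap_set A -> rap_set (~` A).
Proof.
move=> [mA rA]; have mA' := measurableC mA; split => //.
apply: (@rap_lipschitz2 _ _ _ 1 _ _ rA rA) => //.
move=> x y; rewrite !indicE !in_setC mul1r.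
by case: (x \in A); case: (y \in A) => /=;
  rewrite ?subrr ?sub0r ?subr0 ?normrN ?normr0 ?normr1 ?addr0 // lerDl.
Qed.

Lemma rap_setU A B : rap_set A -> rap_set B -> rap_set (A `|` B).
Proof.
move=> [mA rA] [mB rB]; have mAB := measurableU _ _ mA mB; split => //.
apply: (@rap_lipschitz2 _ _ _ 1 _ _ rA rB) => //.
move=> x y; rewrite !indicE !in_setU mul1r.
by case: (x \in A); case: (y \in A); case: (x \in B); case: (y \in B) => /=;
  rewrite ?subrr ?sub0r ?subr0 ?normrN ?normr0 ?normr1 ?addr0 ?add0r // lerDl.
Qed.

Lemma rap_set0 : rap_set set0.
Proof. by split => //; rewrite indic0; exact: rap_cst. Qed.

Lemma rap_bigcup (A : (set T)^nat) : (forall n, rap_set (A n)) ->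
  rap_set (\bigcup_n A n).
Proof.
move=> rA; split; first by apply: bigcup_measurable => n _; have [] := rA n.
pose B n := \big[setU/set0]_(i < n) A i.
have rB n : rap_set (B n).
  rewrite /B; elim/big_ind: _ => //; [exact: rap_set0|exact: rap_setU].
apply: (@rap_lim _ (fun n => \1_(B n)) 1); first by move=> n; have [] := rB n.
  by move=> n x; rewrite indicE normr_nat; case: (_ \in _).
move=> x; have [[m _ Amx]|nx] := pselect ((\bigcup_n A n) x).
  rewrite indicE mem_set; last by exists m.
  apply: cvg_near_cst; near=> n.
  rewrite indicE mem_set // /B -bigcup_mkord; exists m => //=.
  by near: n; exists m.+1.
rewrite indicE memNset //; apply: cvg_near_cst; near=> n.
rewrite indicE memNset // /B -bigcup_mkord => -[i _ Aix]; apply: nx; by exists i.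
Unshelve. all: by end_near. Qed.

(** Rational almost periodicity propagates from the generators of the
sigma-algebra to all measurable sets. *)
Lemma rap_generated (G : set (set T)) : (forall A, G A -> rap_set A) ->
  measurable `<=` <<s G >> -> forall A, measurable A -> rap_set A.
Proof.
move=> rG gen A mA.
have sub : <<s G >> `<=` rap_set.
  apply: smallest_sub => //; split; first exact: rap_set0.
    by move=> B rB; rewrite setTD; exact: rap_setC.
  by move=> F rF; exact: rap_bigcup.
exact: sub (gen _ mA).
Qed.

Lemma rap_integrable (u : T -> R) : (forall A, measurable A -> rap_set A) ->
  mu.-integrable setT (EFin \o u) -> rap u.
Proof.
move=> rall iu.
have mu_ : measurable_fun setT u by apply/measurable_EFinP; case/integrableP: iu.
apply: rap_approx => // eps eps0.
have [g [_ _ gu]] := approximation_sfun_integrable measurableT iu.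
have := gu [set y | (y < eps%:E)%E]; case.
  by apply: open_nbhs_nbhs; split; [exact: open_ereal_lt_ereal|rewrite /= lte_fin].
move=> N _ /(_ N (leqnn N)) /= hN; exists (g N : T -> R); last exact: ltW.
rewrite (_ : (g N : T -> R) = fun x => \sum_(y <- finmap.enum_fset (fset_set (range (g N))))
    y * \1_(g N @^-1` [set y]) x); last first.
  by apply/funext => x; rewrite fimfunE fsbig_finite.
apply: rap_sum => y; apply: rapZ.
by have [] := rall (g N @^-1` [set y]) (measurable_sfunP (g N) (measurable_set1 y)).
Qed.

End MeasurePreserving.

(** * Approximation by functions invariant under a power of the map *)

Section L1Cauchy.
Context {R : realType} {d : measure_display} {T : measurableType d}.
Context (mu : probability T R).

Local Notation pow2 eps j := (eps / (2 ^ j)%:R).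

(** Fast L1-Cauchy sequences of uniformly bounded functions converge in L1. The
limit is a pointwise upper limit, truncated so as to obey the bound everywhere. *)
Lemma fast_cauchy_L1 (g : nat -> T -> R) (M eps : R) : 0 <= M -> 0 < eps ->
  (forall j, measurable_fun setT (g j)) -> (forall j x, `|g j x| <= M) ->
  (forall j, (dist1 mu (g j.+1) (g j) <= (pow2 eps j.+1)%:E)%E) ->
  exists U : T -> R, [/\ measurable_fun setT U, forall x, `|U x| <= M &
    forall J, (dist1 mu U (g J) <= (pow2 eps J)%:E)%E].
Proof.
move=> M0 eps0 mg gM gC.
pose U x := Num.max (- M) (Num.min M (limn_sup (g ^~ x))).
have mU : measurable_fun setT U.
  apply: measurable_maxr; first exact: measurable_cst.
  apply: measurable_minr; first exact: measurable_cst.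
  apply: measurable_fun_limn_sup => //.
    by move=> x _; exists M => _ [j _ <-]; rewrite (le_trans (ler_norm _)).
  by move=> x _; exists (- M) => _ [j _ <-]; rewrite lerNl (le_trans (ler_norm _)) // normrN.
have UM x : `|U x| <= M.
  by rewrite ler_norml le_max lexx /= ge_max ge0_cp // ge_min lexx.
exists U; split => // J.
pose D i x : \bar R := `|g (J + i).+1 x - g (J + i)%N x|%:E.
have mD i : measurable_fun setT (D i) by exact: measurable_dist.
have D0 i x : (0 <= D i x)%E by rewrite lee_fin.
have UD x : (`|U x - g J x|%:E <= \sum_(0 <= i <oo) D i x)%E.
  have [fin|] := ltP (\sum_(0 <= i <oo) D i x)%E +oo%E; last first.
    by rewrite leye_eq => /eqP ->; rewrite leey.
  have tot0 : (0 <= \sum_(0 <= i <oo) D i x)%E by exact: nneseries_ge0.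
  have tfin : (\sum_(0 <= i <oo) D i x)%E \is a fin_num by rewrite ge0_fin_numE.
  set r := fine (\sum_(0 <= i <oo) D i x)%E.
  have rE : (\sum_(0 <= i <oo) D i x)%E = r%:E by rewrite fineK.
  pose a n := g (n + J)%N x.
  have part n : \sum_(0 <= i < n) `|a i.+1 - a i| <= r.
    rewrite -lee_fin -rE -sumEFin.
    rewrite (eq_bigr (fun i => D i x)) => [|i _]; last first.
      by rewrite /D /a addSn addnC.
    exact: nneseries_lim_ge.
  have ca : cvgn a.
    have : cvgn (series (telescope a)).
      apply: normed_cvg; apply: nondecreasing_is_cvgn.
        by apply/nondecreasing_seqP => n; rewrite -subr_ge0 seriesSB /=.
      by exists r => _ [n _ <-]; exact: part.
    rewrite telescopeK => /cvg_ex[/= l hl]; apply/cvg_ex; exists (l + a 0%N).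
    apply: (cvg_trans _ (cvgD hl (cvg_cst (a 0%N)))).
    by apply: near_eq_cvg; near=> n; rewrite /= subrK.
  have cg : (g ^~ x) n @[n --> \oo] --> limn a.
    by rewrite -(cvg_shiftn J).
  have aM : `|limn a| <= M.
    rewrite -(cvg_lim _ (cvg_norm ca)) //; apply: limr_le.
      by apply/cvg_ex; exists `|limn a|; exact: cvg_norm.
    by near=> n; exact: gM.
  have UE : U x = limn a.
    rewrite /U (cvg_limn_inf_sup cg).
    move: aM; rewrite ler_norml => /andP[aM1 aM2].
    by rewrite (min_idPr aM2) (max_idPr aM1).
  rewrite UE rE lee_fin.
  have cn : `|a n - g J x| @[n --> \oo] --> `|limn a - g J x|.
    by apply: cvg_norm; apply: cvgB => //; exact: cvg_cst.
  rewrite -(cvg_lim _ cn) //; apply: limr_le; first by apply/cvg_ex; exists `|limn a - g J x|.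
  near=> n; rewrite (le_trans _ (part n)) //.
  rewrite (_ : g J x = a 0%N) // -telescope_sumr // (le_trans (ler_norm_sum _ _ _)) //.
apply: (@le_trans _ _ (\int[mu]_x (\sum_(0 <= i <oo) D i x))%E).
  apply: ge0_le_integral => //; first exact: measurable_dist.
  by apply: ge0_emeasurable_sum.
rewrite integral_nneseries //.
have e20 : 0 <= pow2 eps J by rewrite divr_ge0 // ltW.
apply: le_trans (epsilon_trick0 xpredT e20).
apply: lee_nneseries => [i _ _|i _]; first by apply: integral_ge0 => x _.
apply: (le_trans (gC _)); rewrite lee_fin -addnS expnD natrM invfM mulrA //.
Unshelve. all: by end_near. Qed.

End L1Cauchy.

Section InvariantApproximation.
Context {R : realType} {d : measure_display} {T : measurableType d}.
Context (mu : probability T R) (S : T -> T).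
Hypothesis mpS : measure_preserving mu S.

Local Notation pow2 eps j := (eps / (2 ^ j)%:R).

Lemma dist1_average (I : nat) (F G : 'I_I -> T -> R) (c : R) : (0 < I)%N ->
  (forall l, measurable_fun setT (F l)) -> (forall l, measurable_fun setT (G l)) ->
  (forall l, (dist1 mu (F l) (G l) <= c%:E)%E) ->
  (dist1 mu (fun x => (I%:R^-1 * \sum_l F l x)%R) (fun x => (I%:R^-1 * \sum_l G l x)%R)
    <= c%:E)%E.
Proof.
move=> I0 mF mG h; have IR0 : 0 < I%:R :> R by rewrite ltr0n.
have mD l : measurable_fun setT (fun x => `|F l x - G l x|%:E) by exact: measurable_dist.
have mS (H : 'I_I -> T -> R) : (forall l, measurable_fun setT (H l)) ->
    measurable_fun setT (fun x => I%:R^-1 * \sum_l H l x).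
  move=> mH; apply: measurable_funM; first exact: measurable_cst.
  exact: measurable_sum.
apply: (@le_trans _ _ (\int[mu]_x (I%:R^-1%:E * \sum_l `|F l x - G l x|%:E))%E).
  apply: ge0_le_integral => //.
  - by apply: measurable_dist; exact: mS.
  - by apply: measurable_funeM; exact: emeasurable_sum.
  - move=> x _; rewrite sumEFin -EFinM lee_fin -mulrBr normrM ger0_norm ?invr_ge0 //.
    by rewrite ler_wpM2l ?invr_ge0 // -sumrB ler_norm_sum.
have S0 x : (0 <= \sum_l `|F l x - G l x|%:E)%E by apply: sume_ge0 => l _; rewrite lee_fin.
have mSum : measurable_fun setT (fun x => \sum_l `|F l x - G l x|%:E)%E.
  exact: emeasurable_sum.
rewrite ge0_integralZl ?lee_fin ?invr_ge0 //.
rewrite ge0_integral_sum //.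
apply: (@le_trans _ _ (I%:R^-1%:E * \sum_(l < I) c%:E)%E).
  rewrite lee_wpmul2l ?lee_fin ?invr_ge0 //; apply: lee_sum => l _; exact: h.
rewrite sumEFin sumr_const card_ord -EFinM -[c *+ I]mulr_natl mulrA.
by rewrite mulVf ?gt_eqF // mul1r.
Qed.

(** Each stage averages the preceding one over the next factor of a divisibility
chain of periods, so that stage [j] is the mean of [u] over the multiples of
[q 0] below the product of [q 0, ..., q j]. *)
Fixpoint tower_average (q : nat -> nat) (u : T -> R) (j : nat) : T -> R :=
  if j is i.+1 then fun x => (q i.+1)%:R^-1 *
    \sum_(l < q i.+1) tower_average q u i (iter (\prod_(k < i.+1) q k * l) S x)
  else u.

Section Tower.
Variables (q : nat -> nat) (u : T -> R) (M : R).
Hypotheses (q0 : forall j, (0 < q j)%N) (mu_ : measurable_fun setT u)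
  (uM : forall x, `|u x| <= M).
Local Notation g := (tower_average q u).
Local Notation Q j := (\prod_(k < j.+1) q k)%N.

Let qR0 j : 0 < (q j)%:R :> R. Proof. by rewrite ltr0n. Qed.

Lemma measurable_tower j : measurable_fun setT (g j).
Proof.
elim: j => [//|j ih] /=; apply: measurable_funM; first exact: measurable_cst.
by apply: measurable_sum => l; exact: (measurable_comp_iter mpS).
Qed.

Lemma tower_bounded j x : `|g j x| <= M.
Proof.
elim: j x => [//|j ih] x /=.
rewrite normrM ger0_norm ?invr_ge0 // mulrC ler_pdivrMr //.
rewrite (le_trans (ler_norm_sum _ _ _)) //.
by rewrite (le_trans (ler_sum _ (fun l _ => ih _))) // sumr_const card_ord mulr_natr.
Qed.

Lemma tower_shift n c j : (dist1 mu (fun x => u (iter n S x)) u <= c%:E)%E ->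
  (dist1 mu (fun x => g j (iter n S x)) (g j) <= c%:E)%E.
Proof.
move=> h; elim: j => [//|j ih] /=.
apply: dist1_average => //.
- by move=> l; apply: (measurable_comp_iter mpS n (u := fun x => g j (iter (Q j * l) S x)));
    exact: (measurable_comp_iter mpS _ (measurable_tower j)).
- by move=> l; exact: (measurable_comp_iter mpS _ (measurable_tower j)).
move=> l; under [X in dist1 _ X _]funext => x do rewrite -iterD addnC iterD.
rewrite (dist1_iter mpS _ (u := fun x => g j (iter n S x))) //.
  exact: (measurable_comp_iter mpS _ (measurable_tower j)).
exact: measurable_tower.
Qed.

(** Moving an average by one step of its own progression leaves two boundary
terms: the averages become invariant under the [q 0]-th power of [S]. *)
Lemma tower_telescope j x :
  (\prod_(1 <= i < j.+1) q i)%:R * (g j (iter (q 0%N) S x) - g j x)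
    = u (iter (Q j) S x) - u x.
Proof.
elim: j x => [|j ih] x /=; first by rewrite big_geq // mul1r big_ord1.
rewrite big_nat_recr //= natrM -mulrBr -sumrB mulrA.
rewrite mulfK ?gt_eqF // mulr_sumr.
transitivity (\sum_(l < q j.+1) (u (iter (Q j * l.+1) S x) - u (iter (Q j * l) S x))).
  apply: eq_bigr => l _; rewrite -iterD addnC iterD ih -iterD mulnS //.
rewrite -(big_mkord xpredT (fun l => u (iter (Q j * l.+1) S x) - u (iter (Q j * l) S x))).
by rewrite telescope_sumr // muln0 [in RHS]big_ord_recr.
Qed.

End Tower.

(** A bounded rationally almost periodic function is L1-close to a function that
is invariant under a power of [S]. Averaging over one period would need the mean
ergodic theorem; averaging over a divisibility chain of ever better periods gives
a sequence that is Cauchy with summable errors, whose limit is invariant under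
the first period. *)
Lemma invariant_approx (u : T -> R) (M eps : R) : rap mu S u ->
  (forall x, `|u x| <= M) -> 0 < eps -> exists (Q : nat) (U : T -> R),
  [/\ (0 < Q)%N, measurable_fun setT U, forall x, `|U x| <= M,
      (dist1 mu u U <= eps%:E)%E & {ae mu, forall x, U (iter Q S x) = U x}].
Proof.
move=> [mu_ ru] uM eps0.
have M0 : 0 <= M by rewrite (le_trans _ (uM point)).
have e0 j : 0 < pow2 eps j.+1 by rewrite divr_gt0 // ltr0n expn_gt0.
have /choice[q hq] : forall j, exists Q, (0 < Q)%N /\
    forall k, (dist1 mu (fun x => u (iter (Q * k) S x)) u <= (pow2 eps j.+1)%:E)%E.
  by move=> j; have [Q Q0 HQ] := ru _ (e0 j); exists Q.
have q0 j : (0 < q j)%N by have [] := hq j.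
pose Q j := (\prod_(k < j.+1) q k)%N.
have uQ j k : (dist1 mu (fun x => u (iter (Q j * k) S x)) u <= (pow2 eps j.+1)%:E)%E.
  have [_ /(_ (\prod_(k < j) q k * k)%N)] := hq j.
  by rewrite /Q big_ord_recr /= mulnA [(q j * _)%N]mulnC.
pose g := tower_average q u.
have mg j : measurable_fun setT (g j) by exact: measurable_tower.
have gM j x : `|g j x| <= M by exact: tower_bounded.
have gC j : (dist1 mu (g j.+1) (g j) <= (pow2 eps j.+1)%:E)%E.
  rewrite (_ : g j = fun x => (q j.+1)%:R^-1 * \sum_(l < q j.+1) g j x); last first.
    apply/funext => x; rewrite sumr_const card_ord -[g j x *+ _]mulr_natl mulrA mulVf ?mul1r //.
    by rewrite pnatr_eq0 -lt0n.
  apply: dist1_average; [exact: q0| | |].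
  - by move=> l; exact: (measurable_comp_iter mpS _ (mg j)).
  - by move=> l; exact: (mg j).
  by move=> l; apply: tower_shift => //; exact: uQ.
have [U [mU UM Ug]] := fast_cauchy_L1 M0 eps0 mg gM gC.
exists (q 0%N), U; split => //.
  by rewrite dist1C (le_trans (Ug 0%N)) // expn0 divr1.
have mUq := measurable_comp_iter mpS (q 0%N) mU.
have inv j : (dist1 mu (fun x => g j (iter (q 0%N) S x)) (g j) <= (pow2 eps j)%:E)%E.
  apply: (@le_trans _ _ (dist1 mu (fun x => u (iter (Q j) S x)) u)).
    rewrite -[leRHS]mul1e; apply: dist1_le => //.
    - exact: (measurable_comp_iter mpS _ (mg j)).
    - exact: (measurable_comp_iter mpS _ mu_).
    move=> x; rewrite mul1r /Q -(tower_telescope u q0 j x) normrM normr_nat.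
    rewrite ler_peMl // ler1n prodn_gt0 //.
  have := uQ j 1%N; rewrite muln1 => /le_trans; apply.
  rewrite lee_fin ler_wpM2l ?(ltW eps0) // lef_pV2 ?posrE ?ltr0n ?expn_gt0 //.
  by rewrite ler_nat leq_exp2l.
have zero : dist1 mu (fun x => U (iter (q 0%N) S x)) U = 0%E.
  apply/eqP; rewrite eq_le dist1_ge0 andbT; apply/lee_addgt0Pr => e e1; rewrite add0e.
  have [j hj] : exists j, 3 * pow2 eps j <= e.
    exists (Num.bound (3 * eps / e)).
    rewrite mulrA ler_pdivrMr ?ltr0n ?expn_gt0 // [leRHS]mulrC -ler_pdivrMr //.
    rewrite (le_trans (ltW (archi_boundP _))) ?divr_ge0 ?mulr_ge0 ?(ltW eps0) ?(ltW e1) //.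
    by rewrite ler_nat ltnW // ltn_expl.
  have mgq := measurable_comp_iter mpS (q 0%N) (mg j).
  apply: (le_trans (dist1_tri mu mUq mgq mU)).
  apply: (@le_trans _ _ ((pow2 eps j)%:E + ((pow2 eps j)%:E + (pow2 eps j)%:E))%E).
    rewrite leeD //; first by rewrite (dist1_iter mpS).
    by rewrite (le_trans (dist1_tri mu mgq (mg j) mU)) // leeD // dist1C.
  by rewrite -!EFinD lee_fin; lra.
have mdU : measurable_fun setT (fun x => (U (iter (q 0%N) S x) - U x)%:E).
  by apply/measurable_EFinP; exact: measurable_funB.
have /(ae_eq_integral_abs mu measurableT mdU) ae0 :
  (\int[mu]_x `|(U (iter (q 0%N) S x) - U x)%:E| = 0)%E by exact: zero.
apply: filterS ae0 => x /(_ I) [] /eqP; rewrite subr_eq0 => /eqP //.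
Qed.

End InvariantApproximation.

(** * Rational discrete spectrum *)

Section RootsOfUnity.
Context {R : realType}.
Implicit Types (a b : R).

Lemma expi2piD a b : expi2pi (a + b) = expi2pi a * expi2pi b.
Proof. by rewrite /expi2pi mulrDr cisD. Qed.

Lemma expi2pi0 : expi2pi 0 = 1 :> R[i].
Proof. by rewrite /expi2pi /cis mulr0 cos0 sin0. Qed.

Lemma expi2pi1 : expi2pi 1 = 1 :> R[i].
Proof. by rewrite /expi2pi /cis mulr1 mulr_natl cos2pi sin2pi. Qed.

Lemma expi2piX a n : expi2pi (n%:R * a) = expi2pi a ^+ n.
Proof.
elim: n => [|n ih]; first by rewrite mul0r expi2pi0.
by rewrite -natr1 mulrDl mul1r expi2piD ih exprSr.
Qed.

Lemma expi2pi_nat n : expi2pi n%:R = 1 :> R[i].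
Proof. by rewrite -[n%:R]mulr1 expi2piX expi2pi1 expr1n. Qed.

Lemma nc_expi2pi a : nc (expi2pi a) = 1.
Proof. exact: nc_cis. Qed.

Lemma expi2pi_neq1 a : 0 < a < 1 -> expi2pi a != 1.
Proof.
move=> /andP[a0 a1]; apply/eqP => /(congr1 (@complex.Re R)) /=.
have -> : 2 * pi * a = pi * a + pi * a by ring.
have s0 : 0 < sin (pi * a).
  by rewrite sin_gt0_pi // mulr_gt0 ?pi_gt0 //= gtr_pMr ?pi_gt0.
rewrite cosD -!expr2 => h; have := cos2Dsin2 (pi * a).
by have := exprn_gt0 2 s0; lra.
Qed.

Lemma ncX (z : R[i]) n : nc (z ^+ n) = nc z ^+ n.
Proof. by elim: n => [|n ih]; rewrite ?expr0 ?nc1 // !exprS ncM ih. Qed.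

End RootsOfUnity.

Section ComplexMeasurable.
Context {R : realType} {d : measure_display} {T : measurableType d}.
Context (mu : probability T R).
Implicit Types (g h : T -> R[i]).

Definition cmeas g := measurable_fun setT (fun x => complex.Re (g x)) /\
  measurable_fun setT (fun x => complex.Im (g x)).

Lemma cmeasD g h : cmeas g -> cmeas h -> cmeas (fun x => g x + h x).
Proof.
move=> [rg ig] [rh ih]; split.
- rewrite (_ : (fun x => _) = (fun x => complex.Re (g x) + complex.Re (h x))).
    exact: measurable_funD.
  by apply/funext => x; rewrite ReD.
- rewrite (_ : (fun x => _) = (fun x => complex.Im (g x) + complex.Im (h x))).
    exact: measurable_funD.
  by apply/funext => x; rewrite ImD.
Qed.

Lemma cmeasZ (c : R[i]) g : cmeas g -> cmeas (fun x => c * g x).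
Proof.
case: c => a b [rg ig]; split.
- rewrite (_ : (fun x => _) = (fun x => a * complex.Re (g x) - b * complex.Im (g x))).
    by apply: measurable_funB; apply: measurable_funM => //; exact: measurable_cst.
  by apply/funext => x; case: (g x).
- rewrite (_ : (fun x => _) = (fun x => a * complex.Im (g x) + b * complex.Re (g x))).
    by apply: measurable_funD; apply: measurable_funM => //; exact: measurable_cst.
  by apply/funext => x; case: (g x).
Qed.

Lemma cmeas_cst (c : R[i]) : cmeas (fun=> c).
Proof. by split; exact: measurable_cst. Qed.

Lemma cmeas_sum (I : Type) (r : seq I) (F : I -> T -> R[i]) :
  (forall i, cmeas (F i)) -> cmeas (fun x => \sum_(i <- r) F i x).
Proof.
move=> mF; elim: r => [|i r ih].
  by under [X in cmeas X]eq_fun do rewrite big_nil; exact: cmeas_cst.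
by under [X in cmeas X]eq_fun do rewrite big_cons; exact: cmeasD.
Qed.

Lemma measurable_nc2 g : cmeas g -> measurable_fun setT (fun x => (nc (g x) ^+ 2)%:E).
Proof.
move=> [rg ig]; apply/measurable_EFinP.
rewrite (_ : (fun x => _) = (fun x => complex.Re (g x) ^+ 2 + complex.Im (g x) ^+ 2)).
  by apply: measurable_funD; exact: measurable_funX.
by apply/funext => x; rewrite nc_sqr.
Qed.

Lemma measurable_nc g : cmeas g -> measurable_fun setT (fun x => nc (g x)).
Proof.
move=> mg; rewrite (_ : (fun x => _) = (fun x => Num.sqrt (nc (g x) ^+ 2))).
  apply: (measurableT_comp (continuous_measurable_fun (@sqrt_continuous R))).
  by apply/measurable_EFinP; exact: measurable_nc2.
by apply/funext => x; rewrite sqrtr_sqr ger0_norm ?nc_ge0.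
Qed.

Lemma L2normE g : L2norm mu g = sqrte (\int[mu]_x (nc (g x) ^+ 2)%:E)%E.
Proof.
rewrite /L2norm unlock /Lnorm -poweR12_sqrt; last first.
  by apply: integral_ge0 => x _; rewrite lee_fin sqr_ge0.
congr poweR; apply: eq_integral => x _ /=.
by rewrite -/(nc (g x)) ger0_norm ?nc_ge0 // powR_mulrn ?nc_ge0.
Qed.

Lemma L2norm_le g (e : R) : 0 <= e ->
  ((\int[mu]_x (nc (g x) ^+ 2)%:E <= (e ^+ 2)%:E)%E -> L2norm mu g <= e%:E)%E.
Proof.
move=> e0 h; rewrite L2normE (_ : e%:E = sqrte (e ^+ 2)%:E); last first.
  by rewrite /= sqrtr_sqr ger0_norm.
by rewrite lee_sqrt // lee_fin sqr_ge0.
Qed.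

Lemma L2norm_lty g : (L2norm mu g < +oo)%E ->
  (\int[mu]_x (nc (g x) ^+ 2)%:E < +oo)%E.
Proof.
rewrite L2normE; have : (0 <= \int[mu]_x (nc (g x) ^+ 2)%:E)%E.
  by apply: integral_ge0 => x _; rewrite lee_fin sqr_ge0.
by case: (\int[mu]_x _)%E => // r _ _; rewrite ltry.
Qed.

Lemma in_L2_bounded g (B : R) : cmeas g -> (forall x, nc (g x) <= B) -> in_L2 mu g.
Proof.
move=> mg gB; have [rg ig] := mg; split => //.
have B0 : 0 <= B by rewrite (le_trans (nc_ge0 _) (gB point)).
apply: (@le_lt_trans _ _ B%:E); last by rewrite ltry.
apply: L2norm_le => //; rewrite -[leRHS]mule1 -(@probability_setT _ _ _ mu) -integral_cst //.
apply: ge0_le_integral => //.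
- by move=> x _; rewrite lee_fin sqr_ge0.
- exact: measurable_nc2.
by move=> x _; rewrite lee_fin lerXn2r // ?nnegrE ?nc_ge0.
Qed.

Lemma ae_false : ~ {ae mu, forall x : T, False}.
Proof.
move=> [A [mA A0 sA]]; have : A = setT by apply/seteqP; split => // x _; exact: sA.
by move=> AT; move: A0; rewrite AT probability_setT => /eqP; rewrite onee_eq0.
Qed.

End ComplexMeasurable.

Section SquareApproximation.
Context {R : realType} {d : measure_display} {T : measurableType d}.
Context (mu : probability T R) (S : T -> T).
Hypotheses (mpS : measure_preserving mu S)
  (rall : forall A, measurable A -> rap_set mu S A).

Lemma rap_bounded (u : T -> R) (M : R) : measurable_fun setT u ->
  (forall x, `|u x| <= M) -> rap mu S u.
Proof.
move=> mu_ uM; apply: rap_integrable => //.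
apply: measurable_bounded_integrable => //.
  by rewrite [X in (X < _)%E]probability_setT ltry.
by exists M; split; [exact: num_real|move=> z Mz x _; rewrite /= (le_trans (uM x)) // ltW].
Qed.

Definition clip (n : nat) (y : R) : R := Num.max (- n%:R) (Num.min n%:R y).

Lemma clip_bounded n y : `|clip n y| <= n%:R.
Proof. by rewrite ler_norml le_max lexx /= ge_max ge0_cp // ge_min lexx. Qed.

Lemma clip_id n y : `|y| <= n%:R -> clip n y = y.
Proof. by rewrite ler_norml => /andP[y1 y2]; rewrite /clip (min_idPr y2) (max_idPr y1). Qed.

Lemma clip_sqr n y : (y - clip n y) ^+ 2 <= y ^+ 2.
Proof.
have n0 : 0 <= n%:R :> R by [].
rewrite /clip; case: (leP n%:R y) => h1.
  rewrite max_r ?ge0_cp //; nra.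
case: (leP (- n%:R) y) => h2; first by rewrite subrr expr0n sqr_ge0.
nra.
Qed.

(** A bound in L1 suffices for bounded functions, as [y ^+ 2 <= 2 * N * |y|] for the
difference [y] of two functions bounded by [N]; an unbounded [u] is clipped at a
height [N] first. *)
Lemma invariant_approx_sqr (u : T -> R) (e : R) : measurable_fun setT u ->
  (\int[mu]_x (u x ^+ 2)%:E < +oo)%E -> 0 < e ->
  exists (Q : nat) (U : T -> R) (M : R),
  [/\ (0 < Q)%N, measurable_fun setT U, forall x, `|U x| <= M,
      (\int[mu]_x ((u x - U x) ^+ 2)%:E <= e%:E)%E &
      {ae mu, forall x, U (iter Q S x) = U x}].
Proof.
move=> mu_ ufin e0; have e4 : 0 < e / 4 by rewrite divr_gt0.
pose v n x := clip n (u x).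
have mv n : measurable_fun setT (v n).
  apply: measurable_maxr; first exact: measurable_cst.
  by apply: measurable_minr => //; exact: measurable_cst.
have msq (a b : T -> R) : measurable_fun setT a -> measurable_fun setT b ->
    measurable_fun setT (fun x => ((a x - b x) ^+ 2)%:E).
  by move=> ma mb; apply/measurable_EFinP; apply: measurable_funX; exact: measurable_funB.
have cv : (\int[mu]_x ((u x - v n x) ^+ 2)%:E)%E @[n --> \oo] --> (\int[mu]_x (cst 0 x))%E.
  apply: (@dominated_cvg _ _ _ mu setT measurableT (fun n x => ((u x - v n x) ^+ 2)%:E) _
    (fun x => (u x ^+ 2)%:E)) => //.
  - by move=> n; exact: msq.
  - move=> x _ /=; apply: cvg_near_cst; near=> n.
    rewrite /v clip_id ?subrr ?expr0n //.
    near: n; exists (Num.bound `|u x|) => // n /= hn.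
    by rewrite (le_trans (ltW (archi_boundP _))) // ler_nat.
  - apply/integrableP; split; first by apply/measurable_EFinP; exact: measurable_funX.
    by under eq_integral => x _ do rewrite gee0_abs ?lee_fin ?sqr_ge0 //.
  - move=> n x _ /=; rewrite ger0_norm ?sqr_ge0 // lee_fin; exact: clip_sqr.
rewrite integral0 in cv.
have [N hN] : exists N, (\int[mu]_x ((u x - v N x) ^+ 2)%:E <= (e / 4)%:E)%E.
  have := cv [set y | (y < (e / 4)%:E)%E]; case.
    by apply: open_nbhs_nbhs; split; [exact: open_ereal_lt_ereal|rewrite /= lte_fin].
  by move=> N _ /(_ N (leqnn N)) /= hN; exists N; exact: ltW.
have vN x : `|v N x| <= N%:R by exact: clip_bounded.
pose c : R := 8 * (N%:R + 1).
have c0 : 0 < c by rewrite mulr_gt0 // ltr_wpDl.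
have [Q [U [Q0 mU UN vU inv]]] :=
  invariant_approx mpS (rap_bounded (mv N) vN) vN (divr_gt0 e0 c0).
exists Q, U, N%:R; split => //.
apply: (@le_trans _ _ (\int[mu]_x (2%:E * ((u x - v N x) ^+ 2)%:E +
   (4 * N%:R)%:E * `|v N x - U x|%:E))%E).
  apply: ge0_le_integral => //.
  - by move=> x _; rewrite lee_fin sqr_ge0.
  - exact: msq.
  - by apply: emeasurable_funD; apply: measurable_funeM; [exact: msq|exact: measurable_dist].
  move=> x _; rewrite -!EFinM -EFinD lee_fin.
  have -> : u x - U x = (u x - v N x) + (v N x - U x) by ring.
  have b2 : `|v N x - U x| <= 2 * N%:R.
    by rewrite (le_trans (ler_normB _ _)) // mulr2n mulrDl mul1r lerD.
  have b3 : (v N x - U x) ^+ 2 <= 2 * N%:R * `|v N x - U x|.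
    by rewrite -real_normK ?num_real // expr2 ler_wpM2r.
  have := sqr_ge0 ((u x - v N x) - (v N x - U x)).
  rewrite !sqrrD sqrrN; lra.
rewrite ge0_integralD //; last 2 first.
- by apply: measurable_funeM; exact: msq.
- by apply: measurable_funeM; exact: measurable_dist.
rewrite ge0_integralZl //; [|exact: msq|by move=> x _; rewrite lee_fin sqr_ge0].
rewrite ge0_integralZl //; [|exact: measurable_dist].
have h2 : ((4 * N%:R)%:E * dist1 mu (v N) U <= (e / 2)%:E)%E.
  apply: (le_trans (lee_wpmul2l _ vU)); first by rewrite lee_fin mulr_ge0.
  rewrite -EFinM lee_fin mulrA ler_pdivrMr // /c; have : 0 <= N%:R :> R by []. nra.
apply: (@le_trans _ _ (2%:E * (e / 4)%:E + (e / 2)%:E)%E).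
  by rewrite leeD // lee_wpmul2l.
by rewrite -EFinM -EFinD lee_fin; lra.
Unshelve. all: try by end_near.
all: by move=> x _; rewrite -EFinM lee_fin mulr_ge0 ?sqr_ge0 ?mulr_ge0.
Qed.

End SquareApproximation.

Section EigenDecomposition.
Context {R : realType} {d : measure_display} {T : measurableType d}.
Context (mu : probability T R) (S : T -> T).
Hypothesis mpS : measure_preserving mu S.

Lemma cmeas_iter n (g : T -> R[i]) : cmeas g -> cmeas (fun x => g (iter n S x)).
Proof.
move=> [rg ig]; split.
  exact: (measurable_comp_iter mpS n (u := fun x => complex.Re (g x))).
exact: (measurable_comp_iter mpS n (u := fun x => complex.Im (g x))).
Qed.

(** The projection to the eigenspace of [e(j / Q)] of a function invariant under
the Q-th power of [S]: a discrete Fourier coefficient along the orbit. *)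
Definition eigen_part (Q : nat) (G : T -> R[i]) (j : nat) (x : T) : R[i] :=
  Q%:R^-1 * \sum_(r < Q) expi2pi (- Q%:R^-1) ^+ (j * r) * G (iter r S x).

Variables (Q : nat) (G : T -> R[i]).
Hypotheses (Q0 : (0 < Q)%N) (mG : cmeas G)
  (invG : {ae mu, forall x, G (iter Q S x) = G x}).

Let w : R[i] := expi2pi Q%:R^-1.
Let v : R[i] := expi2pi (- Q%:R^-1).

Let QR0 : Q%:R != 0 :> R. Proof. by rewrite pnatr_eq0 -lt0n. Qed.
Let QC0 : Q%:R != 0 :> R[i]. Proof. by rewrite pnatr_eq0 -lt0n. Qed.

Let vw : v * w = 1.
Proof. by rewrite -expi2piD addNr expi2pi0. Qed.

Let wQ : w ^+ Q = 1.
Proof. by rewrite -expi2piX divff // expi2pi1. Qed.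

Let vQ : v ^+ Q = 1.
Proof. by have := congr1 (fun z => z ^+ Q) vw; rewrite exprMn wQ mulr1 expr1n. Qed.

Lemma cmeas_eigen_part j : cmeas (eigen_part Q G j).
Proof.
apply: cmeasZ; apply: cmeas_sum => r; apply: cmeasZ; exact: cmeas_iter.
Qed.

Lemma eigen_part_bounded (B : R) : (forall x, nc (G x) <= B) ->
  forall j x, nc (eigen_part Q G j x) <= B.
Proof.
move=> GB j x; rewrite /eigen_part ncM.
have -> : nc (Q%:R^-1 : R[i]) = Q%:R^-1.
  by rewrite -[Q%:R^-1]/(Q%:R^-1) (_ : (Q%:R^-1 : R[i]) = (Q%:R^-1 : R)%:C%C)
    ?nc_real ?ger0_norm ?invr_ge0 // fmorphV rmorph_nat.
rewrite mulrC ler_pdivrMr ?ltr0n // (le_trans (nc_sum _ _ _)) //.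
rewrite (@le_trans _ _ (\sum_(r < Q) B)) //.
  by apply: ler_sum => r _; rewrite ncM ncX nc_expi2pi expr1n mul1r.
by rewrite sumr_const card_ord mulr_natr.
Qed.

Lemma eigen_part_eigen j :
  {ae mu, forall x, eigen_part Q G j (S x) = expi2pi (j%:R / Q%:R) * eigen_part Q G j x}.
Proof.
apply: filterS invG => x Gx; rewrite expi2piX -/w /eigen_part -/v mulrCA; congr (_ * _).
pose c r := v ^+ (j * r) * G (iter r S x).
have cQ : c Q = c 0%N by rewrite /c muln0 expr0 mulnC exprM vQ expr1n Gx.
transitivity (\sum_(r < Q) w ^+ j * c r.+1).
  apply: eq_bigr => r _; rewrite /c mulnS exprD !mulrA -exprMn [w * v]mulrC vw.
  by rewrite expr1n mul1r iterSr.
rewrite -mulr_sumr; congr (_ * _).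
have : \sum_(r < Q.+1) c r = \sum_(r < Q) c r + c Q by rewrite big_ord_recr.
by rewrite big_ord_recl /= cQ [X in X = _]addrC => /addIr.
Qed.

Lemma sum_eigen_parts x : \sum_(j < Q) eigen_part Q G j x = G x.
Proof.
rewrite /eigen_part -mulr_sumr exchange_big /=.
rewrite (bigD1 (Ordinal Q0)) //= [X in _ + X]big1 ?addr0 => [|r r0].
  under eq_bigr do rewrite muln0 expr0 mul1r.
  by rewrite sumr_const card_ord -[G x *+ Q]mulr_natl mulrA mulVf // mul1r.
rewrite -mulr_suml -/v; under eq_bigr do rewrite mulnC exprM.
suff -> : \sum_(j < Q) (v ^+ r) ^+ j = 0 by rewrite mul0r.
have r0' : (0 < r)%N by rewrite lt0n.
have vr : v ^+ r - 1 != 0.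
  rewrite subr_eq0; apply/eqP => vr1.
  have : w ^+ r = 1 by rewrite -[LHS]mul1r -vr1 -exprMn vw expr1n.
  rewrite -expi2piX; apply/eqP/expi2pi_neq1.
  rewrite divr_gt0 ?ltr0n //= ltr_pdivrMr ?ltr0n // mul1r ltr_nat //.
apply: (mulfI vr); rewrite mulr0 -subrX1 -exprM mulnC exprM vQ expr1n subrr //.
Qed.

End EigenDecomposition.

Section RationalSpectrum.
Context {R : realType} {d : measure_display} {T : measurableType d}.
Context (mu : probability T R) (S : T -> T).
Hypotheses (mpS : measure_preserving mu S)
  (rall : forall A, measurable A -> rap_set mu S A).

Lemma rational_frac (j Q : nat) : rational (j%:R / Q%:R : R).
Proof. by exists (j%:R / Q%:R) => //; rewrite fmorph_div !rmorph_nat. Qed.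

Lemma invariant_approx_complex (h : T -> R[i]) (e : R) : in_L2 mu h -> 0 < e ->
  exists (Q : nat) (G : T -> R[i]) (B : R),
  [/\ (0 < Q)%N, cmeas G, forall x, nc (G x) <= B,
      (\int[mu]_x (nc (h x - G x) ^+ 2)%:E <= e%:E)%E &
      {ae mu, forall x, G (iter Q S x) = G x}].
Proof.
move=> [rh ih /L2norm_lty hfin] e0; have e2 : 0 < e / 2 by rewrite divr_gt0.
have mh : cmeas h by [].
have Rfin : (\int[mu]_x (complex.Re (h x) ^+ 2)%:E < +oo)%E.
  apply: le_lt_trans hfin; apply: ge0_le_integral => //.
  - by move=> x _; rewrite lee_fin sqr_ge0.
  - by apply/measurable_EFinP; exact: measurable_funX.
  - exact: measurable_nc2.
  - by move=> x _; rewrite lee_fin nc_sqr lerDl sqr_ge0.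
have Ifin : (\int[mu]_x (complex.Im (h x) ^+ 2)%:E < +oo)%E.
  apply: le_lt_trans hfin; apply: ge0_le_integral => //.
  - by move=> x _; rewrite lee_fin sqr_ge0.
  - by apply/measurable_EFinP; exact: measurable_funX.
  - exact: measurable_nc2.
  - by move=> x _; rewrite lee_fin nc_sqr lerDr sqr_ge0.
have [Q1 [U [M1 [Q10 mU UM hU invU]]]] := invariant_approx_sqr mpS rall rh Rfin e2.
have [Q2 [V [M2 [Q20 mV VM hV invV]]]] := invariant_approx_sqr mpS rall ih Ifin e2.
exists (Q1 * Q2)%N, (fun x => (U x +i* V x)%C), (M1 + M2); split => //.
- by rewrite muln_gt0 Q10.
- by move=> x; exact: (le_trans (nc_le_ReIm (U x +i* V x)%C) (lerD (UM x) (VM x))).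
- rewrite (_ : e%:E = (e / 2)%:E + (e / 2)%:E)%E; last by rewrite -EFinD -splitr.
  apply: le_trans (leeD hU hV).
  have m1 : measurable_fun setT (fun x => ((complex.Re (h x) - U x) ^+ 2)%:E).
    by apply/measurable_EFinP; apply: measurable_funX; exact: measurable_funB.
  have m2 : measurable_fun setT (fun x => ((complex.Im (h x) - V x) ^+ 2)%:E).
    by apply/measurable_EFinP; apply: measurable_funX; exact: measurable_funB.
  rewrite -ge0_integralD //; try by move=> x _; rewrite lee_fin sqr_ge0.
  rewrite le_eqVlt; apply/orP; left; apply/eqP; apply: eq_integral => x _.
  by rewrite nc_sqr ReB ImB EFinD.
have inv_iter (u : T -> R) (Q : nat) : {ae mu, forall x, u (iter Q S x) = u x} ->
    forall k, {ae mu, forall x, u (iter (Q * k) S x) = u x}.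
  move=> iu; elim=> [|k ihk]; first by apply: aeW => x; rewrite muln0.
  have iu' : {ae mu, forall x, u (iter Q S (iter (Q * k) S x)) = u (iter (Q * k) S x)}.
    case: iu => A [mA A0 sA]; exists (iter (Q * k) S @^-1` A); split.
    - by rewrite -[_ @^-1` _]setTI; exact: (measurable_iter mpS).
    - by rewrite (measure_preimage_iter mpS).
    - by move=> x /= nx; apply: sA.
  by apply: filterS2 ihk iu' => x h1 h2; rewrite mulnS iterD h2.
have i1 := inv_iter _ _ invU Q2; have i2 := inv_iter _ _ invV Q1.
rewrite mulnC in i2.
by apply: filterS2 i1 i2 => x -> ->.
Qed.

Theorem rap_rational_discrete_spectrum : rational_discrete_spectrum mu S.
Proof.
move=> h hL2 e e0; pose e2 := e / 2.
have e20 : 0 < e2 by rewrite divr_gt0.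
have [Q [G [B [Q0 mG GB hG invG]]]] := invariant_approx_complex hL2 (exprn_gt0 2 e20).
pose g (j : 'I_Q) := eigen_part S Q G j.
have mg j : cmeas (g j) by exact: (cmeas_eigen_part mpS).
(* A part that vanishes almost everywhere is not an eigenfunction: the constant 1
   takes its place, with coefficient 0. *)
pose null (j : 'I_Q) := `[< {ae mu, forall x, g j x = 0} >].
exists Q, (fun j => if null j then 0 else 1),
  (fun j => if null j then fun=> 1 else g j); split.
  move=> j; rewrite /null; case: asboolP => [_|nj]; last first.
    exists (j%:R / Q%:R); split; last split => //.
    - rewrite divr_ge0 //= ltr_pdivrMr ?ltr0n // mul1r ltr_nat //.
    - exact: rational_frac.
    - exact: (in_L2_bounded mu (mg j) (eigen_part_bounded S Q0 GB j)).
    - exact: eigen_part_eigen.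
  exists 0; rewrite lexx ltr01; split => //.
    by have := rational_frac 0 1; rewrite mul0r.
  split.
  - by apply: (@in_L2_bounded _ _ _ _ _ 1) => [|x]; [exact: cmeas_cst|rewrite nc1].
  - move=> h1; apply: (@ae_false _ _ _ mu); apply: filterS h1 => x /eqP.
    by rewrite oner_eq0.
  - by apply: aeW => x; rewrite expi2pi0 mulr1.
apply: (@le_lt_trans _ _ e2%:E); last by rewrite lte_fin /e2 ltr_pdivrMr // ltr_pMr // ltr1n.
apply: L2norm_le; first exact: ltW.
apply: le_trans hG; rewrite le_eqVlt; apply/orP; left; apply/eqP.
have [rh ih _] := hL2.
have mGsum : cmeas (fun x => - 1 * (\sum_(j < Q) (if null j then 0 else 1) *
    (if null j then fun=> 1 else g j) x)).
  apply: cmeasZ; apply: cmeas_sum => j; apply: cmeasZ.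
  by case: (null j) => //; exact: cmeas_cst.
have mG' : cmeas (fun x => - 1 * G x) by exact: cmeasZ.
have hcm : cmeas h by [].
apply: ge0_ae_eq_integral => //.
- by under eq_fun do rewrite -mulN1r; exact: measurable_nc2 (cmeasD hcm mGsum).
- by under eq_fun do rewrite -mulN1r; exact: measurable_nc2 (cmeasD hcm mG').
- by move=> x _; rewrite lee_fin sqr_ge0.
- by move=> x _; rewrite lee_fin sqr_ge0.
have : {ae mu, forall x, forall j : 'I_Q, null j -> g j x = 0}.
  apply: filter_forall => j; rewrite /null; case: asboolP => [h0|_].
    by apply: filterS h0.
  exact: aeW.
apply: filterS => x gx _; congr ((nc _ ^+ 2)%:E); congr (_ - _).
rewrite -(sum_eigen_parts S G Q0 x); apply: eq_bigr => j _.
case: ifPn => [nj|_]; last by rewrite mul1r.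
by rewrite mul0r -/(g j x) gx.
Qed.

End RationalSpectrum.

(** * No irrational eigenvalues *)

Section IrrationalEigenvalues.
Context {R : realType}.

(** A number of modulus one other than 1 has a power far from 1: squaring doubles
the distance to 1, up to a factor, as long as this distance is small. *)
Lemma unit_power_far (z : R[i]) : nc z = 1 -> z != 1 ->
  exists k : nat, 2^-1 <= nc (z ^+ k - 1).
Proof.
move=> z1 zn1; apply/not_existsP => far.
have near1 k : nc (z ^+ k - 1) < 2^-1 by rewrite ltNge; apply/negP; exact: far.
have d0 : 0 < nc (z - 1).
  by rewrite lt_neqAle nc_ge0 andbT eq_sym; apply: contra zn1 => /eqP/nc_eq0/eqP; rewrite subr_eq0.
have grow j : (3 / 2) ^+ j * nc (z - 1) <= nc (z ^+ (2 ^ j) - 1).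
  elim: j => [|j ih]; first by rewrite expr0 mul1r expn0 expr1.
  set y := z ^+ (2 ^ j) in ih.
  have -> : z ^+ (2 ^ j.+1) - 1 = (y - 1) * (y + 1).
    by rewrite expnS mulnC exprM -/y; ring.
  have y1 := near1 (2 ^ j)%N; rewrite -/y in y1.
  have y2 : 3 / 2 <= nc (y + 1).
    have := ncB (y + 1) (y - 1); rewrite (_ : y + 1 - (y - 1) = 2%:R%:C%C); last first.
      by rewrite rmorph_nat; ring.
    by rewrite nc_real normr_nat; lra.
  rewrite ncM exprS mulrAC -mulrA mulrC.
  have := nc_ge0 (y - 1); have := nc_ge0 (y + 1); nra.
pose j := Num.bound (2^-1 / nc (z - 1) : R).
have j1 : j%:R <= (3 / 2 : R) ^+ (2 * j).
  elim: (j) => [|k ih]; first by rewrite muln0 expr0 ler01.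
  rewrite mulnS exprD -natr1; have : 1 <= (3 / 2 : R) ^+ (2 * k).
    by rewrite exprn_ege1 // ler_pdivlMr //; lra.
  by rewrite expr2; lra.
have h0 : 0 <= 2^-1 / nc (z - 1) by rewrite divr_ge0 // nc_ge0.
have := archi_boundP h0; rewrite -/j ltr_pdivrMr // => h.
have := near1 (2 ^ (2 * j))%N; have := grow (2 * j)%N; have := ler_wpM2r (ltW d0) j1; lra.
Qed.

Lemma expi2pi_eq1_rational (a : R) (Q : nat) : 0 <= a -> (0 < Q)%N ->
  expi2pi (Q%:R * a) = 1 -> rational a.
Proof.
move=> a0 Q0 h; have Qa0 : 0 <= Q%:R * a by rewrite mulr_ge0.
have QR0 : Q%:R != 0 :> R by rewrite pnatr_eq0 -lt0n.
pose n := Num.truncn (Q%:R * a); have /andP[n1 n2] := truncn_itv Qa0.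
rewrite -/n in n1 n2; pose b := Q%:R * a - n%:R.
have eb : expi2pi b = 1.
  have := h; rewrite (_ : Q%:R * a = b + n%:R); last by rewrite subrK.
  by rewrite expi2piD expi2pi_nat mulr1.
have [b0|b0] := eqVneq b 0.
  exists (n%:R / Q%:R) => //; rewrite fmorph_div !rmorph_nat.
  by move/eqP: b0; rewrite subr_eq0 => /eqP <-; rewrite mulrC mulKf.
have : expi2pi b != 1.
  by apply: expi2pi_neq1; rewrite lt_neqAle eq_sym b0 subr_ge0 n1 ltrBlDr addrC natr1.
by rewrite eb eqxx.
Qed.

Context {d : measure_display} {T : measurableType d}.
Context (mu : probability T R) (S : T -> T).
Hypotheses (mpS : measure_preserving mu S)
  (rall : forall A, measurable A -> rap_set mu S A).

(** The factor [exp (- |g|^2)] is invariant and makes an eigenfunction [g] bounded,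
hence rationally almost periodic. Along the period [Q] the product is multiplied
by [e(Q a)], which is not 1 when [a] is irrational, so that some multiple of the
period moves the product by at least half its modulus. *)
Theorem rap_no_irrational_spectrum : spectrum mu S `&` irrational = set0.
Proof.
apply/seteqP; split => // a [/= [/andP[a0 a1] [g [[rg ig _] gn0 geig]]]] airr.
have mg : cmeas g by [].
pose E x : R := expR (- nc (g x) ^+ 2).
have mE : measurable_fun setT E.
  apply: measurableT_comp; first exact: measurable_expR.
  by apply: measurableT_comp => //; apply/measurable_EFinP; exact: measurable_nc2.
have E0 x : 0 < E x by exact: expR_gt0.
pose b x : R[i] := (E x)%:C%C * g x.
have reb x : complex.Re (b x) = E x * complex.Re (g x).
  by rewrite /b; case: (g x) => u v /=; rewrite mul0r subr0.
have imb x : complex.Im (b x) = E x * complex.Im (g x).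
  by rewrite /b; case: (g x) => u v /=; rewrite mul0r addr0.
have mb : cmeas b.
  by split; [under eq_fun do rewrite reb|under eq_fun do rewrite imb]; exact: measurable_funM.
have b1 x : nc (b x) <= 1.
  rewrite ncM nc_real ger0_norm ?(ltW (E0 x)) // /E expRN mulrC ler_pdivrMr ?expR_gt0 //.
  rewrite mul1r (le_trans _ (expR_ge1Dx _)) //.
  by have := nc_ge0 (g x); have := sqr_ge0 (nc (g x) - 1); nra.
have rapRe : rap mu S (fun x => complex.Re (b x)).
  by apply: (rap_bounded mpS rall (proj1 mb)) => x; rewrite (le_trans (nc_ge_Re _)).
have rapIm : rap mu S (fun x => complex.Im (b x)).
  by apply: (rap_bounded mpS rall (proj2 mb)) => x; rewrite (le_trans (nc_ge_Im _)).
have beig k : {ae mu, forall x, b (iter k S x) = expi2pi (k%:R * a) * b x}.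
  have one : {ae mu, forall x, b (S x) = expi2pi a * b x}.
    apply: filterS geig => x gx; rewrite /b /E gx ncM nc_expi2pi mul1r; ring.
  elim: k => [|k ih]; first by apply: aeW => x; rewrite mul0r expi2pi0 mul1r.
  have one' : {ae mu, forall x, b (S (iter k S x)) = expi2pi a * b (iter k S x)}.
    case: one => A [mA A0 sA]; exists (iter k S @^-1` A); split.
    - by rewrite -[_ @^-1` _]setTI; exact: (measurable_iter mpS).
    - by rewrite (measure_preimage_iter mpS).
    - by move=> x /= nx; apply: sA.
  apply: filterS2 ih one' => x h1 h2; rewrite iterS h2 h1 -natr1 mulrDl mul1r expi2piD; ring.
have mbR k : measurable_fun setT (fun x => complex.Re (b (iter k S x))).
  exact: (measurable_comp_iter mpS k (proj1 mb)).
have mbI k : measurable_fun setT (fun x => complex.Im (b (iter k S x))).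
  exact: (measurable_comp_iter mpS k (proj2 mb)).
have mnb : measurable_fun setT (fun x => (nc (b x))%:E).
  apply/measurable_EFinP.
  exact: measurable_nc.
have small (e : R) : 0 < e -> (\int[mu]_x (nc (b x))%:E <= e%:E)%E.
  move=> e0; have e4 : 0 < e / 4 by rewrite divr_gt0.
  have [Q Q0 HQ] := rapRe.2 _ e4; have [Q' Q'0 HQ'] := rapIm.2 _ e4.
  have QQ0 : (0 < Q * Q')%N by rewrite muln_gt0 Q0.
  pose z : R[i] := expi2pi ((Q * Q')%N%:R * a).
  have zn1 : z != 1.
    by apply/eqP => /(expi2pi_eq1_rational a0 QQ0); exact: airr.
  have [k hk] := unit_power_far (nc_expi2pi _) zn1.
  have hR := HQ (Q' * k)%N; have hI := HQ' (Q * k)%N.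
  rewrite mulnA in hR; rewrite mulnA [(Q' * Q)%N]mulnC in hI.
  have zk := beig (Q * Q' * k)%N.
  have zkE : expi2pi ((Q * Q' * k)%N%:R * a) = z ^+ k.
    by rewrite natrM -mulrA mulrCA expi2piX.
  rewrite zkE in zk; set m := (Q * Q' * k)%N in hR hI zk.
  apply: (@le_trans _ _ (2%:E * (\int[mu]_x (`|complex.Re (b (iter m S x)) - complex.Re (b x)|%:E
    + `|complex.Im (b (iter m S x)) - complex.Im (b x)|%:E)))%E).
    rewrite -ge0_integralZl //; last 2 first.
    - by apply: emeasurable_funD; apply: measurable_dist => //; [exact: proj1 mb|exact: proj2 mb].
    - by move=> x _; rewrite -EFinD lee_fin addr_ge0.
    apply: ae_ge0_le_integral => //.
    - by move=> x _; rewrite lee_fin nc_ge0.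
    - by move=> x _; rewrite -EFinD -EFinM lee_fin mulr_ge0 // addr_ge0.
    - apply: measurable_funeM; apply: emeasurable_funD; apply: measurable_dist => //;
        [exact: proj1 mb|exact: proj2 mb].
    apply: filterS zk => x zx _; rewrite -EFinD -EFinM lee_fin zx -ReB -ImB.
    apply: (@le_trans _ _ (2 * nc (z ^+ k * b x - b x))); last first.
      by rewrite ler_wpM2l // nc_le_ReIm.
    rewrite (_ : z ^+ k * b x - b x = (z ^+ k - 1) * b x); last by ring.
    rewrite ncM mulrA ler_peMl ?nc_ge0 //; lra.
  rewrite ge0_integralD //; try (apply: measurable_dist => //;
    [exact: proj1 mb|exact: proj2 mb]); last 2 first.
  - by apply: measurable_dist => //; exact: proj1 mb.
  - by apply: measurable_dist => //; exact: proj2 mb.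
  apply: (@le_trans _ _ (2%:E * ((e / 4)%:E + (e / 4)%:E))%E).
    by rewrite lee_wpmul2l // leeD.
  by rewrite -EFinD -EFinM lee_fin; lra.
apply: gn0.
have zero : (\int[mu]_x `|(nc (b x))%:E| = 0)%E.
  under eq_integral => x _ do rewrite gee0_abs ?lee_fin ?nc_ge0 //.
  apply/eqP; rewrite eq_le integral_ge0 ?andbT => [|x _]; last by rewrite lee_fin nc_ge0.
  by apply/lee_addgt0Pr => e e0; rewrite add0e; exact: small.
have /(ae_eq_integral_abs mu measurableT mnb) := zero.
apply: filterS => x /(_ I) [] /eqP /= h.
have : nc (b x) = 0 by apply/eqP.
move=> /nc_eq0 /eqP; rewrite mulf_eq0 => /orP[|/eqP //].
rewrite (_ : 0 = 0%:C%C) // => /eqP /complexI /eqP; by rewrite gt_eqF.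
Qed.

End IrrationalEigenvalues.

(** * Zero entropy *)

Section Entropy.
Context {R : realType}.

Lemma gibbs (I : finType) (p q : I -> R) : (forall i, 0 <= p i) -> (forall i, 0 < q i) ->
  \sum_i p i = 1 -> \sum_i q i <= 1 ->
  - \sum_i p i * ln (p i) <= - \sum_i p i * ln (q i).
Proof.
move=> p0 q0 p1 q1; rewrite lerN2 -subr_ge0 -sumrB.
rewrite (@le_trans _ _ (\sum_i (p i - q i))) //; first by rewrite sumrB p1 subr_ge0.
apply: ler_sum => i _; have [->|pn0] := eqVneq (p i) 0.
  by rewrite !mul0r subrr sub0r oppr_le0 ltW.
have pi : 0 < p i by rewrite lt_neqAle eq_sym pn0 p0.
rewrite -mulrBr -ln_div ?posrE // -lerN2 opprB -mulrN -lnV ?posrE ?divr_gt0 // invf_div.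
have qp : 0 < q i / p i by rewrite divr_gt0.
have := le_ln1Dx (x := q i / p i - 1); rewrite addrCA subrr addr0 => h.
have h' : ln (q i / p i) <= q i / p i - 1 by apply: h; lra.
by have := ler_wpM2l (ltW pi) h'; rewrite mulrBr mulr1 mulrCA mulfV ?gt_eqF // mulr1.
Qed.

Section CodingBound.
Variables (k Q n : nat) (eta : R).
Hypotheses (k0 : (0 < k)%N) (Q0 : (0 < Q)%N) (Qn : (Q <= n)%N)
  (eta0 : 0 < eta) (eta1 : eta < 1).

(** Adding the uniform law with weight [eta] keeps all weights positive, so that
their logarithms are finite. *)
Definition copy_kernel (a b : 'I_k) : R := (1 - eta) * (a == b)%:R + eta / k%:R.

Lemma modQ_lt (j : 'I_n) : (j %% Q < n)%N.
Proof. by rewrite (leq_trans _ Qn) // ltn_mod. Qed.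

Definition mod_ord (j : 'I_n) : 'I_n := Ordinal (modQ_lt j).

(** Weight of the word [w] for a source that draws its first Q letters uniformly
and then copies the letter at the same residue modulo Q, with error rate [eta]. *)
Definition copy_weight (w : {ffun 'I_n -> 'I_k}) : R :=
  (k%:R ^+ Q)^-1 * \prod_(j < n) copy_kernel (w j) (w (mod_ord j)).

Let kR0 : 0 < k%:R :> R. Proof. by rewrite ltr0n. Qed.

Lemma copy_kernel_gt0 a b : 0 < copy_kernel a b.
Proof. by rewrite ltr_wpDl ?divr_gt0 // mulr_ge0 // subr_ge0 ltW. Qed.

Lemma copy_weight_gt0 w : 0 < copy_weight w.
Proof.
by rewrite mulr_gt0 ?invr_gt0 ?exprn_gt0 // prodr_gt0 // => j _; exact: copy_kernel_gt0.
Qed.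

Lemma sum_copy_kernel b : \sum_a copy_kernel a b = 1.
Proof.
rewrite big_split /= -mulr_sumr (bigD1 b) //= eqxx big1 ?addr0 => [|a /negPf -> //].
rewrite mulr1 sumr_const card_ord -[_ *+ k]mulr_natl mulrCA divff ?gt_eqF // mulr1.
by rewrite subrK.
Qed.

(** The copied letters are conditioned on the first Q letters; summing over these
as independent parameters bounds the total weight. *)
Lemma sum_copy_weight : \sum_w copy_weight w <= 1.
Proof.
pose modQ (j : 'I_n) : 'I_Q := Ordinal (ltn_pmod j Q0).
pose q (v : {ffun 'I_Q -> 'I_k}) (w : {ffun 'I_n -> 'I_k}) : R :=
  (k%:R ^+ Q)^-1 * \prod_(j < n) copy_kernel (w j) (v (modQ j)).
have q0 v w : 0 <= q v w.
  rewrite mulr_ge0 ?invr_ge0 ?exprn_ge0 // prodr_ge0 // => j _; exact: ltW (copy_kernel_gt0 _ _).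
apply: (@le_trans _ _ (\sum_w \sum_v q v w)).
  apply: ler_sum => w _.
  rewrite (bigD1 [ffun i : 'I_Q => w (widen_ord Qn i)]) //=.
  rewrite (_ : copy_weight w = q [ffun i : 'I_Q => w (widen_ord Qn i)] w) ?lerDl ?sumr_ge0 //.
  rewrite /copy_weight /q; congr (_ * _); apply: eq_bigr => j _; rewrite ffunE.
  by congr (copy_kernel _ (w _)); exact: val_inj.
rewrite exchange_big /= (eq_bigr (fun=> (k%:R ^+ Q)^-1)) => [|v _].
  rewrite sumr_const card_ffun !card_ord -[_ *+ _]mulr_natl natrX divff //.
  by rewrite expf_neq0 // gt_eqF.
rewrite -mulr_sumr -(bigA_distr_bigA (fun j a => copy_kernel a (v (modQ j)))) /=.
by rewrite big1 ?mulr1 // => j _; exact: sum_copy_kernel.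
Qed.

Lemma copy_weight_cost w :
  - ln (copy_weight w) <= Q%:R * ln k%:R +
    \sum_(j < n) (- ln (1 - eta) + ln (k%:R / eta) * (w j != w (mod_ord j))%:R).
Proof.
have e1 : 0 < 1 - eta by rewrite subr_gt0.
rewrite /copy_weight lnM ?posrE ?invr_gt0 ?exprn_gt0 //; last first.
  by rewrite prodr_gt0 // => j _; exact: copy_kernel_gt0.
rewrite lnV ?posrE ?exprn_gt0 // lnXn // opprD opprK mulr_natl lerD2l.
have lnprod (F : 'I_n -> R) : (forall j, 0 < F j) ->
    ln (\prod_(j < n) F j) = \sum_(j < n) ln (F j).
  move=> F0; suff [] : 0 < \prod_(j < n) F j /\ ln (\prod_(j < n) F j) = \sum_(j < n) ln (F j) by [].
  elim/big_rec2: _ => [|j x y _ [y0 yE]]; first by rewrite ln1.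
  by rewrite mulr_gt0 // lnM ?posrE // yE.
rewrite lnprod => [|j]; last exact: copy_kernel_gt0.
rewrite -sumrN; apply: ler_sum => j _.
set a := w j; set b := w (mod_ord j).
have ek : 0 < eta / k%:R by rewrite divr_gt0.
have [->|ab] := eqVneq a b.
  rewrite /= mulr0 addr0 lerN2 ler_ln ?posrE ?copy_kernel_gt0 //.
  by rewrite /copy_kernel eqxx mulr1 lerDl ltW.
rewrite /copy_kernel (negPf ab) mulr0 add0r mulr1.
have -> : ln (k%:R / eta) = - ln (eta / k%:R) by rewrite -lnV ?posrE // invf_div.
by rewrite lerDr oppr_ge0 ln_le0 // lerBlDr lerDl ltW.
Qed.

End CodingBound.
End Entropy.

Section ZeroEntropy.
Context {R : realType} {d : measure_display} {T : measurableType d}.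
Context (mu : probability T R) (S : T -> T).
Hypotheses (mpS : measure_preserving mu S)
  (rall : forall A, measurable A -> rap_set mu S A).

Lemma rap_common_period (I : finType) (u : I -> T -> R) (e : R) :
  (forall i, rap mu S (u i)) -> 0 < e ->
  exists2 Q, (0 < Q)%N & forall i k,
    (dist1 mu (fun x => u i (iter (Q * k) S x)) (u i) <= e%:E)%E.
Proof.
move=> ru e0; have /choice[q hq] : forall i, exists Q, (0 < Q)%N /\
    forall k, (dist1 mu (fun x => u i (iter (Q * k) S x)) (u i) <= e%:E)%E.
  by move=> i; have [Q Q0 HQ] := (ru i).2 _ e0; exists Q.
exists (\prod_i q i)%N; first by rewrite prodn_gt0 // => i; have [] := hq i.
move=> i k; rewrite (bigD1 i) //= -mulnA; exact: (hq i).2.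
Qed.

Variables (k : nat) (A : 'I_k -> set T).
Hypothesis partA : measurable_partition A.

Lemma partition_code : exists c : T -> 'I_k, forall i x, A i x <-> c x = i.
Proof.
have [mA tA cA] := partA.
have /choice[c hc] : forall x, exists i, A i x.
  by move=> x; have : [set: T] x by []; rewrite -cA => -[i _ Aix]; exists i.
exists c => i x; split => [Aix|<- //].
by apply: (tA _ _ I I); exists x; split.
Qed.

Section Words.
Variables (c : T -> 'I_k) (n : nat).
Hypothesis hc : forall i x, A i x <-> c x = i.

Let word (x : T) : {ffun 'I_n -> 'I_k} := [ffun j : 'I_n => c (iter j S x)].

Lemma joinE w x : dynamical_join S A w x <-> word x = w.
Proof.
split => [h|<- j]; last by apply/hc; rewrite ffunE.
by apply/ffunP => j; rewrite ffunE; apply/hc; exact: h.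
Qed.

Lemma measurable_join w : measurable (dynamical_join S A (n := n) w).
Proof.
have [mA _ _] := partA.
rewrite (_ : dynamical_join S A w = \bigcap_(j : 'I_n) (iter j S @^-1` A (w j))); last first.
  by apply/seteqP; split => [x h j _|x h j]; [exact: h|exact: (h j I)].
apply: fin_bigcap_measurable => // j _.
by rewrite -[_ @^-1` _]setTI; exact: (measurable_iter mpS).
Qed.

Let p w : R := fine (mu (dynamical_join S A (n := n) w)).

Lemma mu_joinE w : mu (dynamical_join S A w) = (p w)%:E.
Proof.
by rewrite /p fineK // fin_num_measure //; exact: measurable_join.
Qed.

Lemma word_indic (F : {ffun 'I_n -> 'I_k} -> R) x :
  F (word x) = \sum_w F w * \1_(dynamical_join S A w) x.
Proof.
rewrite (bigD1 (word x)) //= indicE mem_set ?mulr1; last exact/joinE.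
rewrite big1 ?addr0 // => w /eqP nw; rewrite indicE memNset ?mulr0 //.
by move=> /joinE /esym.
Qed.

Lemma measurable_word (F : {ffun 'I_n -> 'I_k} -> R) :
  measurable_fun setT (fun x => F (word x)).
Proof.
under eq_fun do rewrite word_indic.
apply: measurable_sum => w; apply: measurable_funM; first exact: measurable_cst.
by apply: measurable_indic; exact: measurable_join.
Qed.

Lemma integral_word (F : {ffun 'I_n -> 'I_k} -> R) : (forall w, 0 <= F w) ->
  (\int[mu]_x (F (word x))%:E)%E = (\sum_w p w * F w)%:E.
Proof.
move=> F0; pose J w := dynamical_join S A (n := n) w.
transitivity (\int[mu]_x (\sum_w (F w * \1_(J w) x)%:E))%E.
  by apply: eq_integral => x _; rewrite sumEFin word_indic.
rewrite ge0_integral_sum //; last 2 first.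
- move=> w; apply/measurable_EFinP; apply: measurable_funM; first exact: measurable_cst.
  by apply: measurable_indic; exact: measurable_join.
- by move=> w x _; rewrite lee_fin mulr_ge0.
rewrite -sumEFin; apply: eq_bigr => w _.
under eq_integral do rewrite EFinM.
rewrite ge0_integralZl //; last 2 first.
- by apply/measurable_EFinP; apply: measurable_indic; exact: measurable_join.
- by rewrite lee_fin.
rewrite integral_indic ?setIT //; last exact: measurable_join.
by rewrite [X in (_ * X)%E](mu_joinE w) -EFinM mulrC.
Qed.

Lemma p_ge0 w : 0 <= p w.
Proof. by rewrite fine_ge0. Qed.

Lemma sum_p : \sum_w p w = 1.
Proof.
apply/EFin_inj; under eq_bigr do rewrite -[p _]mulr1.
rewrite -(integral_word (F := fun=> 1)) // integral_cst // mul1e; exact: probability_setT.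
Qed.

Lemma partition_entropy_ge0 : 0 <= partition_entropy mu (dynamical_join S A (n := n)).
Proof.
rewrite oppr_ge0; apply: sumr_le0 => w _; rewrite -/(p w) mulr_ge0_le0 ?p_ge0 //.
by rewrite ln_le0 // -sum_p (bigD1 w) //= lerDl sumr_ge0 // => *; exact: p_ge0.
Qed.

(** Coding bound for the entropy of the join: by Gibbs' inequality the entropy is
at most the mean cost of encoding a word by copying from the first period, and
copying fails only where the orbit is far from Q-periodic. *)
Lemma partition_entropy_bound (Q : nat) (e eta : R) : (0 < Q)%N -> (Q <= n)%N ->
  0 < eta -> eta < 1 -> 0 <= e ->
  (forall i m, (dist1 mu (fun x => \1_(A i) (iter (Q * m) S x)) (\1_(A i)) <= e%:E)%E) ->
  partition_entropy mu (dynamical_join S A (n := n)) <=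
    Q%:R * ln k%:R + n%:R * (- ln (1 - eta) + ln (k%:R / eta) * (k%:R * e)).
Proof.
move=> Q0 Qn eta0 eta1 e0 hQ.
have [mA _ _] := partA.
have k0 : (0 < k)%N by case: (k) (c point) => [[]|].
have kR1 : 1 <= k%:R :> R by rewrite ler1n.
have le0 : 0 <= ln (k%:R / eta).
  by rewrite ln_ge0 // ler_pdivlMr // mul1r (le_trans (ltW eta1)).
have l1 : 0 <= - ln (1 - eta) by rewrite oppr_ge0 ln_le0 // lerBlDr lerDl ltW.
pose cost (w : {ffun 'I_n -> 'I_k}) : R := Q%:R * ln k%:R +
    \sum_(j < n) (- ln (1 - eta) + ln (k%:R / eta) * (w j != w (mod_ord Q0 Qn j))%:R).
have coding := gibbs p_ge0 (copy_weight_gt0 k0 Q0 Qn eta0 eta1) sum_p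
  (sum_copy_weight k0 Q0 Qn eta0 eta1).
apply: (le_trans coding).
apply: (@le_trans _ _ (\sum_w p w * cost w)).
  rewrite -sumrN; apply: ler_sum => w _; rewrite -mulrN ler_wpM2l ?p_ge0 //.
  exact: copy_weight_cost.
have cost0 w : 0 <= cost w.
  rewrite addr_ge0 ?mulr_ge0 ?ln_ge0 // sumr_ge0 // => j _.
  by rewrite addr_ge0 // mulr_ge0.
rewrite -lee_fin -integral_word //.
pose D (j : 'I_n) (i : 'I_k) x : \bar R :=
  `|\1_(A i) (iter j S x) - \1_(A i) (iter (j %% Q)%N S x)|%:E.
have mI i m : measurable_fun setT (fun x => \1_(A i) (iter m S x) : R).
  by apply: (measurable_comp_iter mpS m (u := \1_(A i) : T -> R)); exact: measurable_indic.
have mD j i : measurable_fun setT (D j i) by apply: measurable_dist.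
have D0 j i x : (0 <= D j i x)%E by rewrite lee_fin.
have mSD j : measurable_fun setT (fun x => \sum_i D j i x)%E by exact: emeasurable_sum.
have SD0 j x : (0 <= \sum_i D j i x)%E by exact: sume_ge0.
have mSSD : measurable_fun setT (fun x => \sum_(j < n) \sum_i D j i x)%E by exact: emeasurable_sum.
have SSD0 x : (0 <= \sum_(j < n) \sum_i D j i x)%E by exact: sume_ge0.
have Dle j i : (\int[mu]_x D j i x <= e%:E)%E.
  have := hQ i (j %/ Q)%N; apply: le_trans.
  have mIi : measurable_fun setT (\1_(A i) : T -> R) by exact: measurable_indic.
  rewrite -(dist1_iter mpS (j %% Q)%N (mI i (Q * (j %/ Q))%N) mIi).
  by rewrite /dist1 le_eqVlt; apply/orP; left; apply/eqP; apply: eq_integral => x _;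
    rewrite /D -iterD mulnC -divn_eq.
apply: (@le_trans _ _ (\int[mu]_x ((Q%:R * ln k%:R + n%:R * - ln (1 - eta))%:E
   + (ln (k%:R / eta))%:E * \sum_(j < n) \sum_i D j i x)))%E.
  apply: ge0_le_integral => //.
  - by move=> x _; rewrite lee_fin.
  - by apply/measurable_EFinP; exact: measurable_word.
  - apply: emeasurable_funD; first exact: measurable_cst.
    by apply: measurable_funeM.
  move=> x _; rewrite /D; under eq_bigr do rewrite sumEFin.
  rewrite sumEFin -EFinM -EFinD lee_fin /cost -addrA lerD2l big_split /= sumr_const card_ord.
  rewrite [n%:R * _]mulr_natl lerD2l -mulr_sumr ler_wpM2l //; apply: ler_sum => j _.
  rewrite !ffunE /=; set a := c _; set b := c _.
  have [_|ab] := eqVneq a b; first by rewrite sumr_ge0.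
  rewrite (bigD1 a) //= !indicE mem_set; last exact/hc.
  rewrite memNset; last by move=> /hc; rewrite -/b => /esym/eqP; rewrite (negPf ab).
  by rewrite subr0 normr1 lerDl sumr_ge0.
have C0 : 0 <= Q%:R * ln k%:R + n%:R * - ln (1 - eta).
  by rewrite addr_ge0 ?mulr_ge0 ?ln_ge0.
rewrite ge0_integralD //; last 2 first.
- by move=> x _; rewrite mule_ge0.
- by apply: measurable_funeM.
rewrite integral_cst // [X in (_ * X + _ <= _)%E](@probability_setT _ _ _ mu) mule1.
rewrite ge0_integralZl //.
rewrite ge0_integral_sum //.
under eq_bigr do rewrite ge0_integral_sum //.
apply: (@le_trans _ _ ((Q%:R * ln k%:R + n%:R * - ln (1 - eta))%:E +
   (ln (k%:R / eta))%:E * \sum_(j < n) \sum_(i < k) e%:E)%E).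
  rewrite leeD2l // lee_wpmul2l //; apply: lee_sum => j _; apply: lee_sum => i _; exact: Dle.
under eq_bigr do rewrite sumEFin sumr_const card_ord.
rewrite sumEFin sumr_const card_ord -EFinM -EFinD lee_fin mulrDr addrA lerD2l.
by rewrite -[_ *+ n]mulr_natl -[e *+ k]mulr_natl mulrCA.
Qed.

End Words.

(** The first period costs a bounded amount, which disappears in the rate; the
other two terms of the coding bound are made small by choosing first [eta] and
then the period. *)
Lemma entropy_rate_eq0 : entropy_rate mu S A = 0%E.
Proof.
have [c hc] := partition_code.
have [mA _ _] := partA.
have k0 : (0 < k)%N by case: (k) (c point) => [[]|].
have kR1 : 1 <= k%:R :> R by rewrite ler1n.
apply: cvg_lim => //; apply: cvg_EFin; first by near=> n.
apply/cvgrPdist_le => e e0.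
(* Chosen so that [- ln (1 - eta) = e / 3]. *)
pose eta : R := 1 - expR (- (e / 3)).
have e3 : 0 < e / 3 by rewrite divr_gt0.
have eta0 : 0 < eta by rewrite subr_gt0 expR_lt1 oppr_lt0.
have eta1 : eta < 1 by rewrite ltrBlDr ltrDl expR_gt0.
have lneta : - ln (1 - eta) = e / 3 by rewrite /eta opprB addrCA subrr addr0 expRK opprK.
pose C : R := (ln (k%:R / eta) + 1) * k%:R.
have le0 : 0 <= ln (k%:R / eta).
  by rewrite ln_ge0 // ler_pdivlMr // mul1r (le_trans (ltW eta1)).
have C0 : 0 < C by rewrite mulr_gt0 ?ltr0n // ltr_wpDl.
have rA i : rap mu S (\1_(A i)) by have [] := rall (mA i).
have [Q Q0 hQ] := rap_common_period rA (divr_gt0 e3 C0).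
near=> n.
have n0 : (0 < n)%N by near: n; exists 1%N.
have nR0 : 0 < n%:R :> R by rewrite ltr0n.
have Qn : (Q <= n)%N by near: n; exists Q.
rewrite sub0r normrN /= ger0_norm; last first.
  by rewrite divr_ge0 // (partition_entropy_ge0 n hc).
rewrite ler_pdivrMr //.
apply: (le_trans (partition_entropy_bound hc Q0 Qn eta0 eta1 (ltW (divr_gt0 e3 C0)) hQ)).
rewrite lneta.
have b1 : Q%:R * ln k%:R <= e / 3 * n%:R.
  rewrite mulrC -ler_pdivrMl //.
  near: n; exists (Num.bound ((e / 3)^-1 * (ln k%:R * Q%:R) : R)) => // m /= hm.
  rewrite (le_trans (ltW (archi_boundP _))) ?ler_nat //.
  by rewrite mulr_ge0 ?invr_ge0 ?(ltW e3) // mulr_ge0 ?ln_ge0.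
have b2 : ln (k%:R / eta) * (k%:R * (e / 3 / C)) <= e / 3.
  rewrite !mulrA ler_pdivrMr // /C.
  have : 0 <= k%:R * (e / 3) :> R by rewrite mulr_ge0 // ltW.
  by nra.
have := ler_wpM2l (ltW nR0) b2; lra.
Unshelve. all: by end_near. Qed.

End ZeroEntropy.

Theorem rap_ks_entropy_eq0 {R : realType} {d : measure_display} {T : measurableType d}
  (mu : probability T R) (S : T -> T) : measure_preserving mu S ->
  (forall A, measurable A -> rap_set mu S A) -> ks_entropy mu S = 0%E.
Proof.
move=> mpS rall; rewrite /ks_entropy.
have -> : [set h | exists (k : nat) (A : 'I_k -> set T),
    measurable_partition A /\ h = entropy_rate mu S A] = [set 0%E].
  apply/seteqP; split => [_ [k [A [pA ->]]]|_ ->] /=; first exact: entropy_rate_eq0.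
  have pA : measurable_partition (fun _ : 'I_1 => [set: T]).
    split=> //; first by move=> i j _ _ _; rewrite (ord1 i) (ord1 j).
    by apply/seteqP; split => // x _; exists ord0.
  by exists 1%N, (fun=> setT); split => //; rewrite entropy_rate_eq0.
exact: ereal_sup1.
Qed.

(** * The sequence space *)

Section SequenceSpace.
Context {R : realType}.
Local Notation X := (@seqspace R).
Local Notation BX := (@borel_seqspace R).
Local Notation S := (@seq_shift R).

Lemma iter_shift n (x : BX) k : iter n S x k = x (k + n%:Z).
Proof.
elim: n k => [|n ih] k; first by rewrite addr0.
by rewrite iterS /seq_shift ih -addrA; congr (x _); rewrite -natr1 natz; lia.
Qed.

(** The four real coordinates [+-Re] and [+-Im]: every half-plane bounded by a
horizontal or vertical line is the locus where one of them exceeds a constant. *)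
Definition lin (b : bool * bool) (z : R[i]) : R :=
  (-1) ^+ b.1 * (if b.2 then complex.Re z else complex.Im z).

Lemma dist_lin b (z w : R[i]) : `|lin b z - lin b w| <= nc (z - w).
Proof.
rewrite /lin -mulrBr normrM normrX normrN1 expr1n mul1r.
by case: b.2; rewrite -?ReB -?ImB ?nc_ge_Re ?nc_ge_Im.
Qed.

Lemma continuous_lin b : continuous (fun z : R[i]^o => lin b z : R).
Proof.
move=> z; apply/(@cvgrPdist_lt _ R _ _ (nbhs_filter (z : R[i]^o))) => e e0.
have e0' : 0 < e%:C%C by rewrite -[0]/(0%:C)%C ltcR.
near=> w; apply: (le_lt_trans (dist_lin b z w)).
have : ball z e%:C%C w by near: w; exact: nbhsx_ballx.
by rewrite -ball_normE /ball_ /= normc_def ltcR; case: (z - w).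
Unshelve. all: by end_near. Qed.

Lemma continuous_coord b k : continuous (fun x : X => lin b (disc_val (x k)) : R).
Proof.
move=> x; apply: (@continuous_comp X (disc R) R (fun x => x k)
  (fun z => lin b (disc_val z))); first exact: proj_continuous.
apply: (@continuous_comp (disc R) R[i]^o R (@disc_val R) (lin b)).
  exact: initial_continuous.
exact: continuous_lin.
Qed.

Lemma measurable_continuous (F : X -> R) : continuous F ->
  measurable_fun setT (F : BX -> R).
Proof.
move=> cF; apply: (measurability _ (RGenOInfty.measurableE R)).
move=> _ [_ [a ->] <-]; rewrite setTI; apply: sub_sigma_algebra.
by move/continuousP: cF; apply; exact: interval_open.
Qed.

(** Rational half-spaces, a countable family; their finite intersections form a
base of the topology. *)
Definition half_index : Type := (int * (bool * bool) * rat)%type.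

Definition half (c : half_index) : set BX :=
  [set x | ratr c.2 < lin c.1.2 (disc_val (x c.1.1))].

Definition cylinder (l : seq half_index) : set BX :=
  [set x | forall c, c \in l -> half c x].

Lemma nbhs_half_planes (z : R[i]) (V : set R[i]^o) : nbhs (z : R[i]^o) V ->
  exists l : seq ((bool * bool) * rat),
    (forall c, c \in l -> ratr c.2 < lin c.1 z) /\
    (forall w : R[i], (forall c, c \in l -> ratr c.2 < lin c.1 w) -> V w).
Proof.
move=> /nbhs_ballP[e /= e0 eV].
have [r rE] : exists r : R, e = r%:C%C.
  by exists (complex.Re e); case: e e0 {eV} => a b; rewrite ltcE /= => /andP[/eqP -> _].
have r0 : 0 < r by move: e0; rewrite rE -[0]/(0%:C)%C ltcR.
have pick b : exists q : rat, lin b z - r / 4 < ratr q < lin b z.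
  have lt : lin b z - r / 4 < lin b z by rewrite gtrBl divr_gt0.
  have [q] := rat_in_itvoo lt.
  by rewrite in_itv /=; exists q.
have /choice[q hq] := pick.
exists [seq (b, q b) | b <- enum {: bool * bool}]; split.
  by move=> c /mapP[b _ ->] /=; have /andP[] := hq b.
move=> w hw; apply: eV; rewrite rE -ball_normE /ball_ /= normc_def ltcR.
have hw' b : ratr (q b) < lin b w.
  by apply: (hw (b, q b)); apply: map_f; rewrite mem_enum.
have d b : lin b z - r / 4 < lin b w.
  by have /andP[h1 _] := hq b; exact: lt_trans h1 (hw' b).
have := d (false, true); have := d (true, true); have := d (false, false).
have := d (true, false); rewrite /lin /= !expr0 !expr1 !mul1r !mulN1r => d1 d2 d3 d4.
have -> : Num.sqrt (complex.Re (z - w) ^+ 2 + complex.Im (z - w) ^+ 2) = nc (z - w).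
  by case: (z - w).
rewrite (le_lt_trans (nc_le_ReIm _)) // ReB ImB.
have a1 : `|complex.Re z - complex.Re w| <= r / 4 by rewrite ler_norml; apply/andP; split; lra.
have a2 : `|complex.Im z - complex.Im w| <= r / 4 by rewrite ler_norml; apply/andP; split; lra.
lra.
Qed.

(** The sets that contain a cylinder around [x] form a filter. It converges to [x]
as soon as all its images under coordinate projections do, the topology being
the coarsest that makes these projections continuous. *)
Lemma cylinder_base (U : set X) x : open U -> U x ->
  exists l, cylinder l x /\ cylinder l `<=` U.
Proof.
move=> oU Ux.
pose F : set_system X := [set A | exists l, cylinder l x /\ cylinder l `<=` A].
have FF : Filter F.
  split.
  - by exists [::]; split.
  - move=> A B [l [lx lA]] [m [mx mB]]; exists (l ++ m); split.
      by move=> c; rewrite mem_cat => /orP[/lx|/mx].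
    by move=> y ly; split; [apply: lA|apply: mB] => c cl; apply: ly; rewrite mem_cat cl ?orbT.
  - by move=> A B AB [l [lx lA]]; exists l; split => // y /lA /AB.
suff : F --> (x : X) by apply; exact: open_nbhs_nbhs.
apply/cvg_sup => i A; rewrite /nbhs /= => -[B [[V oV VB] Bx] BA].
move: oV => [W oW WV].
have Wx : W (disc_val (x i)) by move: Bx; rewrite -VB /= -WV.
have /nbhs_half_planes[l [lx lW]] : nbhs (disc_val (x i) : R[i]^o) W.
  exact: open_nbhs_nbhs.
exists [seq (i, c.1, c.2) | c <- l]; split.
  by move=> _ /mapP[c cl ->]; exact: lx.
move=> y hy; apply: BA; rewrite -VB /= -WV /=; apply: lW => c cl.
by apply: (hy (i, c.1, c.2)); apply: (map_f (fun c => (i, c.1, c.2))).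
Qed.

Lemma half_open c : open (half c : set X).
Proof.
rewrite (_ : half c = (fun x : X => lin c.1.2 (disc_val (x c.1.1))) @^-1` [set t | ratr c.2 < t]) //.
by move/continuousP: (@continuous_coord c.1.2 c.1.1); apply; exact: open_gt.
Qed.

Lemma measurable_half c : measurable (half c).
Proof. by apply: sub_sigma_algebra; exact: half_open. Qed.

Lemma cylinderE l : cylinder l = \big[setI/setT]_(c <- l) half c.
Proof.
elim: l => [|c l ih]; first by rewrite big_nil; apply/seteqP; split.
rewrite big_cons -ih; apply/seteqP; split => x h.
  split; first by apply: h; rewrite inE eqxx.
  by move=> c' cl; apply: h; rewrite inE cl orbT.
by move=> c'; rewrite inE => /predU1P[->|]; [exact: h.1|exact: h.2].
Qed.

Lemma cylinder_open l : open (cylinder l : set X).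
Proof.
rewrite cylinderE; elim/big_ind: _; [exact: (@openT X)|exact: (@openI X)|].
by move=> c _; exact: half_open.
Qed.

Lemma measurable_cylinder l : measurable (cylinder l).
Proof.
rewrite cylinderE; elim/big_ind: _ => //; first exact: measurableI.
by move=> c _; exact: measurable_half.
Qed.

(** There are countably many cylinders, so an open set is a countable union of
those that it contains. *)
Lemma borel_generated_cylinders : @measurable _ BX `<=` <<s range cylinder >>.
Proof.
apply: smallest_sub; first exact: smallest_sigma_algebra.
move=> U oU; pose u (n : nat) : option (seq half_index) := unpickle n.
have uK l : u (pickle l) = Some l by exact: pickleK.
clearbody u; have -> : U = \bigcup_(n in setT)
    (if u n is Some l
     then [set x | cylinder l x /\ cylinder l `<=` U] else set0).
  apply/seteqP; split => [x Ux|x [n _]].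
    have [l [lx lU]] := cylinder_base oU Ux.
    by exists (pickle l) => //; rewrite uK.
  by case: (u n) => // l [lx]; exact.
refine (@sigma_algebra_bigcup _ setT (range cylinder) _ _).
move=> n.
case: (u n) => [l|]; last first.
  exact: (@sigma_algebra0 _ setT (range cylinder)).
have [lU|nlU] := pselect (cylinder l `<=` U).
  rewrite (_ : [set x | _] = cylinder l).
    by apply: (@sub_sigma_algebra _ setT (range cylinder)); exists l.
  by apply/seteqP; split => [x []//|x lx]; split.
rewrite (_ : [set x | _] = set0).
  exact: (@sigma_algebra0 _ setT (range cylinder)).
by apply/seteqP; split => x // [].
Qed.

Lemma borel_generated_halves : @measurable _ BX `<=` <<s range half >>.
Proof.
apply: (subset_trans borel_generated_cylinders); apply: smallest_sub.
  exact: smallest_sigma_algebra.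
move=> _ [l _ <-]; rewrite cylinderE; elim/big_ind: _ => //.
- exact: (@measurableT _ (g_sigma_algebraType (range half))).
- by move=> A B; exact: (@measurableI _ (g_sigma_algebraType (range half))).
- by move=> c _; apply: sub_sigma_algebra; exists c.
Qed.

Lemma measurable_shift : measurable_fun setT S.
Proof.
apply: (@measurability _ _ BX BX setT S (range half)).
  apply/seteqP; split; first exact: borel_generated_halves.
  apply: smallest_sub; first exact: sigma_algebra_measurable.
  by move=> _ [c _ <-]; exact: measurable_half.
move=> _ [_ [c _ <-] <-]; rewrite setTI.
exact: (measurable_half (c.1.1 + 1, c.1.2, c.2)).
Qed.

End SequenceSpace.

(** * Averages and weak limits *)

Section Averages.
Context {R : realType}.
Local Notation X := (@seqspace R).
Local Notation BX := (@borel_seqspace R).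
Local Notation S := (@seq_shift R).

Definition weight (m : averaging) (i : nat) : R :=
  if m is Cesaro then 1 else i.+1%:R^-1.

Lemma weight_ge0 m i : 0 <= weight m i.
Proof. by case: m => /=. Qed.

Lemma weight_nonincreasing m i : weight m i.+1 <= weight m i.
Proof. by case: m => //=; rewrite lef_pV2 ?posrE ?ltr0n // ler_nat. Qed.

(** Summation by parts: a linear bound for the partial sums of [s] survives any
nonincreasing weight.  The induction carries the bound with the term
[w N * (eps * N + C - \sum_(i < N) s i)] to spare. *)
Lemma weighted_sum_le (w s : nat -> R) (eps C : R) :
  (forall i, 0 <= w i) -> (forall i, w i.+1 <= w i) ->
  (forall N, \sum_(i < N) s i <= eps * N%:R + C) ->
  forall N, \sum_(i < N) w i * s i <= eps * (\sum_(i < N) w i) + C * w 0%N.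
Proof.
move=> w0 wS h N.
suff : \sum_(i < N) w i * s i + w N * (eps * N%:R + C - \sum_(i < N) s i)
    <= eps * (\sum_(i < N) w i) + C * w 0%N.
  by apply: le_trans; rewrite lerDl mulr_ge0 // subr_ge0.
elim: N => [|N ih]; first by rewrite !big_ord0; lra.
have D0 : 0 <= eps * N.+1%:R + C - \sum_(i < N.+1) s i by rewrite subr_ge0.
apply: (@le_trans _ _ (\sum_(i < N.+1) w i * s i
    + w N * (eps * N.+1%:R + C - \sum_(i < N.+1) s i))).
  by rewrite lerD2l ler_wpM2r.
move: ih; rewrite !big_ord_recr /= -natr1.
move: (\sum_(i < N) w i * s i) (\sum_(i < N) w i) (\sum_(i < N) s i) => a b c.
by nra.
Qed.

Definition weight_sum m N : R := \sum_(i < N) weight m i.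

Lemma weight_sum_gt0 m N : (0 < N)%N -> 0 < weight_sum m N.
Proof.
case: N => // N _; rewrite /weight_sum big_ord_recl ltr_wpDr //.
  by apply: sumr_ge0 => i _; exact: weight_ge0.
by case: m => /=; rewrite ?invr_gt0.
Qed.

Lemma weight_sum_homo m : {homo weight_sum m : i j / (i <= j)%N >-> i <= j}.
Proof.
apply: (homo_leq (r := fun x y => x <= y)) => // [y x z|i]; first exact: le_trans.
by rewrite /weight_sum big_ord_recr lerDl weight_ge0.
Qed.

Lemma weight_sum_unbounded m (B : R) : exists n, B <= weight_sum m n.
Proof.
case: m => /=.
  exists (Num.bound B); rewrite /weight_sum sumr_const card_ord.
  have [B0|B0] := leP 0 B; first by rewrite ltW // archi_boundP.
  by rewrite (le_trans (ltW B0)).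
apply: contrapT => h; apply: (@dvg_harmonic R).
have E n : series harmonic n = weight_sum Logarithmic n :> R.
  by rewrite seriesEord.
apply: nondecreasing_is_cvgn.
  by move=> i j ij; rewrite !E weight_sum_homo.
exists B => _ [n _ <-]; rewrite E leNgt; apply/negP => lt.
by apply: h; exists n; exact: ltW.
Qed.

Lemma Rintegral_avg_measure m (a : BX) N (F : BX -> R) : (0 < N)%N ->
  measurable_fun setT F -> (forall x, 0 <= F x) ->
  (\int[avg_measure m (fun n => \d_(iter n S a)) N]_x F x)%R
    = (weight_sum m N)^-1 * \sum_(i < N) weight m i * F (iter i.+1 S a).
Proof.
move=> N0 mF F0; rewrite /Rintegral.
have mF' : measurable_fun setT (EFin \o F) by exact/measurable_EFinP.
have F0' x : setT x -> (0 <= (EFin \o F) x)%E by move=> _; rewrite lee_fin.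
have dir n : (\int[\d_(iter n S a)]_x (EFin \o F) x)%E = (F (iter n S a))%:E.
  by rewrite (integral_dirac _ measurableT mF') diracT mul1e.
case: m => /=.
  rewrite (ge0_integral_mscale _ measurableT _ mF') // ge0_integral_measure_sum //.
  rewrite (eq_bigr (fun i : 'I_N => (F (iter i.+1 S a))%:E) (fun i _ => dir i.+1)).
  rewrite sumEFin -EFinM /= /weight_sum sumr_const card_ord; congr (_ * _).
  by apply: eq_bigr => i _; rewrite mul1r.
rewrite (ge0_integral_mscale _ measurableT _ mF') // ge0_integral_measure_sum //.
rewrite (eq_bigr (fun i : 'I_N => (i.+1%:R^-1 * F (iter i.+1 S a))%:E)); last first.
  move=> i _; rewrite (ge0_integral_mscale _ measurableT _ mF') //.
  by rewrite [X in (_ * X)%E](dir i.+1).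
by rewrite sumEFin -EFinM.
Qed.

Lemma fin_num_integral_bounded (mu : probability BX R) (F : BX -> R) (M : R) :
  measurable_fun setT F -> (forall x, 0 <= F x <= M) ->
  (\int[mu]_x (F x)%:E)%E \is a fin_num.
Proof.
move=> mF h; rewrite ge0_fin_numE; last first.
  by apply: integral_ge0 => x _; rewrite lee_fin; have /andP[] := h x.
apply: (@le_lt_trans _ _ (\int[mu]_x (cst M%:E x))%E).
  apply: ge0_le_integral => //.
  - by move=> x _; rewrite lee_fin; have /andP[] := h x.
  - exact/measurable_EFinP.
  - by move=> x _ /=; rewrite lee_fin; have /andP[] := h x.
by rewrite integral_cst //= [X in (_ * X)%E](@probability_setT _ _ _ mu) mule1 ltry.
Qed.

(** An average of point masses along the orbit of [a] compares the integrals of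
two continuous functions whenever their orbit sums compare up to a bounded
error, since the total weight of the average tends to infinity. *)
Lemma weak_limit_le m (a : BX) (N : nat -> nat) (mu : probability BX R)
    (F G : X -> R) (M eps C : R) :
  (forall k, (0 < N k)%N) -> {homo N : i j / (i < j)%N} ->
  weak_star_cvg (fun k => avg_measure m (fun n => \d_(iter n S a)) (N k)) mu ->
  continuous F -> continuous G ->
  (forall x, 0 <= F x <= M) -> (forall x, 0 <= G x <= M) ->
  (forall n, \sum_(i < n) (F (iter i.+1 S a) - G (iter i.+1 S a)) <= eps * n%:R + C) ->
  (\int[mu]_x (F x)%:E <= \int[mu]_x (G x)%:E + eps%:E)%E.
Proof.
move=> N0 Nh cv cF cG F0 G0 h.
have mF := measurable_continuous cF; have mG := measurable_continuous cG.
have fF := fin_num_integral_bounded mu mF F0.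
have fG := fin_num_integral_bounded mu mG G0.
rewrite -(fineK fF) -(fineK fG) -EFinD lee_fin.
apply/ler_addgt0Pr => del del0.
have Nk k : (k <= N k)%N.
  by elim: k => // k ih; rewrite (leq_ltn_trans ih) // Nh.
have [k0 hk0] := weight_sum_unbounded m (`|C| / del).
have cvF := cv _ cF.
have cvG : Rintegral (avg_measure m (fun n => \d_(iter n S a)) (N k)) setT G
    + (eps + del) @[k --> \oo] --> Rintegral mu setT G + (eps + del).
  by apply: cvgD; [exact: cv|exact: cvg_cst].
rewrite -addrA; change (Rintegral mu setT F <= Rintegral mu setT G + (eps + del)).
rewrite -(cvg_lim _ cvF) // -(cvg_lim _ cvG) //.
apply: ler_lim; [by apply/cvg_ex; eexists; exact: cvF|by apply/cvg_ex; eexists; exact: cvG|].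
near=> k.
have F0' x : 0 <= F x by have /andP[] := F0 x.
have G0' x : 0 <= G x by have /andP[] := G0 x.
rewrite !Rintegral_avg_measure //.
have W0 := weight_sum_gt0 m (N0 k).
rewrite -lerBlDl -mulrBr mulrC ler_pdivrMr // -sumrB.
under eq_bigr do rewrite -mulrBr.
have := @weighted_sum_le (weight m) (fun i => F (iter i.+1 S a) - G (iter i.+1 S a)) eps C (weight_ge0 m) (weight_nonincreasing m) h (N k).
move=> /le_trans; apply; rewrite -/(weight_sum m (N k)) mulrDl lerD2l.
have w1 : weight m 0 = 1 by case: (m) => //=; rewrite invr1.
rewrite w1 mulr1 (le_trans (ler_norm C)) // mulrC -ler_pdivrMr //.
apply: (le_trans hk0); apply: weight_sum_homo; apply: leq_trans (Nk k).
by near: k; exact: nbhs_infty_ge.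
Unshelve. all: by end_near. Qed.

End Averages.

(** * Invariance and almost periodicity of the coordinates *)

Section Systems.
Context {R : realType}.
Local Notation X := (@seqspace R).
Local Notation BX := (@borel_seqspace R).
Local Notation S := (@seq_shift R).

(** Weak-star convergence only tests continuous functions; the ramps replace the
indicator of [t > 0], to which they tend as [n] grows. *)
Definition ramp (n : nat) (t : R) : R := Order.min 1 (n%:R * Order.max 0 t).

Lemma ramp_ge0 n t : 0 <= ramp n t.
Proof. by rewrite /ramp le_min ler01 mulr_ge0 // le_max lexx. Qed.

Lemma ramp_le1 n t : ramp n t <= 1.
Proof. by rewrite /ramp ge_min lexx. Qed.

Lemma ramp_lipschitz n s t : `|ramp n s - ramp n t| <= n%:R * `|s - t|.
Proof.
wlog st : s t / t <= s.
  move=> h; have [|/ltW] := leP t s; first exact: h.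
  by rewrite distrC [`|s - t|]distrC; exact: h.
have n0 : 0 <= n%:R :> R by [].
rewrite [`|s - t|]ger0_norm ?subr_ge0 // /ramp.
have m1 : Order.max 0 t <= Order.max 0 s by rewrite ge_max !le_max lexx st orbT.
have m2 : Order.max 0 s <= Order.max 0 t + (s - t).
  by rewrite ge_max; case: (leP 0 t) => h; apply/andP; split; lra.
move: (Order.max 0 s) (Order.max 0 t) m1 m2 => x y m1 m2.
have le1 : n%:R * y <= n%:R * x by rewrite ler_wpM2l.
have le2 : n%:R * x <= n%:R * y + n%:R * (s - t) by rewrite -mulrDr ler_wpM2l.
have d0 : 0 <= n%:R * (s - t) by rewrite mulr_ge0 // subr_ge0.
rewrite ler_norml; apply/andP.
by case: (leP 1 (n%:R * x)) => h1; case: (leP 1 (n%:R * y)) => h2; split; lra.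
Qed.

Lemma ramp_continuous n : continuous (ramp n).
Proof.
move=> t; apply/cvgrPdist_lt => e e0; near=> s.
apply: (le_lt_trans (ramp_lipschitz n t s)).
rewrite (@le_lt_trans _ _ (n.+1%:R * `|t - s|)) //.
  by rewrite ler_wpM2r // ler_nat.
rewrite mulrC -ltr_pdivlMr ?ltr0n //.
near: s; apply: (@cvgr_dist_lt _ _ _ (nbhs t) _ id) => //.
by rewrite divr_gt0 // ltr0n.
Unshelve. all: by end_near. Qed.

Lemma ramp_cvg t : ramp n t @[n --> \oo] --> ((0 < t)%R%:R : R).
Proof.
have [t0|t0] := leP t 0.
  rewrite (_ : (fun n => ramp n t) = fun=> 0); first exact: cvg_cst.
  by apply/funext => n; rewrite /ramp max_l // mulr0 min_r.
apply: cvg_near_cst; near=> n; rewrite /ramp max_r ?(ltW t0) // min_l // -ler_pdivrMr //.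
apply: (le_trans (ltW (archi_boundP _))); first by rewrite divr_ge0 // ltW.
by rewrite ler_nat; near: n; exact: nbhs_infty_ge.
Unshelve. all: by end_near. Qed.

Lemma continuous_subc (T : topologicalType) (f : T -> R) (c : R) :
  continuous f -> continuous (fun x => f x - c).
Proof. by move=> cf x; apply: cvgB; [exact: cf|exact: cvg_cst]. Qed.

Lemma continuous_cst (T : topologicalType) (c : R) : continuous ((fun=> c) : T -> R).
Proof. by move=> x; exact: cvg_cst. Qed.

Lemma continuous_prod (T : topologicalType) (I : Type) (r : seq I) (f : I -> T -> R) :
  (forall i, continuous (f i)) -> continuous (fun x => \prod_(i <- r) f i x).
Proof.
move=> cf; elim: r => [|i r ih] x.
  rewrite (_ : (fun x => _) = fun=> 1); first exact: cvg_cst.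
  by apply/funext => y; rewrite big_nil.
rewrite (_ : (fun x => _) = f i \* (fun x => \prod_(i <- r) f i x)).
  by apply: cvgM; [exact: cf|exact: ih].
by apply/funext => y; rewrite big_cons.
Qed.

Definition soft_half (n : nat) (c : half_index) (x : X) : R :=
  ramp n (lin c.1.2 (disc_val (x c.1.1)) - ratr c.2).

Lemma soft_half_continuous n c : continuous (soft_half n c).
Proof.
move=> x; apply: (@continuous_comp X R R
  (fun x => lin c.1.2 (disc_val (x c.1.1)) - ratr c.2) (ramp n)).
  by apply: continuous_subc; exact: continuous_coord.
exact: ramp_continuous.
Qed.

Lemma soft_half_cvg c (x : BX) : soft_half n c x @[n --> \oo] --> (\1_(half c) x : R).
Proof.
rewrite (_ : \1_(half c) x = (0 < lin c.1.2 (disc_val (x c.1.1)) - ratr c.2)%R%:R :> R).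
  exact: ramp_cvg.
rewrite indicE subr_gt0 (_ : (x \in half c) = (ratr c.2 < lin c.1.2 (disc_val (x c.1.1)))) //.
by apply/idP/idP; rewrite inE.
Qed.

Definition soft_cylinder (n : nat) (l : seq half_index) (x : X) : R :=
  \prod_(c <- l) soft_half n c x.

Lemma soft_cylinder_continuous n l : continuous (soft_cylinder n l).
Proof.
by apply: continuous_prod => c; exact: soft_half_continuous.
Qed.

Lemma soft_cylinder_bounds n l x : 0 <= soft_cylinder n l x <= 1.
Proof.
apply/andP; split; first by apply: prodr_ge0 => c _; exact: ramp_ge0.
by apply: prodr_ile1 => c _; rewrite ramp_ge0 ramp_le1.
Qed.

Lemma soft_cylinder_cvg l (x : BX) :
  soft_cylinder n l x @[n --> \oo] --> (\1_(cylinder l) x : R).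
Proof.
elim: l => [|c l ih].
  rewrite (_ : (fun n => _) = fun=> 1); last first.
    by apply/funext => n; rewrite /soft_cylinder big_nil.
  rewrite (_ : \1_(cylinder [::]) x = 1 :> R); first exact: cvg_cst.
  by rewrite cylinderE big_nil indicT.
rewrite (_ : \1_(cylinder (c :: l)) x = \1_(half c) x * \1_(cylinder l) x :> R); last first.
  by rewrite !cylinderE big_cons indicI.
rewrite (_ : (fun n => _) = fun n => soft_half n c x * soft_cylinder n l x).
  by apply: cvgM; [exact: soft_half_cvg|exact: ih].
by apply/funext => n; rewrite /soft_cylinder big_cons.
Qed.

Section System.
Variables (m : averaging) (a : BX) (N : nat -> nat) (mu : probability BX R).
Hypothesis N0 : forall k, (0 < N k)%N.
Hypothesis Nh : {homo N : i j / (i < j)%N}.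
Hypothesis cv :
  weak_star_cvg (fun k => avg_measure m (fun n => \d_(iter n S a)) (N k)) mu.

Lemma continuous_comp_shift (F : X -> R) : continuous F -> continuous (F \o S : X -> R).
Proof.
move=> /continuousP cF; apply/continuousP => A /cF oU.
have open_nbhs (B : set X) : B `<=` B^° -> open B by rewrite openE.
apply: open_nbhs => x Ux; have [l [lx lU]] := cylinder_base oU Ux.
pose l' := [seq (c.1.1 + 1, c.1.2, c.2) | c : half_index <- l].
have lS y : cylinder l' y -> cylinder l (S y).
  by move=> h c cl; exact: (h _ (map_f (fun c => (c.1.1 + 1, c.1.2, c.2)) cl)).
apply: (@filterS _ (nbhs (x : X)) _ (cylinder l')); first by move=> y /lS /lU.
apply: open_nbhs_nbhs; split; first exact: cylinder_open.
by move=> _ /mapP[c cl ->]; exact: (lx c cl).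
Qed.

(** Shifting changes an orbit sum by two boundary terms only. *)
Lemma integral_shift (F : X -> R) : continuous F -> (forall x, 0 <= F x <= 1) ->
  (\int[mu]_x (F (S x))%:E = \int[mu]_x (F x)%:E)%E.
Proof.
move=> cF F0; have cFS := continuous_comp_shift cF.
have F0S x : 0 <= (F \o S) x <= 1 by exact: F0.
have tel n : \sum_(i < n) (F (S (iter i.+1 S a)) - F (iter i.+1 S a))
    = F (iter n.+1 S a) - F (S a).
  rewrite -(big_mkord xpredT (fun i => F (S (iter i.+1 S a)) - F (iter i.+1 S a))).
  exact: (telescope_sumr (fun i => F (iter i.+1 S a)) (leq0n n)).
apply/eqP; rewrite eq_le; apply/andP; split.
  rewrite -[leRHS]adde0; apply: (@weak_limit_le _ m a N mu (F \o S) F 1 0 1) => // n.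
  rewrite mul0r add0r [leLHS]tel.
  by have /andP[] := F0 (iter n.+1 S a); have /andP[] := F0 (S a); lra.
rewrite -[leRHS]adde0; apply: (@weak_limit_le _ m a N mu F (F \o S) 1 0 1) => // n.
rewrite mul0r add0r (_ : \sum_(i < n) _ = - (F (iter n.+1 S a) - F (S a))).
  by have /andP[] := F0 (iter n.+1 S a); have /andP[] := F0 (S a); lra.
by rewrite -tel -sumrN; apply: eq_bigr => i _; rewrite opprB.
Qed.

Lemma integral_cylinder (h : BX -> BX) l : measurable_fun setT h ->
  (\int[mu]_x (soft_cylinder n l (h x))%:E)%E @[n --> \oo] --> mu (h @^-1` cylinder l).
Proof.
move=> mh.
have mc := measurable_cylinder l.
have mhc : measurable (h @^-1` cylinder l) by rewrite -[X in measurable X]setTI; exact: mh.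
rewrite -(setIT (h @^-1` _)) -integral_indic //.
apply: (@dominated_cvg _ _ _ mu setT measurableT
  (fun n x => (soft_cylinder n l (h x))%:E) _ (cst 1%:E)) => //.
- move=> n; apply/measurable_EFinP.
  by apply: (measurableT_comp _ mh); apply: measurable_continuous; exact: soft_cylinder_continuous.
- move=> x _; apply: cvg_EFin; first by near=> n.
  change (soft_cylinder n l (h x) @[n --> \oo] --> (\1_(cylinder l) (h x) : R)).
  exact: soft_cylinder_cvg.
- exact: finite_measure_integrable_cst.
- by move=> n x _ /=; rewrite lee_fin ger0_norm; have /andP[] := soft_cylinder_bounds n l (h x).
Unshelve. all: by end_near. Qed.

(** Cylinders form a pi-system, and the measure of a cylinder is a limit of
integrals of continuous functions. *)
Lemma shift_measure_preserving : measure_preserving mu S.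
Proof.
have mS := @measurable_shift R; split => //.
apply: (measure_unique (range (@cylinder R)) (fun=> setT) _ _ _ _ (pushforward mu S) mu).
- apply/seteqP; split; first exact: borel_generated_cylinders.
  apply: smallest_sub; first exact: sigma_algebra_measurable.
  by move=> _ [l _ <-]; exact: measurable_cylinder.
- move=> _ _ [l _ <-] [l' _ <-]; exists (l ++ l') => //.
  by rewrite !cylinderE big_cat.
- by move=> _; exists [::] => //; rewrite cylinderE big_nil.
- by apply/seteqP; split => // x _; exists 0%N.
- move=> _ [l _ <-]; rewrite /pushforward.
  have h1 := @integral_cylinder S l mS.
  have h2 := @integral_cylinder id l (@measurable_id _ _ _).
  suff E n : (\int[mu]_x (soft_cylinder n l (S x))%:E = \int[mu]_x (soft_cylinder n l x)%:E)%E.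
    move: h1; rewrite (_ : (fun n => _) = fun n => (\int[mu]_x (soft_cylinder n l x)%:E)%E).
      by move=> h1; exact: (cvg_unique _ h1 h2).
    by apply/funext.
  apply: (@integral_shift (soft_cylinder n l)).
    exact: soft_cylinder_continuous.
  by move=> x; exact: soft_cylinder_bounds.
- move=> _; apply: (@le_lt_trans _ _ 1%E); last exact: ltry.
  exact: (probability_le1 mu measurableT).
Qed.

Variable f : nat -> disc R.
Hypothesis af : forall n : nat, (0 < n)%N -> a n%:Z = f n.
Hypothesis f_mult : multiplicative_fun (fun n => disc_val (f n)).
Hypothesis f_pret : pretentious (fun n => disc_val (f n)).

Local Notation coord b k := (fun x : BX => lin b (disc_val (x k))).

Lemma measurable_coord b k : measurable_fun setT (coord b k).
Proof. by apply: measurable_continuous; exact: continuous_coord. Qed.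

Lemma lin_disc_le1 b (z : disc R) : `|lin b (disc_val z)| <= 1.
Proof.
rewrite -[lin b _]subr0 (_ : 0 = lin b 0); last by rewrite /lin /=; case: b.2; rewrite mulr0.
by rewrite (le_trans (dist_lin _ _ _)) // subr0 disc_nc_le1.
Qed.

Lemma continuous_dist (T : topologicalType) (u v : T -> R) :
  continuous u -> continuous v -> continuous (fun x => `|u x - v x|).
Proof. by move=> cu cv' x; apply: cvg_norm; apply: cvgB; [exact: cu|exact: cv']. Qed.

(** The integral of the coordinate distance is a limit of averages of terms that
are at most [nc (f (n + Q * k) - f n)]. *)
Lemma rap_coord0 b : rap mu S (coord b 0).
Proof.
split; first exact: measurable_coord.
move=> eps eps0.
have f1 n : nc (disc_val (f n)) <= 1 by exact: disc_nc_le1.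
have [Q Q0 hQ] := pretentious_almost_periodic f_mult f1 f_pret eps0.
exists Q => // k; have [C hC] := hQ k.
pose F (x : X) : R := `|lin b (disc_val (x (Q * k)%N%:Z)) - lin b (disc_val (x 0))|.
have -> : dist1 mu (fun x => lin b (disc_val (iter (Q * k) S x 0))) (coord b 0)
    = (\int[mu]_x (F x)%:E)%E.
  by apply: eq_integral => x _; rewrite /F iter_shift add0r.
have cF : continuous F by apply: continuous_dist; exact: continuous_coord.
have F2 x : 0 <= F x <= 2.
  rewrite normr_ge0 /F (le_trans (ler_normB _ _)) //.
  by rewrite -[2]/(1 + 1) lerD // lin_disc_le1.
have := @weak_limit_le _ m a N mu F (fun=> 0) 2 eps C N0 Nh cv cF _ F2 _ _.
rewrite integral0 add0e; apply.
- exact: continuous_cst.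
- by move=> _; rewrite lexx ler0n.
- move=> n; apply: le_trans (hC n); rewrite big_add1 /= big_mkord.
  apply: ler_sum => i _; rewrite -[S (iter i S a)]/(iter i.+1 S a) subr0 /F !iter_shift add0r.
  rewrite (le_trans (dist_lin _ _ _)) // -(af (n := i.+1)) // -(af (n := i.+1 + Q * k)%N) //.
  by rewrite -PoszD addnC.
Qed.

(** Any two coordinates are related by a power of the shift, applied on the side of
the one with the smaller index; the shift preserves the distance. *)
Lemma dist1_coord b k n :
  dist1 mu (fun x => coord b k (iter n S x)) (coord b k)
    = dist1 mu (fun x => coord b 0 (iter n S x)) (coord b 0).
Proof.
have mpS := shift_measure_preserving.
have mc j : measurable_fun setT (fun x => coord b j (iter n S x)).
  exact: (@measurable_comp_iter _ _ _ mu S mpS _ _ n (coord b j) (measurable_coord b j)).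
case: k => k.
  rewrite -[RHS](dist1_iter mpS k (mc _) (measurable_coord _ _)).
  by congr (dist1 mu _ _); apply/funext => x; rewrite !iter_shift; congr (lin b (disc_val (x _))); lia.
rewrite -[LHS](dist1_iter mpS k.+1 (mc _) (measurable_coord _ _)).
by congr (dist1 mu _ _); apply/funext => x; rewrite !iter_shift; congr (lin b (disc_val (x _))); lia.
Qed.

Lemma rap_coord b k : rap mu S (coord b k).
Proof.
split; first exact: measurable_coord.
move=> eps eps0; have [_ /(_ eps eps0)[Q Q0 hQ]] := rap_coord0 b.
by exists Q => // j; rewrite dist1_coord.
Qed.

(** A ramp of a coordinate is a Lipschitz function of it, and the ramps are bounded
and tend to the indicator. *)
Lemma rap_half c : rap_set mu S (half c).
Proof.
split; first exact: measurable_half.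
apply: (@rap_lim _ _ _ _ _ shift_measure_preserving _ (fun n x => soft_half n c x) 1).
- move=> n; have rc := rap_coord c.1.2 c.1.1.
  apply: (rap_lipschitz2 shift_measure_preserving (ler0n R n) _ rc rc).
    by apply: measurable_continuous; exact: soft_half_continuous.
  move=> x y; rewrite (le_trans (ramp_lipschitz _ _ _)) // ler_wpM2l //.
  by rewrite opprB addrA subrK lerDl.
- by move=> n x; rewrite ger0_norm ?ramp_ge0 ?ramp_le1.
- by move=> x; exact: soft_half_cvg.
Qed.

Lemma rap_borel A : measurable A -> rap_set mu S A.
Proof.
apply: (rap_generated shift_measure_preserving (G := range (@half R))).
  by move=> _ [c _ <-]; exact: rap_half.
exact: borel_generated_halves.
Qed.

End System.
End Systems.

Theorem theorem2p7 (R : realType) (f : nat -> disc R)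
    (f_mult : multiplicative_fun (fun n => disc_val (f n)))
    (f_pret : pretentious (fun n => disc_val (f n))) :
  forall (m : averaging) (mu : probability (@borel_seqspace R) R),
    furstenberg_system m f mu ->
    [/\ rational_discrete_spectrum mu seq_shift,
        ks_entropy mu seq_shift = 0%E
      & spectrum mu seq_shift `&` irrational = set0].
Proof.
move=> m mu [a [N [af N0 Nh cv]]].
have mpS := shift_measure_preserving N0 Nh cv.
have rall := rap_borel N0 Nh cv af f_mult f_pret.
split; first exact: rap_rational_discrete_spectrum.
- exact: rap_ks_entropy_eq0.
- exact: rap_no_irrational_spectrum.
Qed.
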